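(* Let $k$ be an algebraically closed field and let $\mathcal{C}$ be a Krull-Schmidt, Hom-finite, $k$-linear triangulated category such that for every pair of objects $M$ and $N$ of $\mathcal{C}$ we have $\operatorname{Hom}_{\mathcal{C}}(M,N[i])\neq 0$ for only finitely many $i\in\mathbb{Z}$. (1) The expression $$\langle M,N\rangle^t:=\sum_{i\in\mathbb{Z}}t^i\dim_k\operatorname{Hom}_{\mathcal{C}}(M,N[i])$$ for objects $M,N$, extended sesquilinearly, gives a well-defined sesquilinear form $\langle\,,\,\rangle^t$ on $A(\mathcal{C})^t$ (with values in $\mathbb{Z}[t,t^{-1}]$) and on $A_{\mathbb{Q}}(\mathcal{C})^t$ (with values in $\mathbb{Q}(t)$). (2) Let $X\to Y\to Z\to X[1]$ be an Auslander-Reiten triangle in $\mathcal{C}$. Define $\hat Z=X+Z-Y$ and let $M$ be an indecomposable object of $\mathcal{C}$. We have $$\langle M,\hat Z\rangle^t=\begin{cases}0&\text{unless }M\cong Z[i]\text{ for some }i,\\ 1+t&\text{if }M\cong Z.\end{cases}$$ Thus the element $\frac{1}{1+t}\hat Z$ is dual on the right to $Z$ in $A_{\mathbb{Q}}(\mathcal{C})^t$. Similarly $$\langle\hat Z,M\rangle^t=\begin{cases}0&\text{unless }M\cong X[i]\text{ for some }i,\\ 1+t^{-1}&\text{if }M\cong X,\end{cases}$$ so that the element $\frac{1}{1+t^{-1}}\hat Z$ is dual on the left to $X$ in $A_{\mathbb{Q}}(\mathcal{C})^t$. (3) When $\mathcal{C}=D^b(\Lambda\text{-proj})$ is the category of perfect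 complexes for a symmetric algebra $\Lambda$, the form is Hermitian, in the sense that $\langle M,N\rangle^t=\overline{\langle N,M\rangle^t}$ always. (4) When $\mathcal{C}=D^b(kG\text{-proj})$ is the category of perfect complexes for a group algebra $kG$ of a finite group $G$, we have $$\langle M\otimes_kU,N\rangle^t=\langle M,U^*\otimes_kN\rangle^t\qquad\text{and}\qquad\langle M,N\rangle^t=\langle M^*,N^*\rangle^t$$ for objects $M,N,U$ of $\mathcal{C}$, where $U^*,M^*,N^*$ denote the dual complexes of $kG$-modules.
   Context: Hom-finite means that all Hom spaces are finite-dimensional over $k$. Krull-Schmidt means that indecomposable objects have local endomorphism rings and every object is a finite direct sum of indecomposables (unique up to isomorphism and order). $A(\mathcal{C})$ is the free abelian group with basis the isomorphism classes $[C]$ of indecomposable objects of $\mathcal{C}$; if $C\cong C_1\oplus\cdots\oplus C_n$ one puts $[C]=[C_1]+\cdots+[C_n]$. With $t$ an indeterminate, define $A(\mathcal{C})^t:=(\mathbb{Z}[t,t^{-1}]\otimes_{\mathbb{Z}}A(\mathcal{C}))/I$, where $I$ is the $\mathbb{Z}[t,t^{-1}]$-submodule generated by the elements $1\otimes[M[i]]-t^i\otimes[M]$ for all objects $M$ and $i\in\mathbb{Z}$, and $A_{\mathbb{Q}}(\mathcal{C})^t:=\mathbb{Q}(t)\otimes_{\mathbb{Z}[t,t^{-1}]}A(\mathcal{C})^t$. The image of $t^i\otimes[M]$ in either is written $t^iM$ (and that of $1\otimes[M]$ is written $M$), so that $M[i]=t^iM$. $\overline{\phantom{x}}$ denotes the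 ring automorphism of $\mathbb{Z}[t,t^{-1}]$ and of $\mathbb{Q}(t)$ with $t\mapsto t^{-1}$. Sesquilinear means: $\langle a_1M_1+a_2M_2,N\rangle^t=a_1\langle M_1,N\rangle^t+a_2\langle M_2,N\rangle^t$ and $\langle M,b_1N_1+b_2N_2\rangle^t=\overline{b_1}\langle M,N_1\rangle^t+\overline{b_2}\langle M,N_2\rangle^t$ for scalars $a_i,b_i$. An element $u$ is dual on the right to an indecomposable $Z$ if $\langle Z,u\rangle^t=1$ and $\langle M,u\rangle^t=0$ for every indecomposable $M$ not isomorphic to a shift of $Z$; it is dual on the left to $X$ if $\langle u,X\rangle^t=1$ and $\langle u,M\rangle^t=0$ for every indecomposable $M$ not isomorphic to a shift of $X$. An Auslander-Reiten triangle is a distinguished triangle $X\xrightarrow{\alpha} Y\xrightarrow{\beta} Z\xrightarrow{\gamma} X[1]$ with $X$ and $Z$ indecomposable, $\gamma\neq 0$, such that every morphism $W\to Z$ that is not a split epimorphism factors through $\beta$. $D^b(\Lambda\text{-proj})$ is the homotopy category of perfect complexes, i.e. of finite complexes of finitely generated projective $\Lambda$-modules. A finite-dimensional $k$-algebra $\Lambda$ is symmetric if $\Lambda\cong\operatorname{Hom}_k(\Lambda,k)$ as $\Lambda$-bimodules. For complexes of $kG$-modules, $\otimes_k$ carries the diagonal $G$-action and $*$ denotes the $k$-dual complex with the contragredient action.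
   Formalization: Corrected false formulas: in (2) the right dual of Z is Ẑ/(1+t⁻¹), ⟨Ẑ,M⟩ is 1+t if M≅X, and the left dual of X is Ẑ/(1+t); in (4) the second identity reads ⟨M,N⟩=⟨N*,M*⟩, equal to the conjugate of ⟨M*,N*⟩. *)

(* Defs.v *)
From HB Require Import structures.
From mathcomp Require Import all_boot all_order all_fingroup all_algebra all_field.
From mathcomp Require Import generic_quotient ring_quotient.
From mathcomp Require Import boolp classical_sets functions cardinality fsbigop.
From mathcomp Require Import freeg mxtens.

Set Implicit Arguments.
Unset Strict Implicit.
Unset Printing Implicit Defensive.

Import GRing.Theory.
Local Open Scope ring_scope.
Local Open Scope quotient_scope.
Local Open Scope classical_set_scope.

Inductive submod_gen (R : pzRingType) (V : lmodType R) (P : set V) : set V :=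
| SubmodIn v : P v -> submod_gen P v
| Submod0 : submod_gen P 0
| SubmodLin a u v : submod_gen P u -> submod_gen P v -> submod_gen P (a *: u + v).

Section QuotMod.
Variables (R : pzRingType) (V : lmodType R) (P : set V).

Definition submod_pred : {pred V} := fun v => `[< submod_gen P v >].

Fact submod_pred_closed : submod_closed submod_pred.
Proof.
split; first by apply/asboolP; exact: Submod0.
by move=> a u v /asboolP hu /asboolP hv; apply/asboolP; exact: SubmodLin.
Qed.

HB.instance Definition _ :=
  GRing.isSubmodClosed.Build R V submod_pred submod_pred_closed.

(* V modulo the submodule generated by P *)
Definition quotmod : Type := Quotient.quot submod_pred.
HB.instance Definition _ := GRing.Zmodule.on quotmod.

Definition qcls (v : V) : quotmod := \pi_(Quotient.quot submod_pred) v.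
Definition qrep (x : quotmod) : V := repr (x : Quotient.quot submod_pred).

Lemma qrepK : cancel qrep qcls. Proof. exact: reprK. Qed.

Lemma qcls_eq u v : qcls u = qcls v <-> submod_gen P (u - v).
Proof.
rewrite /qcls; split.
  by move/eqP; rewrite -Quotient.idealrBE => /asboolP.
by move=> h; apply/eqP; rewrite -Quotient.idealrBE; apply/asboolP.
Qed.

Definition qscale (a : R) (x : quotmod) : quotmod := qcls (a *: qrep x).

Lemma qclsB u v : qcls (u - v) = qcls u - qcls v.
Proof. by rewrite /qcls; rewrite !piE. Qed.
Lemma qclsD u v : qcls (u + v) = qcls u + qcls v.
Proof. by rewrite /qcls; rewrite !piE. Qed.

Lemma submod_genZ a u : submod_gen P u -> submod_gen P (a *: u).
Proof. by move=> h; rewrite -[_ *: _]addr0; apply: SubmodLin h (Submod0 _). Qed.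

Lemma qscaleE a u : qscale a (qcls u) = qcls (a *: u).
Proof.
apply/qcls_eq; rewrite -scalerBr; apply: submod_genZ.
by apply/qcls_eq; rewrite qrepK.
Qed.

Fact qscaleA a b v : qscale a (qscale b v) = qscale (a * b) v.
Proof. by rewrite -(qrepK v) !qscaleE scalerA. Qed.
Fact qscale1 : left_id 1 qscale.
Proof. by move=> v; rewrite -(qrepK v) !qscaleE scale1r. Qed.
Fact qscaleDr : right_distributive qscale +%R.
Proof.
by move=> a u v; rewrite -(qrepK u) -(qrepK v) -qclsD !qscaleE scalerDr qclsD.
Qed.
Fact qscaleDl v : {morph qscale^~ v : a b / a + b}.
Proof. by move=> a b; rewrite -(qrepK v) !qscaleE scalerDl qclsD. Qed.

HB.instance Definition _ :=
  GRing.Zmodule_isLmodule.Build R quotmod qscaleA qscale1 qscaleDr qscaleDl.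

Fact qcls_is_linear : linear qcls.
Proof. by move=> a u v; rewrite qclsD -qscaleE. Qed.
HB.instance Definition _ := GRing.isLinear.Build R V quotmod _ qcls qcls_is_linear.

End QuotMod.

Section ExtScalars.
Variables (R : nzRingType) (S : comNzRingType) (phi : {rmorphism R -> S}) (V : lmodType R).

(* S (x)_R V along phi, presented as the free S-module on symbols 1 (x) v modulo
   the R-linearity of v |-> 1 (x) v; [tens s v] is s (x) v. *)
Definition ext_rel : set {freeg V / S} := fun x =>
  exists (r : R) (u v : V),
   x = << r *: u + v >> - (phi r *: << u >> + << v >>).
Definition extsc := quotmod ext_rel.
HB.instance Definition _ := GRing.Lmodule.on extsc.
Definition tens (s : S) (v : V) : extsc := s *: qcls ext_rel << v >>.
End ExtScalars.

Definition Qt : fieldType := {fraction {poly rat}}.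
Definition qT : Qt := tofrac 'X.

Lemma qT_neq0 : qT != 0. Proof. by rewrite tofrac_eq0 polyX_eq0. Qed.

(* image of Z[t] in Q(t) *)
Definition qpoly (p : {poly int}) : Qt := tofrac (map_poly intr p).

Lemma qpolyB p q : qpoly (p - q) = qpoly p - qpoly q.
Proof. by rewrite /qpoly !rmorphB. Qed.
Lemma qpolyM p q : qpoly (p * q) = qpoly p * qpoly q.
Proof. by rewrite /qpoly !rmorphM. Qed.
Lemma qpolyX n : qpoly 'X^n = qT ^+ n.
Proof. by rewrite /qpoly map_polyXn rmorphXn. Qed.

(* Z[t,t^-1] is realised as a subring of Q(t). *)
Definition is_laurent : {pred Qt} :=
  fun x => `[< exists (n : nat) (p : {poly int}), x = qpoly p / qT ^+ n >].

Fact is_laurent_subring : subring_closed is_laurent.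
Proof.
split.
- by apply/asboolP; exists 0%N, 1; rewrite expr0 divr1 /qpoly !rmorph1.
- move=> x y /asboolP[n [p ->]] /asboolP[m [q ->]]; apply/asboolP.
  exists (n + m)%N, (p * 'X^m - q * 'X^n).
  rewrite qpolyB !qpolyM !qpolyX exprD.
  have h i : qT ^+ i != 0 by rewrite expf_neq0 // qT_neq0.
  by rewrite mulrBl; congr (_ - _); [rewrite -mulf_div divff ?mulr1| rewrite [X in _ = _ / X]mulrC -mulf_div divff ?mulr1].
- move=> x y /asboolP[n [p ->]] /asboolP[m [q ->]]; apply/asboolP.
  by exists (n + m)%N, (p * q); rewrite mulf_div -exprD qpolyM.
Qed.
HB.instance Definition _ := GRing.isSubringClosed.Build Qt is_laurent is_laurent_subring.

Record laurent := Laurent { lval : Qt; lvalP : lval \in is_laurent }.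
HB.instance Definition _ := [isSub for lval].
HB.instance Definition _ := [Choice of laurent by <:].
HB.instance Definition _ := [SubChoice_isSubComNzRing of laurent by <:].
Fact lval_zmod : zmod_morphism lval. Proof. by []. Qed.
Fact lval_monoid : monoid_morphism lval. Proof. by []. Qed.
HB.instance Definition _ := GRing.isZmodMorphism.Build laurent Qt lval lval_zmod.
HB.instance Definition _ := GRing.isMonoidMorphism.Build laurent Qt lval lval_monoid.

Fact laurentT_subproof (i : int) : qT ^ i \in is_laurent.
Proof.
apply/asboolP; case: i => n.
  by exists 0%N, 'X^n; rewrite expr0 divr1 qpolyX.
by exists n.+1, 1; rewrite /qpoly !rmorph1 mul1r.
Qed.
(* the monomial t^i *)
Definition lT (i : int) : laurent := Laurent (laurentT_subproof i).

(* p(t^-1); [qconj] is the automorphism of Q(t) with t |-> t^-1. *)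
Definition inv_eval (p : {poly rat}) : Qt :=
  (map_poly (@tofrac {poly rat} \o polyC) p).[qT^-1].
Definition qconj (x : Qt) : Qt :=
  inv_eval \n_(repr x) / inv_eval \d_(repr x).

Fact inv_eval_monoid : monoid_morphism inv_eval.
Proof.
by split=> [|p q]; rewrite /inv_eval ?rmorph1 ?hornerC ?rmorphM ?hornerM.
Qed.
Fact inv_eval_zmod : zmod_morphism inv_eval.
Proof. by move=> p q; rewrite /inv_eval rmorphB hornerD hornerN. Qed.
HB.instance Definition _ := GRing.isZmodMorphism.Build _ _ inv_eval inv_eval_zmod.
HB.instance Definition _ := GRing.isMonoidMorphism.Build _ _ inv_eval inv_eval_monoid.

Lemma inv_eval_rev (p : {poly rat}) :
  inv_eval p * qT ^+ (size p).-1 = tofrac (\poly_(i < size p) p`_(size p - i.+1)).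
Proof.
rewrite /inv_eval horner_coef size_map_poly poly_def rmorph_sum mulr_suml.
rewrite (reindex_inj rev_ord_inj) /=; apply: eq_bigr => i _.
rewrite coef_map -mul_polyC rmorphM /= -mulrA; congr (_ * _).
rewrite rmorphXn /= -/qT exprVn.
have -> : (size p).-1 = (size p - i.+1 + i)%N.
  by rewrite -{1}(subnK (ltn_ord i)) addnS.
by rewrite exprD mulKf // expf_neq0 // qT_neq0.
Qed.

Lemma inv_eval_eq0 p : (inv_eval p == 0) = (p == 0).
Proof.
apply/eqP/eqP=> [h|->]; last by rewrite rmorph0.
apply/eqP; rewrite -lead_coef_eq0; apply/eqP.
have /eqP := inv_eval_rev p; rewrite h mul0r eq_sym tofrac_eq0 => /eqP h'.
have [->|p0] := eqVneq p 0; first by rewrite lead_coef0.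
have := congr1 (fun q : {poly rat} => q`_0) h'.
by rewrite coef_poly coef0 size_poly_gt0 p0 lead_coefE subn1.
Qed.



Lemma fracE (x : Qt) : x = tofrac \n_(repr x) / tofrac \d_(repr x).
Proof.
have h (r : {ratio {poly rat}}) :
    \pi_{fraction {poly rat}} r * tofrac \d_r = tofrac \n_r.
  apply/eqP; rewrite !piE /= /equivf /FracField.mulf !numden_Ratio ?mulf_neq0 ?oner_eq0 ?denom_ratioP //.
  by rewrite !mulr1 mulrC.
have d0 : tofrac \d_(repr x) != 0 by rewrite tofrac_eq0; exact: denom_ratioP.
by rewrite -h reprK mulfK.
Qed.


Lemma inv_evalM p q : inv_eval (p * q) = inv_eval p * inv_eval q.
Proof. exact: rmorphM. Qed.

Lemma qconj_frac p q : q != 0 ->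
  qconj (tofrac p / tofrac q) = inv_eval p / inv_eval q.
Proof.
move=> q0; rewrite /qconj; set x := tofrac p / tofrac q.
have d0 : \d_(repr x) != 0 by exact: denom_ratioP.
have := fracE x; rewrite {1}/x => /eqP.
rewrite eqr_div ?tofrac_eq0 // -!tofracM tofrac_eq => /eqP e.
by apply/eqP; rewrite eqr_div ?inv_eval_eq0 // -!inv_evalM /= e.
Qed.

Fact qconj_zmod : zmod_morphism qconj.
Proof.
move=> x y; rewrite (fracE x) (fracE y).
have dx : \d_(repr x) != 0 by exact: denom_ratioP.
have dy : \d_(repr y) != 0 by exact: denom_ratioP.
rewrite -mulNr addf_div ?tofrac_eq0 // -!tofracM -tofracN -!tofracM -tofracD.
rewrite !qconj_frac ?mulf_neq0 // -mulNr addf_div ?inv_eval_eq0 //.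
by rewrite rmorphD /= !inv_evalM rmorphN.
Qed.

Fact qconj_monoid : monoid_morphism qconj.
Proof.
split=> [|x y].
  have -> : 1 = tofrac 1 / tofrac 1 :> Qt by rewrite tofrac1 divr1.
  by rewrite qconj_frac ?oner_eq0 // rmorph1 divr1.
rewrite (fracE x) (fracE y).
have dx : \d_(repr x) != 0 by exact: denom_ratioP.
have dy : \d_(repr y) != 0 by exact: denom_ratioP.
by rewrite mulf_div -!tofracM !qconj_frac ?mulf_neq0 // !inv_evalM mulf_div.
Qed.

HB.instance Definition _ := GRing.isZmodMorphism.Build Qt Qt qconj qconj_zmod.
HB.instance Definition _ := GRing.isMonoidMorphism.Build Qt Qt qconj qconj_monoid.

Lemma qconj_tofrac p : qconj (tofrac p) = inv_eval p.
Proof.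
have {1}-> : tofrac p = tofrac p / tofrac 1 by rewrite tofrac1 divr1.
by rewrite qconj_frac ?oner_eq0 // rmorph1 divr1.
Qed.

Lemma qconjT : qconj qT = qT^-1.
Proof. by rewrite qconj_tofrac /inv_eval map_polyX hornerX. Qed.

Lemma qconjK : involutive qconj.
Proof.
suff h p : qconj (inv_eval p) = tofrac p.
  move=> x; have -> : qconj x = inv_eval \n_(repr x) / inv_eval \d_(repr x) by [].
  by rewrite fmorph_div /= !h -fracE.
rewrite /inv_eval horner_coef size_map_poly rmorph_sum -[in RHS](coefK p).
rewrite poly_def rmorph_sum; apply: eq_bigr => i _.
rewrite coef_map rmorphM rmorphXn /= fmorphV /= qconjT invrK.
by rewrite qconj_tofrac /inv_eval map_polyC hornerC -mul_polyC tofracM tofracXn.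
Qed.

Fact qconj_laurent (x : laurent) : qconj (lval x) \in is_laurent.
Proof.
have TL i : qT ^ i \in is_laurent := laurentT_subproof i.
have : lval x \in is_laurent by exact: lvalP.
move=> /asboolP[n [p ->]].
rewrite fmorph_div rmorphXn /= qconjT exprVn invrK.
apply: rpredM; last exact: (TL n).
rewrite qconj_tofrac /inv_eval horner_coef rpred_sum // => i _.
rewrite exprVn rpredM //; last by have := TL (- (i%:Z)); rewrite -invr_expz.
rewrite coef_map; apply/asboolP; exists 0%N, (p`_i)%:P.
by rewrite expr0 divr1 /qpoly map_polyC coef_map.
Qed.
Definition lconj (x : laurent) : laurent := Laurent (qconj_laurent x).

Record lincat (k : fieldType) := Lincat {
  obj :> Type;
  mor : obj -> obj -> lmodType k;
  mid : forall X, mor X X;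
  mcomp : forall X Y Z, mor Y Z -> mor X Y -> mor X Z;
  mcomp_linearl : forall X Y Z (f : mor X Y), linear (fun g : mor Y Z => mcomp g f);
  mcomp_linearr : forall X Y Z (g : mor Y Z), linear (fun f : mor X Y => mcomp g f);
  mcomp1m : forall X Y (f : mor X Y), mcomp (mid Y) f = f;
  mcompm1 : forall X Y (f : mor X Y), mcomp f (mid X) = f;
  mcompA : forall X Y Z W (h : mor Z W) (g : mor Y Z) (f : mor X Y),
    mcomp h (mcomp g f) = mcomp (mcomp h g) f
}.

Notation "g \oc f" := (mcomp g f) (at level 40, left associativity).

Record linfunctor (k : fieldType) (C D : lincat k) := Linfunctor {
  fobj :> C -> D;
  fmap : forall X Y, mor X Y -> mor (fobj X) (fobj Y);
  fmap_linear : forall X Y, linear (@fmap X Y);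
  fmap_id : forall X, fmap (mid X) = mid (fobj X);
  fmap_comp : forall X Y Z (g : mor Y Z) (f : mor X Y),
    fmap (g \oc f) = fmap g \oc fmap f
}.

Section Basic.
Variables (k : fieldType) (C : lincat k).
Implicit Types X Y Z : C.

Definition is_iso X Y (f : mor X Y) : Prop :=
  exists g : mor Y X, g \oc f = mid X /\ f \oc g = mid Y.

Definition isomorphic X Y : Prop := exists f : mor X Y, is_iso f.

Definition is_zero_obj X : Prop := mid X = 0.

(* X is the direct sum of the A i; for I empty this says that X is a zero
   object. *)
Definition is_dsum (I : finType) (A : I -> C) X : Prop :=
  exists (inj : forall i, mor (A i) X) (prj : forall i, mor X (A i)),
  [/\ forall i, prj i \oc inj i = mid (A i),
      forall i j, i != j -> prj j \oc inj i = 0 &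
      \sum_i inj i \oc prj i = mid X].

Definition is_biprod X Y Z : Prop := is_dsum (fun b : bool => if b then X else Y) Z.

Definition indec X : Prop :=
  ~ is_zero_obj X /\
  forall Y Z, is_biprod Y Z X -> is_zero_obj Y \/ is_zero_obj Z.

Definition local_end X : Prop :=
  mid X <> 0 /\
  forall f g : mor X X, is_iso (f + g) -> is_iso f \/ is_iso g.

Record krull_schmidt : Prop := KrullSchmidt {
  ks_local : forall X, indec X -> local_end X;
  ks_exists : forall X, exists (n : nat) (A : 'I_n -> C),
    (forall i, indec (A i)) /\ is_dsum A X;
  ks_unique : forall X n m (A : 'I_n -> C) (B : 'I_m -> C),
    (forall i, indec (A i)) -> (forall i, indec (B i)) ->
    is_dsum A X -> is_dsum B X ->
    exists2 s : 'I_n -> 'I_m, bijective s & forall i, isomorphic (A i) (B (s i))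
}.

Definition split_epi X Y (f : mor X Y) : Prop :=
  exists g : mor Y X, f \oc g = mid Y.
End Basic.

Definition has_dim (k : fieldType) (V : lmodType k) (n : nat) : Prop :=
  inhabited (Vector.axiom n V).
Definition finite_dim (k : fieldType) (V : lmodType k) : Prop :=
  exists n, has_dim V n.
(* 0 when V is not finite dimensional *)
Definition dimk (k : fieldType) (V : lmodType k) : nat := xget 0%N [set n | has_dim V n].

(* A category with an autoequivalence [1], given with a quasi-inverse [-1]. *)
Record shiftcat (k : fieldType) := Shiftcat {
  scat :> lincat k;
  sh : linfunctor scat scat;
  ush : linfunctor scat scat;
  sh_unit : forall X, mor X (ush (sh X));
  sh_counit : forall X, mor (sh (ush X)) X;
  sh_unit_iso : forall X, is_iso (sh_unit X);
  sh_counit_iso : forall X, is_iso (sh_counit X);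
  sh_unit_nat : forall X Y (f : mor X Y),
    fmap ush (fmap sh f) \oc sh_unit X = sh_unit Y \oc f;
  sh_counit_nat : forall X Y (f : mor X Y),
    f \oc sh_counit X = sh_counit Y \oc fmap sh (fmap ush f)
}.

Section Triang.
Variables (k : fieldType) (C : shiftcat k).
Implicit Types X Y Z : C.

Definition shz (X : C) (i : int) : C :=
  match i with
  | Posz n => iter n (sh C) X
  | Negz n => iter n.+1 (ush C) X
  end.

Definition hom_finite : Prop := forall X Y, finite_dim (mor X Y).

Definition hom_bounded : Prop := forall M N : C,
  finite_set [set i : int | exists f : mor M (shz N i), f != 0].

Definition triangle_class := forall X Y Z, mor X Y -> mor Y Z -> mor Z (sh C X) -> Prop.

Record triangulated (dist : triangle_class) : Prop := Triangulated {
  tr_zero : exists O : C, is_zero_obj O;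
  tr_biprod : forall X Y, exists Z, is_biprod X Y Z;
  tr_iso : forall X Y Z (f : mor X Y) (g : mor Y Z) (h : mor Z (sh C X))
      X' Y' Z' (f' : mor X' Y') (g' : mor Y' Z') (h' : mor Z' (sh C X'))
      (u : mor X X') (v : mor Y Y') (w : mor Z Z'),
    is_iso u -> is_iso v -> is_iso w ->
    f' \oc u = v \oc f -> g' \oc v = w \oc g -> h' \oc w = fmap (sh C) u \oc h ->
    dist _ _ _ f g h -> dist _ _ _ f' g' h';
  tr_id : forall X O, is_zero_obj O ->
    dist X X O (mid X) 0 0;
  tr_cone : forall X Y (f : mor X Y), exists Z (g : mor Y Z) (h : mor Z (sh C X)),
    dist _ _ _ f g h;
  tr_rot : forall X Y Z (f : mor X Y) (g : mor Y Z) (h : mor Z (sh C X)),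
    dist _ _ _ f g h <-> dist _ _ _ g h (- fmap (sh C) f);
  tr_fill : forall X Y Z (f : mor X Y) (g : mor Y Z) (h : mor Z (sh C X))
      X' Y' Z' (f' : mor X' Y') (g' : mor Y' Z') (h' : mor Z' (sh C X'))
      (u : mor X X') (v : mor Y Y'),
    dist _ _ _ f g h -> dist _ _ _ f' g' h' -> f' \oc u = v \oc f ->
    exists w : mor Z Z', g' \oc v = w \oc g /\ h' \oc w = fmap (sh C) u \oc h;
  tr_octahedron : forall X Y Z X' Y' Z' (f : mor X Y) (g : mor Y Z)
      (f1 : mor Y Z') (f2 : mor Z' (sh C X))
      (g1 : mor Z X') (g2 : mor X' (sh C Y))
      (h1 : mor Z Y') (h2 : mor Y' (sh C X)),
    dist _ _ _ f f1 f2 -> dist _ _ _ g g1 g2 -> dist _ _ _ (g \oc f) h1 h2 ->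
    exists (u : mor Z' Y') (v : mor Y' X'),
      [/\ dist _ _ _ u v (fmap (sh C) f1 \oc g2),
          u \oc f1 = h1 \oc g, h2 \oc u = f2,
          v \oc h1 = g1 & g2 \oc v = fmap (sh C) f \oc h2]
}.

Definition AR_triangle (dist : triangle_class) X Y Z
    (a : mor X Y) (b : mor Y Z) (c : mor Z (sh C X)) : Prop :=
  [/\ dist X Y Z a b c, indec X, indec Z, c <> 0 &
      forall W (f : mor W Z), ~ split_epi f -> exists g : mor W Y, f = b \oc g].

(* The sum has finite support under [hom_bounded]. *)
Definition lform (M N : C) : laurent :=
  \sum_(i \in [set: int]) lT i *+ dimk (mor M (shz N i)).

Definition isoclass := {c : set C | exists2 X, indec X & c = [set Y | isomorphic X Y]}.
HB.instance Definition _ := gen_eqMixin isoclass.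
HB.instance Definition _ := gen_choiceMixin isoclass.

Definition icls X (hX : indec X) : isoclass :=
  exist _ [set Y | isomorphic X Y] (ex_intro2 _ _ X hX erefl).

Definition Agrp := {freeg isoclass / int}.

(* [M] = [A_0] + ... + [A_(n-1)] for a decomposition of M into indecomposables;
   independent of the choice in a Krull-Schmidt category. *)
Definition Acls (M : C) : Agrp :=
  xget 0 [set a | exists n (A : 'I_n -> C) (hA : forall i, indec (A i)),
    is_dsum A M /\ a = \sum_i << icls (hA i) >>].

Definition ALt := extsc (intr : int -> laurent) Agrp.
Definition At_rel : set ALt := [set x | exists (M : C) (i : int),
  x = tens intr 1 (Acls (shz M i)) - tens intr (lT i) (Acls M)].
Definition At := quotmod At_rel.
HB.instance Definition _ := GRing.Lmodule.on At.

Definition AQt := extsc lval At.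
HB.instance Definition _ := GRing.Lmodule.on AQt.

Definition Atcls (M : C) : At := qcls At_rel (tens intr 1 (Acls M)).
Definition AQtcls (M : C) : AQt := tens lval 1 (Atcls M).
End Triang.

Definition is_sesquilinear (R : comNzRingType) (cj : R -> R) (V : lmodType R) (f : V -> V -> R) : Prop :=
  (forall a1 a2 x1 x2 y, f (a1 *: x1 + a2 *: x2) y = a1 * f x1 y + a2 * f x2 y) /\
  (forall b1 b2 x y1 y2, f x (b1 *: y1 + b2 *: y2) = cj b1 * f x y1 + cj b2 * f x y2).

Definition hform (k : fieldType) (C : shiftcat k) (f : At C -> At C -> laurent) : Prop :=
  is_sesquilinear lconj f /\ forall M N : C, f (Atcls M) (Atcls N) = lform M N.
Definition hformQ (k : fieldType) (C : shiftcat k) (f : AQt C -> AQt C -> Qt) : Prop :=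
  is_sesquilinear qconj f /\ forall M N : C, f (AQtcls M) (AQtcls N) = lval (lform M N).

(* The form is conjugate-linear on the right, so F M (c *: u) = qconj c * F M u:
   when F Z u = 1 + t, the multiple of u dual to Z is (1 + t^-1)^-1 *: u. *)
Definition dual_right (k : fieldType) (C : shiftcat k) (F : AQt C -> AQt C -> Qt)
    (u : AQt C) (Z : C) : Prop :=
  F (AQtcls Z) u = 1 /\
  forall M : C, indec M -> ~ (exists i, isomorphic M (shz Z i)) ->
    F (AQtcls M) u = 0.

Definition dual_left (k : fieldType) (C : shiftcat k) (F : AQt C -> AQt C -> Qt)
    (u : AQt C) (X : C) : Prop :=
  F u (AQtcls X) = 1 /\
  forall M : C, indec M -> ~ (exists i, isomorphic M (shz X i)) ->
    F u (AQtcls M) = 0.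

Section Modules.
Variables (k : fieldType) (L : falgType k).

(* Finite-dimensional left L-modules in coordinates: k^n as column vectors, with
   a acting by v |-> mdact a *m v. Over a finite-dimensional algebra these are
   the finitely generated modules. *)
Record fdmod := Fdmod {
  mdim : nat;
  mdact : L -> 'M[k]_mdim;
  mdact_linear : linear mdact;
  mdact1 : mdact 1 = 1%:M;
  mdactM : forall a b, mdact (a * b) = mdact a *m mdact b
}.

Definition is_modhom (U V : fdmod) (f : 'M[k]_(mdim V, mdim U)) : Prop :=
  forall a, f *m mdact U a = mdact V a *m f.

Definition projective (P : fdmod) : Prop :=
  forall (U V : fdmod) (p : 'M[k]_(mdim V, mdim U)) (f : 'M[k]_(mdim V, mdim P)),
    is_modhom p -> (forall v : 'cV[k]_(mdim V), exists u, p *m u = v) ->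
    is_modhom f ->
    exists2 g : 'M[k]_(mdim U, mdim P), is_modhom g & p *m g = f.

End Modules.
Arguments is_modhom [k L] U V f.

Definition homogeneous (k : fieldType) (m n : nat) (dX : 'I_m -> int) (dY : 'I_n -> int)
    (r : int) (f : 'M[k]_(n, m)) : Prop :=
  forall i j, f i j != 0 -> dY i = dX j + r.

Section Homogeneous.
Variables (k : fieldType).

Lemma homogeneous_lin m n (dX : 'I_m -> int) (dY : 'I_n -> int) r c
    (f g : 'M[k]_(n, m)) :
  homogeneous dX dY r f -> homogeneous dX dY r g -> homogeneous dX dY r (c *: f + g).
Proof.
move=> hf hg i j; rewrite !mxE => h.
have [f0|/hf//] := eqVneq (f i j) 0; apply: hg.
by apply: contraNneq h => ->; rewrite f0 mulr0 addr0.
Qed.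

Lemma homogeneous0 m n (dX : 'I_m -> int) (dY : 'I_n -> int) r :
  homogeneous dX dY r (0 : 'M[k]_(n, m)).
Proof. by move=> i j; rewrite mxE eqxx. Qed.

Lemma homogeneous1 m (dX : 'I_m -> int) : homogeneous dX dX 0 (1%:M : 'M[k]_m).
Proof.
by move=> i j; rewrite mxE addr0; case: (eqVneq i j) => [->|_] //; rewrite eqxx.
Qed.

Lemma homogeneousM m n p (dX : 'I_m -> int) (dY : 'I_n -> int) (dZ : 'I_p -> int) r s
    (g : 'M[k]_(p, n)) (f : 'M[k]_(n, m)) :
  homogeneous dY dZ s g -> homogeneous dX dY r f ->
  homogeneous dX dZ (r + s) (g *m f).
Proof.
move=> hg hf i j; rewrite mxE => h.
have [l] : exists l, g i l * f l j != 0.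
  apply/existsP; apply: contraNT h => /existsPn h; rewrite big1 // => l _.
  by apply/eqP; have := h l; rewrite negbK.
by rewrite mulf_eq0 negb_or => /andP[/hg -> /hf ->]; rewrite addrA.
Qed.
End Homogeneous.

Section Complexes.
Variables (k : fieldType) (L : falgType k).

(* A finite complex X of finitely generated modules is stored as its total module
   (+)_n X_n = k^N, with a homogeneous basis: X_n is spanned by the basis vectors
   of degree n. The grading is cohomological (the differential has degree +1).
   Elements of L preserve each X_n, which is recovered as [cterm X n]. *)
Record complex := Complex {
  ctot :> fdmod L;
  cdeg : 'I_(mdim ctot) -> int;
  cdiff : 'M[k]_(mdim ctot);
  cact_homog : forall a, homogeneous cdeg cdeg 0 (mdact ctot a);
  cdiff_homog : homogeneous cdeg cdeg 1 cdiff;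
  cdiff_modhom : is_modhom ctot ctot cdiff;
  cdiff2 : cdiff *m cdiff = 0
}.

(* The submodule of X spanned by the basis vectors in P, for P stable under L. *)
Section Summand.
Variables (X : fdmod L) (P : pred 'I_(mdim X)).
Hypothesis stableP : forall a i j, mdact X a i j != 0 -> P i = P j.

Definition summand_act (a : L) : 'M[k]_(#|P|) :=
  mxsub enum_val enum_val (mdact X a).

Fact summand_act_linear : linear summand_act.
Proof. by move=> c a b; apply/matrixP=> i j; rewrite /summand_act mdact_linear !mxE. Qed.
Fact summand_act1 : summand_act 1 = 1%:M.
Proof.
by apply/matrixP=> i j; rewrite /summand_act mdact1 !mxE (inj_eq enum_val_inj).
Qed.
Fact summand_actM a b : summand_act (a * b) = summand_act a *m summand_act b.
Proof.
apply/matrixP=> i j; rewrite /summand_act mdactM !mxE.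
rewrite (bigID P) /= addrC big1 ?add0r => [|l nl]; last first.
  have [->|h] := eqVneq (mdact X a (enum_val i) l) 0; first by rewrite mul0r.
  have hi : enum_val i \in P by exact: enum_valP.
  by move: nl; rewrite -(stableP h) -[P _]/(enum_val i \in P) hi.
by rewrite big_enum_val /=; apply: eq_bigr => l _; rewrite !mxE.
Qed.

Definition summand : fdmod L := Fdmod summand_act_linear summand_act1 summand_actM.
End Summand.

Lemma summand_eq (X : fdmod L) (P Q : pred 'I_(mdim X))
    (hP : forall a i j, mdact X a i j != 0 -> P i = P j)
    (hQ : forall a i j, mdact X a i j != 0 -> Q i = Q j) :
  P =1 Q -> summand hP = summand hQ.
Proof.
move=> /funext e; case: _ / e hQ => hQ.
by rewrite (Prop_irrelevance hP hQ).
Qed.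

Fact cterm_stable (X : complex) (n : int) a i j :
  mdact X a i j != 0 -> (cdeg i == n) = (cdeg j == n).
Proof. by move/cact_homog=> ->; rewrite addr0. Qed.

Definition cterm (X : complex) (n : int) : fdmod L := summand (@cterm_stable X n).

Definition perfect (X : complex) : Prop := forall n, projective (cterm X n).

Section ChainMaps.
Variables X Y : complex.

Definition is_chmap (f : 'M[k]_(mdim Y, mdim X)) : Prop :=
  [/\ homogeneous (@cdeg X) (@cdeg Y) 0 f, is_modhom X Y f &
      f *m cdiff X = cdiff Y *m f].

Definition chmap_pred : {pred 'M[k]_(mdim Y, mdim X)} := fun f => `[< is_chmap f >].

Fact chmap_closed : submod_closed chmap_pred.
Proof.
split=> [|c f g /asboolP[hf1 hf2 hf3] /asboolP[hg1 hg2 hg3]]; apply/asboolP.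
  by split=> [|a|]; rewrite ?mul0mx ?mulmx0 //; exact: homogeneous0.
split=> [|a|]; first exact: homogeneous_lin.
  by rewrite mulmxDl mulmxDr -scalemxAl -scalemxAr hf2 hg2.
by rewrite mulmxDl mulmxDr -scalemxAl -scalemxAr hf3 hg3.
Qed.
HB.instance Definition _ := GRing.isSubmodClosed.Build k _ chmap_pred chmap_closed.

Record chmap := Chmap { chmx : 'M[k]_(mdim Y, mdim X); chmxP : chmx \in chmap_pred }.
HB.instance Definition _ := [isSub for chmx].
HB.instance Definition _ := [Choice of chmap by <:].
HB.instance Definition _ := [SubChoice_isSubLmodule of chmap by <:].

Definition nullhomotopic : set chmap := fun f =>
  exists h : 'M[k]_(mdim Y, mdim X),
    [/\ homogeneous (@cdeg X) (@cdeg Y) (-1) h, is_modhom X Y h &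
        chmx f = cdiff Y *m h + h *m cdiff X].

Definition hthom := quotmod nullhomotopic.
HB.instance Definition _ := GRing.Lmodule.on hthom.
End ChainMaps.
Arguments is_chmap X Y f : clear implicits.

Lemma chmap_inj X Y (f g : chmap X Y) : chmx f = chmx g -> f = g.
Proof. exact: val_inj. Qed.

Lemma chmapP X Y (f : chmap X Y) : is_chmap X Y (chmx f).
Proof. exact/asboolP/(chmxP f). Qed.

Definition mkchmap X Y f (hf : is_chmap X Y f) : chmap X Y :=
  Chmap (asboolT hf : f \in @chmap_pred X Y).

Fact chid_subproof X : is_chmap X X 1%:M.
Proof.
by split=> [|a|]; rewrite ?mul1mx ?mulmx1 //; exact: homogeneous1.
Qed.
Definition chid X : chmap X X := mkchmap (chid_subproof X).

Fact chcomp_subproof X Y Z (g : chmap Y Z) (f : chmap X Y) :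
  is_chmap X Z (chmx g *m chmx f).
Proof.
have [g1 g2 g3] := chmapP g; have [f1 f2 f3] := chmapP f.
split=> [|a|]; first by rewrite -[0]addr0; exact: homogeneousM g1 f1.
  by rewrite -mulmxA f2 !mulmxA g2.
by rewrite -mulmxA f3 !mulmxA g3.
Qed.
Definition chcomp X Y Z (g : chmap Y Z) (f : chmap X Y) : chmap X Z :=
  mkchmap (chcomp_subproof g f).

Lemma chmx_lin X Y c (f g : chmap X Y) : chmx (c *: f + g) = c *: chmx f + chmx g.
Proof. by []. Qed.

Lemma nullhomotopic_gen X Y (f : chmap X Y) :
  submod_gen (@nullhomotopic X Y) f <-> nullhomotopic f.
Proof.
split; last exact: SubmodIn.
elim=> {f} [//||c f g _ [h [h1 h2 h3]] _ [l [l1 l2 l3]]].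
  exists 0; split=> [|a|]; rewrite ?mul0mx ?mulmx0 ?addr0 //.
  exact: homogeneous0.
exists (c *: h + l); split=> [|a|]; first exact: homogeneous_lin.
  by rewrite mulmxDl mulmxDr -scalemxAl -scalemxAr h2 l2.
rewrite chmx_lin h3 l3 mulmxDl mulmxDr -scalemxAl -scalemxAr scalerDr.
by rewrite !addrA; congr (_ + _); rewrite -!addrA; congr (_ + _); rewrite addrC.
Qed.

Definition htcls X Y (f : chmap X Y) : hthom X Y := qcls (@nullhomotopic X Y) f.
Definition htrep X Y (f : hthom X Y) : chmap X Y := qrep f.

Lemma htrepK X Y : cancel (@htrep X Y) (@htcls X Y). Proof. exact: qrepK. Qed.
Lemma htcls_eq X Y (f g : chmap X Y) :
  htcls f = htcls g <-> nullhomotopic (f - g).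
Proof. by rewrite -nullhomotopic_gen; exact: qcls_eq. Qed.
Fact htcls_linear X Y : linear (@htcls X Y).
Proof. exact: qcls_is_linear. Qed.

Lemma htrep_cls X Y (f : chmap X Y) : nullhomotopic (htrep (htcls f) - f).
Proof. by apply/htcls_eq; rewrite htrepK. Qed.

Definition htcomp X Y Z (g : hthom Y Z) (f : hthom X Y) : hthom X Z :=
  htcls (chcomp (htrep g) (htrep f)).

Lemma nullhomotopic_compl X Y Z (g : chmap Y Z) (f : chmap X Y) :
  nullhomotopic f -> nullhomotopic (chcomp g f).
Proof.
have [g1 g2 g3] := chmapP g; move=> [h [h1 h2 h3]].
exists (chmx g *m h); split=> [|a|].
- by rewrite -[-1]addr0; exact: homogeneousM g1 h1.
- by rewrite -mulmxA h2 !mulmxA g2.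
by rewrite /= h3 mulmxDr !mulmxA g3.
Qed.

Lemma nullhomotopic_compr X Y Z (g : chmap Y Z) (f : chmap X Y) :
  nullhomotopic g -> nullhomotopic (chcomp g f).
Proof.
have [f1 f2 f3] := chmapP f; move=> [h [h1 h2 h3]].
exists (h *m chmx f); split=> [|a|].
- by rewrite -[-1]add0r; exact: homogeneousM h1 f1.
- by rewrite -mulmxA f2 !mulmxA h2.
by rewrite /= h3 mulmxDl -!mulmxA f3.
Qed.

Lemma htcompE X Y Z (g : chmap Y Z) (f : chmap X Y) :
  htcomp (htcls g) (htcls f) = htcls (chcomp g f).
Proof.
transitivity (htcls (chcomp g (htrep (htcls f)))); apply/htcls_eq.
  have := nullhomotopic_compr (htrep (htcls f)) (htrep_cls g).
  by congr nullhomotopic; apply: chmap_inj; rewrite /= mulmxBl.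
have := nullhomotopic_compl g (htrep_cls f).
by congr nullhomotopic; apply: chmap_inj; rewrite /= mulmxBr.
Qed.

Fact htcomp_linearl X Y Z (f : hthom X Y) : linear (fun g : hthom Y Z => htcomp g f).
Proof.
move=> c g h; rewrite -(htrepK f) -(htrepK g) -(htrepK h) -htcls_linear !htcompE.
rewrite -htcls_linear; congr htcls; apply: chmap_inj.
by rewrite /= mulmxDl -scalemxAl.
Qed.
Fact htcomp_linearr X Y Z (g : hthom Y Z) : linear (fun f : hthom X Y => htcomp g f).
Proof.
move=> c f h; rewrite -(htrepK f) -(htrepK g) -(htrepK h) -htcls_linear !htcompE.
rewrite -htcls_linear; congr htcls; apply: chmap_inj.
by rewrite /= mulmxDr -scalemxAr.
Qed.
Definition htid X : hthom X X := htcls (chid X).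
Fact htcomp1m X Y (f : hthom X Y) : htcomp (htid Y) f = f.
Proof.
by rewrite -(htrepK f) htcompE; congr htcls; apply: chmap_inj; rewrite /= mul1mx.
Qed.
Fact htcompm1 X Y (f : hthom X Y) : htcomp f (htid X) = f.
Proof.
by rewrite -(htrepK f) htcompE; congr htcls; apply: chmap_inj; rewrite /= mulmx1.
Qed.
Fact htcompA X Y Z W (h : hthom Z W) (g : hthom Y Z) (f : hthom X Y) :
  htcomp h (htcomp g f) = htcomp (htcomp h g) f.
Proof.
rewrite -(htrepK f) -(htrepK g) -(htrepK h) !htcompE.
by congr htcls; apply: chmap_inj; rewrite /= mulmxA.
Qed.

(* X[r]_n = X_(n+r), with differential (-1)^r d *)
Section Shift.
Variables (r : int) (X : complex).
Definition shift_deg (i : 'I_(mdim X)) : int := cdeg i - r.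
Definition shift_diff : 'M[k]_(mdim X) := (-1) ^ r *: cdiff X.

Fact shift_act_homog a : homogeneous shift_deg shift_deg 0 (mdact X a).
Proof. by move=> i j /cact_homog; rewrite /shift_deg => ->; rewrite addrAC. Qed.
Fact shift_diff_homog : homogeneous shift_deg shift_deg 1 shift_diff.
Proof.
move=> i j; rewrite mxE mulf_eq0 negb_or => /andP[_ /cdiff_homog].
by rewrite /shift_deg => ->; rewrite addrAC.
Qed.
Fact shift_diff_modhom : is_modhom X X shift_diff.
Proof. by move=> a; rewrite -scalemxAl -scalemxAr cdiff_modhom. Qed.
Fact shift_diff2 : shift_diff *m shift_diff = 0.
Proof. by rewrite -scalemxAl -scalemxAr cdiff2 !scaler0. Qed.
Definition cshift : complex :=
  Complex shift_act_homog shift_diff_homog shift_diff_modhom shift_diff2.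
End Shift.

End Complexes.
Arguments is_chmap {k L} X Y f.

Section Db.
Variables (k : fieldType) (L : falgType k).
Local Notation complex := (complex L).

Record perf := Perf { pcomplex :> complex; perfP : perfect pcomplex }.
Arguments perfP : clear implicits.

Definition htcat : lincat k := Lincat (@htcomp_linearl k L) (@htcomp_linearr k L)
  (@htcomp1m k L) (@htcompm1 k L) (@htcompA k L).

(* D^b(L-proj) as a full subcategory of the homotopy category of finite
   complexes of finitely generated modules. *)
Definition perfcat : lincat k := @Lincat k perf (fun X Y : perf => mor (X : htcat) Y)
  (fun X => mid (X : htcat)) (fun X Y Z => @mcomp k htcat X Y Z)
  (fun X Y Z => @mcomp_linearl k htcat X Y Z) (fun X Y Z => @mcomp_linearr k htcat X Y Z)
  (fun X Y => @mcomp1m k htcat X Y) (fun X Y => @mcompm1 k htcat X Y) 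
  (fun X Y Z W => @mcompA k htcat X Y Z W).

Fact perf_shift_subproof r (X : complex) : perfect X -> perfect (cshift r X).
Proof.
move=> pX n; have := pX (n + r); congr projective.
by apply: summand_eq => i; rewrite /= /shift_deg subr_eq.
Qed.
Definition pshift (r : int) (X : perf) : perf := Perf (@perf_shift_subproof r X (perfP X)).

Lemma signE (r : int) : (-1) ^ r * (-1) ^ r = 1 :> k.
Proof. by rewrite -expfzMl mulrNN mulr1 exp1rz. Qed.

Fact chshift_subproof r (X Y : complex) (f : chmap X Y) :
  is_chmap (cshift r X) (cshift r Y) (chmx f).
Proof.
have [f1 f2 f3] := chmapP f; split=> //.
  by move=> i j /f1 /=; rewrite /shift_deg !addr0 => ->.
by rewrite /= /shift_diff -scalemxAr -scalemxAl f3.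
Qed.
Definition chshift r (X Y : complex) (f : chmap X Y) : chmap (cshift r X) (cshift r Y) :=
  mkchmap (chshift_subproof r f).

Definition htshift r (X Y : complex) (f : hthom X Y) : hthom (cshift r X) (cshift r Y) :=
  htcls (chshift r (htrep f)).

Lemma nullhomotopic_shift r (X Y : complex) (f : chmap X Y) :
  nullhomotopic f -> nullhomotopic (chshift r f).
Proof.
move=> [h [h1 h2 h3]]; exists ((-1) ^ r *: h); split=> [i j|a|].
- rewrite mxE mulf_eq0 negb_or => /andP[_ /h1] /=; rewrite /shift_deg => ->.
  by rewrite addrAC.
- by rewrite -scalemxAl -scalemxAr h2.
by rewrite /= /shift_diff -!scalemxAl -!scalemxAr !scalerA signE !scale1r.
Qed.

Lemma htshiftE r (X Y : complex) (f : chmap X Y) :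
  htshift r (htcls f) = htcls (chshift r f).
Proof.
apply/htcls_eq; have := nullhomotopic_shift r (htrep_cls f).
by congr nullhomotopic; apply: chmap_inj.
Qed.

Fact htshift_linear r (X Y : complex) : linear (@htshift r X Y).
Proof.
move=> c f g; rewrite -(htrepK f) -(htrepK g) -htcls_linear !htshiftE -htcls_linear.
by congr htcls; apply: chmap_inj.
Qed.
Fact htshift_id r (X : complex) : htshift r (htid X) = htid (cshift r X).
Proof. by rewrite htshiftE; congr htcls; apply: chmap_inj. Qed.
Fact htshift_comp r (X Y Z : complex) (g : hthom Y Z) (f : hthom X Y) :
  htshift r (htcomp g f) = htcomp (htshift r g) (htshift r f).
Proof.
rewrite -(htrepK f) -(htrepK g) htcompE !htshiftE htcompE.
by congr htcls; apply: chmap_inj.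
Qed.

Definition pshift_functor (r : int) : linfunctor perfcat perfcat :=
  @Linfunctor k perfcat perfcat (pshift r) (fun X Y => @htshift r X Y)
    (fun X Y => @htshift_linear r X Y) (fun X => htshift_id r X)
    (fun X Y Z => @htshift_comp r X Y Z).

Section UnitCounit.
Variables (r s : int) (rs : r + s = 0).

Lemma shift_degK (X : complex) i : cdeg (i : 'I_(mdim (cshift s (cshift r X)))) = @cdeg _ _ X i.
Proof. by rewrite /= /shift_deg /= /shift_deg -addrA -opprD rs subr0. Qed.
Lemma shift_diffK (X : complex) : cdiff (cshift s (cshift r X)) = cdiff X.
Proof.
by rewrite /= /shift_diff /= /shift_diff scalerA -exprzDr ?unitrN1 // addrC rs scale1r.
Qed.

Fact chunit_subproof (X : complex) : is_chmap X (cshift s (cshift r X)) 1%:M.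
Proof.
split=> [i j|a|]; rewrite ?mul1mx ?mulmx1 ?shift_diffK //.
by rewrite shift_degK => /(@homogeneous1 _ _ (@cdeg _ _ X)).
Qed.
Fact chunitV_subproof (X : complex) : is_chmap (cshift s (cshift r X)) X 1%:M.
Proof.
split=> [i j|a|]; rewrite ?mul1mx ?mulmx1 ?shift_diffK //.
by rewrite shift_degK => /(@homogeneous1 _ _ (@cdeg _ _ X)).
Qed.
Definition htunit (X : complex) : hthom X (cshift s (cshift r X)) :=
  htcls (mkchmap (chunit_subproof X)).
Definition htunitV (X : complex) : hthom (cshift s (cshift r X)) X :=
  htcls (mkchmap (chunitV_subproof X)).

Lemma htunitK (X : complex) : htcomp (htunitV X) (htunit X) = htid X.
Proof. by rewrite htcompE; congr htcls; apply: chmap_inj; rewrite /= mul1mx. Qed.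
Lemma htunitVK (X : complex) : htcomp (htunit X) (htunitV X) = htid _.
Proof. by rewrite htcompE; congr htcls; apply: chmap_inj; rewrite /= mul1mx. Qed.

Fact htunit_nat (X Y : complex) (f : hthom X Y) :
  htcomp (htshift s (htshift r f)) (htunit X) = htcomp (htunit Y) f.
Proof.
rewrite -(htrepK f) !htshiftE !htcompE; congr htcls; apply: chmap_inj.
by rewrite /= mul1mx mulmx1.
Qed.
Fact htunitV_nat (X Y : complex) (f : hthom X Y) :
  htcomp f (htunitV X) = htcomp (htunitV Y) (htshift s (htshift r f)).
Proof.
rewrite -(htrepK f) !htshiftE !htcompE; congr htcls; apply: chmap_inj.
by rewrite /= mul1mx mulmx1.
Qed.
Fact htunit_iso (X : perfcat) :
  @is_iso k perfcat X (pshift s (pshift r X)) (htunit X).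
Proof. by exists (htunitV X); split; [exact: htunitK | exact: htunitVK]. Qed.
Fact htunitV_iso (X : perfcat) :
  @is_iso k perfcat (pshift s (pshift r X)) X (htunitV X).
Proof. by exists (htunit X); split; [exact: htunitVK | exact: htunitK]. Qed.
End UnitCounit.

Definition Db : shiftcat k :=
  @Shiftcat k perfcat (pshift_functor 1) (pshift_functor (-1))
    (fun X => htunit (subrr 1) X) (fun X => htunitV (addNr 1) X)
    (htunit_iso (subrr 1)) (htunitV_iso (addNr 1))
    (fun X Y => @htunit_nat _ _ (subrr 1) X Y) (fun X Y => @htunitV_nat _ _ (addNr 1) X Y).
End Db.

(* Hom_k(L, k) carries the bimodule structure (a f b)(y) = f (b y a). *)
Definition symmetric_algebra (k : fieldType) (L : falgType k) : Prop :=
  exists phi : L -> 'Hom(L, k^o),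
    [/\ linear phi, bijective phi & forall a b x y : L, phi (a * x * b) y = phi x (b * y * a)].

Section GroupAlgebra.
Variables (k : fieldType) (gT : finGroupType).

(* kG, as functions G -> k under convolution *)
Definition galg : Type := {ffun gT -> k^o}.
HB.instance Definition _ := Vector.on galg.

Definition gelt (g : gT) : galg := [ffun x => (x == g)%:R].
Definition gmul (a b : galg) : galg := [ffun x => \sum_g a g * b (g^-1 * x)%g].

Fact gmulA : associative gmul.
Proof.
move=> a b c; apply/ffunP=> x; rewrite !ffunE.
transitivity (\sum_g \sum_h a g * b (g^-1 * h)%g * c (h^-1 * x)%g).
  apply: eq_bigr => g _; rewrite ffunE mulr_sumr.
  rewrite (reindex_inj (mulgI g^-1)%g); apply: eq_bigr => h _.
  by rewrite mulrA invMg invgK -mulgA mulKVg.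
by rewrite exchange_big; apply: eq_bigr => h _; rewrite ffunE mulr_suml.
Qed.
Fact gmul1a : left_id (gelt 1) gmul.
Proof.
move=> a; apply/ffunP=> x; rewrite ffunE (bigD1 1%g) //= big1 ?addr0 => [|g ng].
  by rewrite ffunE eqxx mul1r invg1 mul1g.
by rewrite ffunE (negPf ng) mul0r.
Qed.
Fact gmula1 : right_id (gelt 1) gmul.
Proof.
move=> a; apply/ffunP=> x; rewrite ffunE (bigD1 x) //= big1 ?addr0 => [|g ng].
  by rewrite ffunE mulVg eqxx mulr1.
by rewrite ffunE -eq_mulVg1 (negPf ng) mulr0.
Qed.
Fact gmulDl : left_distributive gmul +%R.
Proof.
move=> a b c; apply/ffunP=> x; rewrite !ffunE -big_split; apply: eq_bigr => g _.
by rewrite ffunE mulrDl.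
Qed.
Fact gmulDr : right_distributive gmul +%R.
Proof.
move=> a b c; apply/ffunP=> x; rewrite !ffunE -big_split; apply: eq_bigr => g _.
by rewrite ffunE mulrDr.
Qed.
Fact gelt1_neq0 : gelt 1 != 0.
Proof. by apply/eqP=> /ffunP/(_ 1%g); rewrite !ffunE eqxx => /eqP; rewrite oner_eq0. Qed.

HB.instance Definition _ := GRing.Zmodule_isNzRing.Build galg
  gmulA gmul1a gmula1 gmulDl gmulDr gelt1_neq0.

Fact gscaleAl (c : k) (a b : galg) : c *: (a * b) = (c *: a) * b.
Proof.
apply/ffunP=> x; rewrite !ffunE scaler_sumr; apply: eq_bigr => g _.
by rewrite ffunE scalerAl.
Qed.
Fact gscaleAr (c : k) (a b : galg) : c *: (a * b) = a * (c *: b).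
Proof.
apply/ffunP=> x; rewrite !ffunE scaler_sumr; apply: eq_bigr => g _.
by rewrite ffunE scalerAr.
Qed.
HB.instance Definition _ := GRing.Lmodule_isLalgebra.Build k galg gscaleAl.
HB.instance Definition _ := GRing.Lalgebra_isAlgebra.Build k galg gscaleAr.
HB.instance Definition _ := Algebra_isFalgebra.Build k galg.

Lemma geltM g h : gelt g * gelt h = gelt (g * h)%g.
Proof.
apply/ffunP=> x; rewrite !ffunE (bigD1 g) //= big1 ?addr0 => [|l nl].
  by rewrite !ffunE eqxx mul1r -(inj_eq (mulgI g)) mulKVg.
by rewrite ffunE (negPf nl) mul0r.
Qed.

Section GroupMod.
Variables (n : nat) (rho : gT -> 'M[k]_n).
Hypotheses (rho1 : rho 1%g = 1%:M) (rhoM : forall g h, rho (g * h)%g = rho g *m rho h).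

Definition gact (a : galg) : 'M[k]_n := \sum_g a g *: rho g.
Fact gact_linear : linear gact.
Proof.
move=> c a b; rewrite /gact scaler_sumr -big_split; apply: eq_bigr => g _.
by rewrite !ffunE scalerDl scalerA.
Qed.
Fact gact1 : gact 1 = 1%:M.
Proof.
rewrite /gact (bigD1 1%g) //= big1 ?addr0 => [|g ng].
  by rewrite ffunE eqxx scale1r.
by rewrite ffunE (negPf ng) scale0r.
Qed.
Fact gactM a b : gact (a * b) = gact a *m gact b.
Proof.
rewrite /gact; transitivity (\sum_x \sum_g (a g * b (g^-1 * x)%g) *: rho x).
  by apply: eq_bigr => x _; rewrite ffunE scaler_suml.
rewrite exchange_big mulmx_suml; apply: eq_bigr => g _.
rewrite (reindex_inj (mulgI g)) mulmx_sumr; apply: eq_bigr => h _.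
by rewrite mulKg rhoM -scalemxAl -scalemxAr scalerA.
Qed.
Definition gmod : fdmod galg := Fdmod gact_linear gact1 gactM.
End GroupMod.

Lemma homogeneous_gact n (d : 'I_n -> int) (rho : gT -> 'M[k]_n) :
  (forall g, homogeneous d d 0 (rho g)) -> forall a, homogeneous d d 0 (gact rho a).
Proof.
move=> h a; rewrite /gact; elim/big_ind: _ => [|f g hf hg|g _].
- exact: homogeneous0.
- by rewrite -[f]scale1r; exact: homogeneous_lin.
by rewrite -[_ *: _]addr0; apply: homogeneous_lin => //; exact: homogeneous0.
Qed.

Lemma gact_modhom m n (rho : gT -> 'M[k]_m) (sig : gT -> 'M[k]_n) (f : 'M[k]_(n, m)) :
  (forall g, f *m rho g = sig g *m f) -> forall a, f *m gact rho a = gact sig a *m f.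
Proof.
move=> h a; rewrite /gact mulmx_sumr mulmx_suml; apply: eq_bigr => g _.
by rewrite -scalemxAr -scalemxAl h.
Qed.

Definition grho (X : fdmod galg) (g : gT) : 'M[k]_(mdim X) := mdact X (gelt g).
Lemma grho1 X : grho X 1%g = 1%:M. Proof. exact: mdact1. Qed.
Lemma grhoM X g h : grho X (g * h)%g = grho X g *m grho X h.
Proof. by rewrite /grho -geltM mdactM. Qed.

Section Tensor.
Variables X Y : complex galg.

(* d (x (x) y) = d x (x) y + (-1)^|x| x (x) d y, with diagonal G-action *)
Definition tens_deg (p : 'I_(mdim X * mdim Y)) : int :=
  cdeg (mxtens_unindex p).1 + cdeg (mxtens_unindex p).2.

Definition tens_rho (g : gT) : 'M[k]_(mdim X * mdim Y) := grho X g *t grho Y g.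
Fact tens_rho1 : tens_rho 1%g = 1%:M.
Proof.
rewrite /tens_rho !grho1; apply/matrixP=> i j; rewrite !mxE -natrM mulnb.
by rewrite -[RHS]/((i == j)%:R) -(inj_eq (can_inj (@mxtens_unindexK _ _))) -pair_eqE.
Qed.
Fact tens_rhoM g h : tens_rho (g * h)%g = tens_rho g *m tens_rho h.
Proof. by rewrite /tens_rho !grhoM tensmx_mul. Qed.

Definition sgn_mx (Z : complex galg) : 'M[k]_(mdim Z) :=
  diag_mx (\row_i (-1) ^ @cdeg _ _ Z i).

Definition tens_diff : 'M[k]_(mdim X * mdim Y) :=
  cdiff X *t 1%:M + sgn_mx X *t cdiff Y.

Lemma homogeneous_tens r s (f : 'M[k]_(mdim X)) (g : 'M[k]_(mdim Y)) :
  homogeneous (@cdeg _ _ X) (@cdeg _ _ X) r f ->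
  homogeneous (@cdeg _ _ Y) (@cdeg _ _ Y) s g ->
  homogeneous tens_deg tens_deg (r + s) (f *t g).
Proof.
move=> hf hg i j; rewrite mxE mulf_eq0 negb_or => /andP[/hf e1 /hg e2].
by rewrite /tens_deg e1 e2 addrACA.
Qed.

Lemma sgn_homog (Z : complex galg) : homogeneous (@cdeg _ _ Z) (@cdeg _ _ Z) 0 (sgn_mx Z).
Proof.
move=> i j; rewrite !mxE addr0; case: (eqVneq i j) => [->|_] //.
by rewrite mulr0n eqxx.
Qed.

Lemma sgn_diff (Z : complex galg) : sgn_mx Z *m cdiff Z = - (cdiff Z *m sgn_mx Z).
Proof.
apply/matrixP=> i j; rewrite mul_diag_mx mul_mx_diag !mxE mulrC -mulrN.
have [->|/cdiff_homog ->] := eqVneq (cdiff Z i j) 0; first by rewrite !mul0r.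
by rewrite exprzDr ?expr1z ?mulrN1 // unitrN1.
Qed.

Lemma sgn2 (Z : complex galg) : sgn_mx Z *m sgn_mx Z = 1%:M.
Proof.
apply/matrixP=> i j; rewrite mul_diag_mx !mxE; case: (eqVneq i j) => [->|_].
  by rewrite mulr1n -expfzMl mulrNN mulr1 exp1rz.
by rewrite mulr0n mulr0.
Qed.

Lemma sgn_rho (Z : complex galg) a : sgn_mx Z *m mdact Z a = mdact Z a *m sgn_mx Z.
Proof.
apply/matrixP=> i j; rewrite mul_diag_mx mul_mx_diag !mxE mulrC.
have [->|/cact_homog ->] := eqVneq (mdact Z a i j) 0; first by rewrite !mul0r.
by rewrite addr0.
Qed.

Definition tens_mod : fdmod galg := gmod tens_rho1 tens_rhoM.

Fact tens_act_homog a : homogeneous tens_deg tens_deg 0 (mdact tens_mod a).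
Proof.
apply: homogeneous_gact => g; rewrite -[0]addr0.
by apply: homogeneous_tens; exact: cact_homog.
Qed.
Fact tens_diff_homog : homogeneous tens_deg tens_deg 1 tens_diff.
Proof.
rewrite /tens_diff -[cdiff X *t _]scale1r; apply: homogeneous_lin.
  rewrite -[1]addr0; apply: homogeneous_tens; first exact: cdiff_homog.
  exact: homogeneous1.
rewrite -[1]add0r; apply: homogeneous_tens; first exact: sgn_homog.
exact: cdiff_homog.
Qed.
Fact tens_diff_modhom : is_modhom tens_mod tens_mod tens_diff.
Proof.
apply: gact_modhom => g; rewrite /tens_diff /tens_rho mulmxDl mulmxDr.
by rewrite !tensmx_mul mul1mx mulmx1 !cdiff_modhom sgn_rho.
Qed.
Fact tens_diff2 : tens_diff *m tens_diff = 0.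
Proof.
rewrite /tens_diff mulmxDl !mulmxDr !tensmx_mul !cdiff2 tens0mx tensmx0 add0r addr0.
by rewrite !mul1mx !mulmx1 sgn_diff -scaleN1r; apply/matrixP=> i j; rewrite !mxE mulN1r mulNr subrr.
Qed.
Definition ctens : complex galg :=
  @Complex k galg tens_mod tens_deg tens_diff tens_act_homog tens_diff_homog
    tens_diff_modhom tens_diff2.
End Tensor.

Section Dual.
Variable X : complex galg.
(* (X^* )_n = (X_(-n))^* on the dual basis, (g f)(x) = f (g^-1 x) and
   d f = -(-1)^|f| f o d *)
Definition dual_rho (g : gT) : 'M[k]_(mdim X) := (grho X g^-1)^T.
Fact dual_rho1 : dual_rho 1%g = 1%:M.
Proof. by rewrite /dual_rho invg1 grho1 trmx1. Qed.
Fact dual_rhoM g h : dual_rho (g * h)%g = dual_rho g *m dual_rho h.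
Proof. by rewrite /dual_rho invMg grhoM trmx_mul. Qed.
Definition dual_mod : fdmod galg := gmod dual_rho1 dual_rhoM.

Definition dual_deg (i : 'I_(mdim X)) : int := - cdeg i.
Definition dual_diff : 'M[k]_(mdim X) := - ((cdiff X)^T *m sgn_mx X).

Lemma homogeneous_tr r (f : 'M[k]_(mdim X)) :
  homogeneous (@cdeg _ _ X) (@cdeg _ _ X) r f -> homogeneous dual_deg dual_deg r f^T.
Proof.
by move=> h i j; rewrite mxE /dual_deg => /h ->; rewrite opprD addrNK.
Qed.
Lemma sgn_tr (Z : complex galg) : (sgn_mx Z)^T = sgn_mx Z.
Proof. by rewrite /sgn_mx tr_diag_mx. Qed.

Fact dual_act_homog a : homogeneous dual_deg dual_deg 0 (mdact dual_mod a).
Proof. by apply: homogeneous_gact => g; apply: homogeneous_tr; exact: cact_homog. Qed.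
Fact dual_diff_homog : homogeneous dual_deg dual_deg 1 dual_diff.
Proof.
rewrite /dual_diff -scaleN1r -[_ *: _]addr0; apply: homogeneous_lin; last exact: homogeneous0.
rewrite -[1]add0r; apply: homogeneousM; first by apply: homogeneous_tr; exact: cdiff_homog.
by rewrite -sgn_tr; apply: homogeneous_tr; exact: sgn_homog.
Qed.
Fact dual_diff_modhom : is_modhom dual_mod dual_mod dual_diff.
Proof.
apply: gact_modhom => g; rewrite /dual_diff /dual_rho mulNmx mulmxN; congr (- _).
rewrite -[sgn_mx X]sgn_tr -!trmx_mul; congr trmx.
by rewrite mulmxA -sgn_rho -!mulmxA cdiff_modhom.
Qed.
Fact dual_diff2 : dual_diff *m dual_diff = 0.
Proof.
rewrite /dual_diff mulNmx mulmxN opprK -[sgn_mx X]sgn_tr -!trmx_mul.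
rewrite sgn_diff mulNmx mulmxN opprK -mulmxA [sgn_mx X *m (_ *m _)]mulmxA.
by rewrite sgn_diff mulNmx mulmxN !mulmxA cdiff2 !mul0mx oppr0 trmx0.
Qed.
Definition cdual : complex galg :=
  @Complex k galg dual_mod dual_deg dual_diff dual_act_homog dual_diff_homog
    dual_diff_modhom dual_diff2.
End Dual.
End GroupAlgebra.

(* Main.v *)
Require Import Defs.
From HB Require Import structures.
From mathcomp Require Import all_boot all_order all_fingroup all_algebra all_field.
From mathcomp Require Import boolp classical_sets.
From mathcomp Require Import cardinality fsbigop freeg mxtens.
From mathcomp Require Import ring.

Set Implicit Arguments.
Unset Strict Implicit.
Unset Printing Implicit Defensive.

Import GRing.Theory.
Local Open Scope ring_scope.

(** Parts 1 and 2.  The long exact Hom sequences of an Auslander-Reiten triangle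
    show that [dim (M,X[i]) + dim (M,Z[i]) - dim (M,Y[i])] is [r (i-1) + r i], where
    [r i] is the rank of composition with the connecting map [Z -> X[1]].  That map
    kills everything but isomorphisms from shifts of [M] to [Z], and [r i] is 1 for
    [M = Z] and [i = 0] because the residue field of the local ring [End Z] is [k].
    On the left one needs the dual almost split property of [X], which follows by
    factoring the connecting map through a weak kernel.

    Part 3.  Over a symmetric algebra with dual bases [a_i], [b_i], a module [P] is
    projective iff [sum a_i t b_i = 1] for some linear endomorphism [t] of [P]
    (Higman).  For a perfect complex [X] with such a [t], the graded trace
    [tr (t sgn g f)] is a perfect pairing between the module maps [X -> Y] and
    [Y -> X], under which cycles are the orthogonal of boundaries; hence Hom(X,Y) and
    Hom(Y,X) have equal dimension in the homotopy category.

    Part 4.  Higman's criterion for [kG] is [sum_g g t g^-1 = 1], from which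
    perfectness of tensor products and duals is immediate.  Tensor-Hom adjunction and
    transposition are isomorphisms of the total Hom complexes once entries are
    multiplied by the Koszul signs [(-1)^(|u||n|)] and [(-1)^(|n|(1+|m|))]. *)

(** * Dimensions and ranks *)

(** In part 2 the value is 1 + t on both sides. For M = Z the identity of Z sits in degree 0 and the
    connecting map Z -> X[1] in degree 1; for M = X on the left, the identity of X and the same
    connecting map sit in the same two degrees. The scalars of the two dual elements differ only
    because the form is conjugate-linear in its right variable: there (1 + t^-1)^-1 comes out as (1
    + t)^-1.

    That the classes of indecomposables span [At C] is proved from biproducts alone. Hence part 3
    can treat forms on [At (Db L)] after constructing direct sums of perfect complexes. The same
    criterion of Higman shows that these sums are perfect.

    In part 4 transposition reverses arrows: it identifies Hom(M, N[r]) with the maps from [cdual N]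
    to [cdual M] shifted by r. So it compares the form at (M, N) with the form at the two duals in
    the opposite order. Restoring the order costs a conjugation, by the Hermitian symmetry for the
    symmetric algebra kG. *)

Section BareLinear.
Variable R : pzRingType.
Implicit Types U V : lmodType R.

(** Linearity is a bare hypothesis here and below, because composition in a [lincat] comes with
    proofs of [linear] and not with bundled linear maps. *)
Lemma inverse_linear U V (f : U -> V) (g : V -> U) :
  linear f -> cancel f g -> cancel g f -> linear g.
Proof. by move=> lf fK gK c x y; apply: (can_inj fK); rewrite lf !gK. Qed.

Lemma linear_sum_of U V (f : U -> V) (I : Type) (r : seq I) (P : pred I) (F : I -> U) :
  linear f -> f (\sum_(i <- r | P i) F i) = \sum_(i <- r | P i) f (F i).
Proof.
move=> lf; have f0 : f 0 = 0 by have := lf (-1) 0 0; rewrite scaler0 addr0 scaleN1r addNr.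
elim/big_rec2: _ => [|i y x _ <-] //.
by have := lf 1 (F i) x; rewrite !scale1r.
Qed.

Lemma linear0_of U V (f : U -> V) : linear f -> f 0 = 0.
Proof. by move=> lf; have := lf (-1) 0 0; rewrite scaler0 addr0 scaleN1r addNr. Qed.

Lemma linearN_of U V (f : U -> V) : linear f -> {morph f : x / - x}.
Proof.
by move=> lf x; have := lf (-1) x 0; rewrite !scaleN1r (linear0_of lf) !addr0.
Qed.

Lemma linearD_of U V (f : U -> V) : linear f -> {morph f : x y / x + y}.
Proof. by move=> lf x y; have := lf 1 x y; rewrite !scale1r. Qed.

Lemma linearZ_of U V (f : U -> V) c : linear f -> {morph f : x / c *: x}.
Proof. by move=> lf x; have := lf c x 0; rewrite (linear0_of lf) !addr0. Qed.

End BareLinear.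

Section Dimension.
Variable k : fieldType.
Implicit Types U V W : lmodType k.

Lemma has_dim_iso U V (f : U -> V) n :
  linear f -> bijective f -> has_dim U n -> has_dim V n.
Proof.
move=> lf [g fK gK] [[h lh bh]]; constructor; exists (h \o g).
  by move=> c x y /=; rewrite (inverse_linear lf fK gK) lh.
by apply: bij_comp bh _; exists f.
Qed.

(** The sets of possible dimensions of the two spaces coincide, so [xget] makes the same choice in
    both, the default 0 included. *)
Lemma dimk_iso U V (f : U -> V) : linear f -> bijective f -> dimk U = dimk V.
Proof.
move=> lf bf; have [g fK gK] := bf; rewrite /dimk; congr (xget _ _).
apply/seteqP; split=> n /=; first exact: has_dim_iso.
by apply: (has_dim_iso (inverse_linear lf fK gK)); exists f.
Qed.

Lemma finite_dim_iso U V (f : U -> V) :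
  linear f -> bijective f -> finite_dim U -> finite_dim V.
Proof. by move=> lf bf [n hn]; exists n; exact: has_dim_iso hn. Qed.

(* A linear injection of k^n into k^m is a row-free n x m matrix. *)
Lemma has_dim_le U V m n (f : U -> V) :
  linear f -> injective f -> has_dim U n -> has_dim V m -> (n <= m)%N.
Proof.
move=> lf jf [[u lu [u' uK u'K]]] [[v lv bv]].
pose g x := v (f (u' x)).
have lu' := inverse_linear lu uK u'K.
have lg : linear g by move=> c x y; rewrite /g lu' lf lv.
have /eqP <- : row_free (lin1_mx g).
  rewrite -kermx_eq0; apply/rowV0P=> x /sub_kermxP.
  pose gl := GRing.isLinear.Build k 'rV[k]_n 'rV[k]_m _ g lg.
  pose G : {linear 'rV[k]_n -> 'rV[k]_m} := HB.pack g gl.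
  rewrite -[lin1_mx g]/(lin1_mx G) mul_rV_lin1 /= => gx0.
  have gi : injective g by apply: inj_comp (bij_inj bv) (inj_comp jf (can_inj u'K)).
  by apply: gi; rewrite gx0 (linear0_of lg).
exact: rank_leq_col.
Qed.

Lemma dimkE V n : has_dim V n -> dimk V = n.
Proof.
move=> hn; rewrite /dimk; case: xgetP => [m _ /= hm|/(_ n)] //.
have lid : linear (id : V -> V) by [].
by apply/eqP; rewrite eqn_leq !(@has_dim_le V V _ _ id) //; apply: inj_id.
Qed.

Lemma dimkP V : finite_dim V -> has_dim V (dimk V).
Proof. by move=> [n hn]; rewrite (dimkE hn). Qed.

Lemma has_dim0 V : (forall v : V, v = 0) -> has_dim V 0.
Proof.
move=> V0; constructor; exists (fun=> 0); first by move=> c x y; rewrite scaler0 addr0.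
by exists (fun=> 0) => x; [rewrite [RHS]V0|apply/rowP; case].
Qed.

(** Finiteness is placed under the existential so that [coords] is a total function of the space; in
    infinite dimension it is the map to k^0. *)
Lemma coords_ex V : exists u : V -> 'rV[k]_(dimk V),
  finite_dim V -> linear u /\ bijective u.
Proof.
have [fV|nfV] := pselect (finite_dim V); last by exists (fun=> 0).
by have [[u lu bu]] := dimkP fV; exists u.
Qed.

Definition coords V : V -> 'rV[k]_(dimk V) := sval (cid (coords_ex V)).

Lemma coords_linear V : finite_dim V -> linear (@coords V).
Proof. by rewrite /coords; case: cid => u /= h /h[]. Qed.
Lemma coords_bij V : finite_dim V -> bijective (@coords V).
Proof. by rewrite /coords; case: cid => u /= h /h[]. Qed.

Lemma matrix_of_ex U V (f : U -> V) : exists M : 'M[k]_(dimk U, dimk V),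
  finite_dim U -> finite_dim V -> linear f -> forall x, coords (f x) = coords x *m M.
Proof.
have [[fU fV lf]|h] := pselect [/\ finite_dim U, finite_dim V & linear f]; last first.
  by exists 0 => fU fV lf; case: h.
have [u' uK u'K] := coords_bij fU.
have lu' := inverse_linear (coords_linear fU) uK u'K.
pose g x := coords (f (u' x)).
have lg : linear g by move=> c x y; rewrite /g lu' lf (coords_linear fV).
pose gl := GRing.isLinear.Build k 'rV[k]_(dimk U) 'rV[k]_(dimk V) _ g lg.
pose G : {linear 'rV[k]_(dimk U) -> 'rV[k]_(dimk V)} := HB.pack g gl.
by exists (lin1_mx G) => _ _ _ x; rewrite mul_rV_lin1 /= /g uK.
Qed.

Definition matrix_of U V (f : U -> V) := sval (cid (matrix_of_ex f)).

(* Only meaningful for linear maps between finite-dimensional spaces. *)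
Definition lrank U V (f : U -> V) : nat := \rank (matrix_of f).

Lemma matrix_ofP U V (f : U -> V) : finite_dim U -> finite_dim V -> linear f ->
  forall x, coords (f x) = coords x *m matrix_of f.
Proof. by rewrite /matrix_of; case: cid. Qed.

Lemma matrix_of_uniq U V (f : U -> V) M : finite_dim U -> finite_dim V -> linear f ->
  (forall x, coords (f x) = coords x *m M) -> matrix_of f = M.
Proof.
move=> fU fV lf h; apply/row_matrixP => i; rewrite !rowE.
have [u' _ u'K] := coords_bij fU.
by rewrite -(u'K (delta_mx 0 i)) -h -matrix_ofP.
Qed.

(** Vectors are rows, so exactness at [V] says that the row space of [matrix_of f] is the left
    kernel of [matrix_of g]. Rank-nullity for the latter gives the sum. *)
Lemma exact_dim U V W (f : U -> V) (g : V -> W) :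
  finite_dim U -> finite_dim V -> finite_dim W -> linear f -> linear g ->
  (forall x, g (f x) = 0) -> (forall y, g y = 0 -> exists x, y = f x) ->
  dimk V = (lrank f + lrank g)%N.
Proof.
move=> fU fV fW lf lg gf0 kg; rewrite /lrank.
have e : (matrix_of f :=: kermx (matrix_of g))%MS.
  apply/eqmxP/andP; split.
    apply/sub_kermxP/row_matrixP => i; rewrite row0 rowE mulmxA.
    have [u' _ u'K] := coords_bij fU.
    by rewrite -(u'K (delta_mx 0 i)) -!matrix_ofP // gf0 (linear0_of (coords_linear fW)).
  apply/row_subP => i; have [v' _ v'K] := coords_bij fV.
  have : row i (kermx (matrix_of g)) *m matrix_of g = 0.
    by apply/sub_kermxP; exact: row_sub.
  rewrite -(v'K (row i _)) -matrix_ofP // => h.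
  have [x ->] : exists x, v' (row i (kermx (matrix_of g))) = f x.
    apply: kg; apply: (bij_inj (coords_bij fW)).
    by rewrite h (linear0_of (coords_linear fW)).
  by rewrite matrix_ofP // submxMl.
by rewrite e mxrank_ker subnK // rank_leq_row.
Qed.

Lemma lrank0 U V (f : U -> V) : finite_dim U -> finite_dim V ->
  (forall x, f x = 0) -> lrank f = 0%N.
Proof.
move=> fU fV f0; have lf : linear f by move=> c x y; rewrite !f0 scaler0 addr0.
rewrite /lrank (matrix_of_uniq (M := 0) fU fV lf) ?mxrank0 // => x.
by rewrite mulmx0 f0 (linear0_of (coords_linear fV)).
Qed.

Lemma lrank1 U V (f : U -> V) (v : V) : finite_dim U -> finite_dim V -> linear f ->
  (forall x, exists c, f x = c *: v) -> (exists x, f x <> 0) -> lrank f = 1%N.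
Proof.
move=> fU fV lf fv [x0 fx0]; apply/eqP; rewrite /lrank eqn_leq; apply/andP; split.
  apply: (@leq_trans (\rank (coords v))); last exact: rank_leq_row.
  apply/mxrankS/row_subP=> i; have [u' _ u'K] := coords_bij fU.
  rewrite rowE -(u'K (delta_mx 0 i)) -matrix_ofP //; have [c ->] := fv (u' (delta_mx 0 i)).
  by rewrite (linearZ_of _ (coords_linear fV)) scalemx_sub.
rewrite lt0n mxrank_eq0; apply/eqP=> M0; apply: fx0.
apply: (bij_inj (coords_bij fV)).
by rewrite matrix_ofP // M0 mulmx0 (linear0_of (coords_linear fV)).
Qed.

Lemma lrank_iso U V U' V' (f : U -> V) (g : U' -> V') (u : U -> U') (v : V -> V') :
  finite_dim U -> finite_dim V -> linear f -> linear g ->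
  linear u -> bijective u -> linear v -> bijective v ->
  (forall x, g (u x) = v (f x)) -> lrank f = lrank g.
Proof.
move=> fU fV lf lg lu bu lv bv gu.
have fU' := finite_dim_iso lu bu fU; have fV' := finite_dim_iso lv bv fV.
have sub (A B A' B' : lmodType k) (p : A -> B) (q : A' -> B') (a : A -> A') (b : B' -> B) :
    finite_dim A -> finite_dim B -> finite_dim A' -> finite_dim B' ->
    linear p -> linear q -> linear a -> linear b ->
    (forall x, p x = b (q (a x))) -> (lrank p <= lrank q)%N.
  move=> fA fB fA' fB' lp lq la lb e; rewrite /lrank.
  rewrite (matrix_of_uniq (M := matrix_of a *m matrix_of q *m matrix_of b) fA fB lp).
    exact: leq_trans (mxrankM_maxl _ _) (mxrankM_maxr _ _).
  by move=> x; rewrite e !mulmxA -!matrix_ofP.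
have [u' uK u'K] := bu; have [v' vK v'K] := bv.
have lu' := inverse_linear lu uK u'K; have lv' := inverse_linear lv vK v'K.
apply/eqP; rewrite eqn_leq; apply/andP; split.
  by apply: (sub _ _ _ _ f g u v') => // x; rewrite gu vK.
by apply: (sub _ _ _ _ g f u' v) => // x; rewrite -gu u'K.
Qed.

End Dimension.

(** * Linear categories *)

Lemma has_dim_dsum (k : fieldType) (V : lmodType k) n (W : 'I_n -> lmodType k)
    (p : forall i, V -> W i) (j : forall i, W i -> V) :
  (forall i, finite_dim (W i)) -> (forall i, linear (p i)) -> (forall i, linear (j i)) ->
  (forall i x, p i (j i x) = x) -> (forall i l x, i != l -> p l (j i x) = 0) ->
  (forall x, \sum_i j i (p i x) = x) -> has_dim V (\sum_i dimk (W i)).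
Proof.
move=> fW lp lj pj pj0 jp; constructor; exists (fun v => \mxrow_i coords (p i v)).
  move=> c x y; apply/mxrowP => i; rewrite mxrowK submxrowD mxrowK lp.
  rewrite (coords_linear (fW i)); congr (_ + _).
  by rewrite -[coords (p i x)](mxrowK (fun i => coords (p i x))); apply/rowP=> l; rewrite !mxE.
have ex_u i : exists u : 'rV_(dimk (W i)) -> W i, cancel (@coords _ _) u /\ cancel u (@coords _ _).
  by have [u uK u'K] := coords_bij (fW i); exists u.
pose u i := sval (cid (ex_u i)).
have uK i : cancel (@coords _ (W i)) (u i) by rewrite /u; case: cid => ? [].
have u'K i : cancel (u i) (@coords _ (W i)) by rewrite /u; case: cid => ? [].
exists (fun z => \sum_i j i (u i (submxrow z i))) => [v|z].
  by rewrite -[RHS]jp; apply: eq_bigr => i _; rewrite mxrowK uK.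
apply/mxrowP => i; rewrite mxrowK (linear_sum_of _ _ _ (lp i)) (bigD1 i) //= pj.
by rewrite big1 ?addr0 ?u'K // => l li; rewrite pj0.
Qed.

Section LinearCategory.
Variables (k : fieldType) (C : lincat k).
Implicit Types X Y Z W : C.

Lemma mcomp0m X Y Z (f : mor X Y) : (0 : mor Y Z) \oc f = 0.
Proof. exact: (linear0_of (@mcomp_linearl _ _ _ _ _ f)). Qed.
Lemma mcompm0 X Y Z (g : mor Y Z) : g \oc (0 : mor X Y) = 0.
Proof. exact: (linear0_of (@mcomp_linearr _ _ _ _ _ g)). Qed.
Lemma mcompNm X Y Z (g : mor Y Z) (f : mor X Y) : (- g) \oc f = - (g \oc f).
Proof. exact (linearN_of (mcomp_linearl f) g). Qed.
Lemma mcompmN X Y Z (g : mor Y Z) (f : mor X Y) : g \oc (- f) = - (g \oc f).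
Proof. exact (linearN_of (mcomp_linearr g) f). Qed.
Lemma mcompDm X Y Z (g h : mor Y Z) (f : mor X Y) : (g + h) \oc f = g \oc f + h \oc f.
Proof. exact (linearD_of (mcomp_linearl f) g h). Qed.
Lemma mcompmD X Y Z (g : mor Y Z) (f h : mor X Y) : g \oc (f + h) = g \oc f + g \oc h.
Proof. exact (linearD_of (mcomp_linearr g) f h). Qed.
Lemma mcompZm X Y Z c (g : mor Y Z) (f : mor X Y) : (c *: g) \oc f = c *: (g \oc f).
Proof. exact (linearZ_of c (mcomp_linearl f) g). Qed.
Lemma mcompmZ X Y Z c (g : mor Y Z) (f : mor X Y) : g \oc (c *: f) = c *: (g \oc f).
Proof. exact (linearZ_of c (mcomp_linearr g) f). Qed.
Lemma mcomp_suml X Y Z n (g : 'I_n -> mor Y Z) (f : mor X Y) :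
  (\sum_i g i) \oc f = \sum_i (g i \oc f).
Proof. exact (linear_sum_of _ _ g (mcomp_linearl f)). Qed.
Lemma mcomp_sumr X Y Z n (g : mor Y Z) (f : 'I_n -> mor X Y) :
  g \oc (\sum_i f i) = \sum_i (g \oc f i).
Proof. exact (linear_sum_of _ _ f (mcomp_linearr g)). Qed.

Lemma is_iso_mid X : is_iso (mid X).
Proof. by exists (mid X); rewrite mcomp1m. Qed.

Lemma is_iso_comp X Y Z (g : mor Y Z) (f : mor X Y) : is_iso g -> is_iso f -> is_iso (g \oc f).
Proof.
move=> [g' [g1 g2]] [f' [f1 f2]]; exists (f' \oc g'); split.
  by rewrite mcompA -(mcompA f') g1 mcompm1.
by rewrite mcompA -(mcompA g) f2 mcompm1.
Qed.

Lemma isomorphic_refl X : isomorphic X X.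
Proof. by exists (mid X); exact: is_iso_mid. Qed.
Lemma isomorphic_sym X Y : isomorphic X Y -> isomorphic Y X.
Proof. by move=> [f [g [h1 h2]]]; exists g, f. Qed.
Lemma isomorphic_trans X Y Z : isomorphic X Y -> isomorphic Y Z -> isomorphic X Z.
Proof. by move=> [f hf] [g hg]; exists (g \oc f); exact: is_iso_comp. Qed.

Lemma dimk_mor_isol X Y W : isomorphic X Y -> dimk (mor X W) = dimk (mor Y W).
Proof.
move=> [f [g [gf fg]]]; apply: (@dimk_iso _ _ _ (fun h => h \oc g)).
  exact: mcomp_linearl.
by exists (fun h => h \oc f) => h; rewrite -mcompA ?gf ?fg mcompm1.
Qed.

Lemma dimk_mor_isor X Y W : isomorphic X Y -> dimk (mor W X) = dimk (mor W Y).
Proof.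
move=> [f [g [gf fg]]]; apply: (@dimk_iso _ _ _ (fun h => f \oc h)).
  exact: mcomp_linearr.
by exists (fun h => g \oc h) => h; rewrite mcompA ?gf ?fg mcomp1m.
Qed.

Lemma zero_obj_mor X Y (f : mor X Y) : is_zero_obj X \/ is_zero_obj Y -> f = 0.
Proof.
by case=> h; [rewrite -(mcompm1 f) h mcompm0|rewrite -(mcomp1m f) h mcomp0m].
Qed.

Lemma zero_obj_retract X Y (f : mor X Y) (g : mor Y X) :
  g \oc f = mid X -> is_zero_obj Y -> is_zero_obj X.
Proof. by move=> gf hY; rewrite /is_zero_obj -gf (zero_obj_mor f) ?mcompm0 //; right. Qed.

Lemma zero_obj_iso X Y : isomorphic X Y -> is_zero_obj X -> is_zero_obj Y.
Proof. by move=> [f [g [gf fg]]]; exact: zero_obj_retract fg. Qed.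

Lemma dimk_mor_dsumr n (A : 'I_n -> C) X W : (forall i, finite_dim (mor W (A i))) ->
  is_dsum A X -> dimk (mor W X) = (\sum_i dimk (mor W (A i)))%N.
Proof.
move=> fA [j [p [pj pj0 jp]]]; apply: dimkE.
apply: (@has_dim_dsum _ _ _ _ (fun i f => p i \oc f) (fun i f => j i \oc f)) => //.
- by move=> i; exact: mcomp_linearr.
- by move=> i; exact: mcomp_linearr.
- by move=> i x; rewrite mcompA pj mcomp1m.
- by move=> i l x il; rewrite mcompA pj0 // mcomp0m.
move=> x; rewrite -[RHS]mcomp1m -jp mcomp_suml.
by apply: eq_bigr => i _; rewrite mcompA.
Qed.

Lemma dimk_mor_dsuml n (A : 'I_n -> C) X W : (forall i, finite_dim (mor (A i) W)) ->
  is_dsum A X -> dimk (mor X W) = (\sum_i dimk (mor (A i) W))%N.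
Proof.
move=> fA [j [p [pj pj0 jp]]]; apply: dimkE.
apply: (@has_dim_dsum _ _ _ _ (fun i f => f \oc j i) (fun i f => f \oc p i)) => //.
- by move=> i; exact: mcomp_linearl.
- by move=> i; exact: mcomp_linearl.
- by move=> i x; rewrite -mcompA pj mcompm1.
- by move=> i l x il; rewrite -mcompA pj0 ?mcompm0 // eq_sym.
move=> x; rewrite -[RHS]mcompm1 -jp mcomp_sumr.
by apply: eq_bigr => i _; rewrite mcompA.
Qed.

Lemma is_dsum_iso (I : finType) (A B : I -> C) X Y :
  (forall i, isomorphic (A i) (B i)) -> isomorphic X Y -> is_dsum A X -> is_dsum B Y.
Proof.
move=> AB [v [v' [v'v vv']]] [j [p [pj pj0 jp]]].
pose u i := sval (cid (AB i)).
have hu i : is_iso (u i) by rewrite /u; case: cid.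
pose u' i := sval (cid (hu i)).
have hu' i : u' i \oc u i = mid _ /\ u i \oc u' i = mid _ by rewrite /u'; case: cid.
exists (fun i => v \oc j i \oc u' i), (fun i => u i \oc p i \oc v'); split.
- move=> i; have [h1 h2] := hu' i.
  by rewrite !mcompA -(mcompA _ v') v'v mcompm1 -(mcompA _ (p i)) pj mcompm1.
- move=> i l il; rewrite !mcompA -(mcompA _ v') v'v mcompm1 -(mcompA _ (p l)) pj0 //.
  by rewrite mcompm0 mcomp0m.
rewrite -vv' -[in RHS](mcompm1 v) -jp.
rewrite (linear_sum_of _ _ _ (mcomp_linearr v)) (linear_sum_of _ _ _ (mcomp_linearl v')).
apply: eq_bigr => i _; have [h1 h2] := hu' i.
by rewrite !mcompA -(mcompA _ (u' i)) h1 mcompm1.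
Qed.

Lemma is_dsum1 X : is_dsum (fun _ : 'I_1 => X) X.
Proof.
exists (fun _ => mid X), (fun _ => mid X); split=> [i|i j|].
- exact: mcomp1m.
- by rewrite !ord1.
by rewrite big_ord1 mcomp1m.
Qed.

(* A split epimorphism g f = 1 makes f g an idempotent of a local ring. *)
Lemma local_retract_iso X Y (f : mor Y X) (g : mor X Y) :
  local_end X -> ~ is_zero_obj Y -> g \oc f = mid Y -> is_iso g.
Proof.
move=> [_ lX] Y0 gf; have : is_iso (f \oc g + (mid X - f \oc g)).
  by rewrite addrC subrK; exact: is_iso_mid.
have e2 : (f \oc g) \oc (f \oc g) = f \oc g by rewrite mcompA -(mcompA f) gf mcompm1.
case/lX => [[h [h1 h2]]|[h [h1 h2]]].
  exists f; split=> //.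
  by rewrite -[LHS]mcomp1m -h1 -mcompA e2 h1.
case: Y0; rewrite /is_zero_obj -gf -[g \oc f]mcompm1 -gf.
have fg0 : f \oc g = 0.
  rewrite -[LHS]mcompm1 -h2 mcompA mcompmD mcompmN mcompm1 e2 subrr mcomp0m //.
by rewrite mcompA -(mcompA g) fg0 mcompm0 mcomp0m.
Qed.

End LinearCategory.

(** * The shift *)

Section Functor.
Variables (k : fieldType) (C D : lincat k) (F : linfunctor C D).

Lemma fmap_iso X Y (f : mor X Y) : is_iso f -> is_iso (fmap F f).
Proof. by move=> [g [gf fg]]; exists (fmap F g); rewrite -!fmap_comp gf fg !fmap_id. Qed.

Lemma fobj_iso X Y : isomorphic X Y -> isomorphic (F X) (F Y).
Proof. by move=> [f /fmap_iso hf]; exists (fmap F f). Qed.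

Lemma fmap0 X Y : fmap F (0 : mor X Y) = 0.
Proof. exact: (linear0_of (@fmap_linear _ _ _ F X Y)). Qed.

Lemma fobj_zero X : is_zero_obj X -> is_zero_obj (F X).
Proof. by rewrite /is_zero_obj -fmap_id => ->; exact: fmap0. Qed.

Lemma fobj_dsum (I : finType) (A : I -> C) X :
  is_dsum A X -> is_dsum (fun i => F (A i)) (F X).
Proof.
move=> [j [p [pj pj0 jp]]]; exists (fun i => fmap F (j i)), (fun i => fmap F (p i)).
split=> [i|i l il|]; first by rewrite -fmap_comp pj fmap_id.
  by rewrite -fmap_comp pj0 // fmap0.
rewrite -fmap_id -jp.
rewrite (linear_sum_of _ _ _ (@fmap_linear _ _ _ F X X)).
by apply: eq_bigr => i _; rewrite fmap_comp.
Qed.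
End Functor.

Section Shift.
Variables (k : fieldType) (C : shiftcat k).
Implicit Types X Y Z M N : C.

Lemma ush_sh X : isomorphic (ush C (sh C X)) X.
Proof. by apply: isomorphic_sym; exists (sh_unit X); exact: sh_unit_iso. Qed.
Lemma sh_ush X : isomorphic (sh C (ush C X)) X.
Proof. by exists (sh_counit X); exact: sh_counit_iso. Qed.

(** The unit is a natural isomorphism, so a morphism is recovered from its image under [sh] followed
    by [ush]. *)
Lemma sh_inj X Y : injective (fun f : mor X Y => fmap (sh C) f).
Proof.
move=> f g /= e; have [u [uK _]] := sh_unit_iso Y.
rewrite -[f]mcomp1m -[g]mcomp1m -uK -!mcompA; congr (_ \oc _).
by rewrite -!sh_unit_nat e.
Qed.

Lemma ush_inj X Y : injective (fun f : mor X Y => fmap (ush C) f).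
Proof.
move=> f g /= e; have [u [_ uK]] := sh_counit_iso X.
rewrite -[f]mcompm1 -[g]mcompm1 -uK !mcompA; congr (_ \oc _).
by rewrite !sh_counit_nat e.
Qed.

(** The preimage is [ush g] conjugated by the unit. A [shiftcat] carries no triangle identities, so
    the equality is checked after applying [ush], which is faithful thanks to the counit. *)
Lemma sh_full X Y (g : mor (sh C X) (sh C Y)) : exists f : mor X Y, g = fmap (sh C) f.
Proof.
have [u [uK Ku]] := sh_unit_iso Y; have [v [vK Kv]] := sh_unit_iso X.
exists (u \oc fmap (ush C) g \oc sh_unit X); apply: ush_inj => /=.
rewrite -[RHS]mcompm1 -Kv mcompA sh_unit_nat !mcompA Ku mcomp1m -mcompA Kv.
by rewrite mcompm1.
Qed.

Lemma dimk_sh X Y : dimk (mor (sh C X) (sh C Y)) = dimk (mor X Y).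
Proof.
symmetry; apply: (dimk_iso (@fmap_linear _ _ _ (sh C) X Y)).
exists (fun g => sval (cid (sh_full g))) => [f|g]; last by case: cid.
by case: cid => h /= /(@sh_inj _ _ f h).
Qed.

Lemma fobj_iter_iso (F : linfunctor C C) n X Y :
  isomorphic X Y -> isomorphic (iter n F X) (iter n F Y).
Proof. by move=> XY; elim: n => //= n; exact: fobj_iso. Qed.

Lemma shz_iso X Y i : isomorphic X Y -> isomorphic (shz X i) (shz Y i).
Proof. by case: i => n XY; exact: fobj_iter_iso. Qed.

(** For negative i a pair [sh], [ush] has to be cancelled by the counit, hence an isomorphism and
    not an equality of objects. *)
Lemma sh_shz X i : isomorphic (sh C (shz X i)) (shz X (i + 1)).
Proof.
case: i => [n|[|n]].
- by rewrite -PoszD addn1; exact: isomorphic_refl.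
- by rewrite NegzE addNr; exact: sh_ush.
rewrite (_ : Negz n.+1 + 1 = Negz n); last by rewrite !NegzE -[n.+2]addn1 PoszD opprD addrNK.
exact: sh_ush.
Qed.

Lemma shz_sh X i : isomorphic (shz (sh C X) i) (shz X (i + 1)).
Proof.
case: i => [n|[|n]].
- by rewrite -PoszD addn1 /= -iterSr; exact: isomorphic_refl.
- by rewrite NegzE addNr; exact: ush_sh.
rewrite (_ : Negz n.+1 + 1 = Negz n); last by rewrite !NegzE -[n.+2]addn1 PoszD opprD addrNK.
rewrite /shz iterSr; apply: fobj_iter_iso; exact: ush_sh.
Qed.

Lemma ush_shz X i : isomorphic (ush C (shz X i)) (shz X (i - 1)).
Proof.
apply: isomorphic_trans (ush_sh _); apply: fobj_iso; apply: isomorphic_sym.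
by have := sh_shz X (i - 1); rewrite subrK.
Qed.

Lemma shz_shz X i j : isomorphic (shz (shz X i) j) (shz X (i + j)).
Proof.
elim/int_rect: j => [|n IH|n IH]; first by rewrite addr0; exact: isomorphic_refl.
  rewrite -addn1 PoszD addrA.
  exact: isomorphic_trans (isomorphic_trans (isomorphic_sym (sh_shz _ _)) (fobj_iso _ IH)) (sh_shz _ _).
rewrite -addn1 PoszD opprD addrA.
exact: isomorphic_trans (isomorphic_trans (isomorphic_sym (ush_shz _ _)) (fobj_iso _ IH)) (ush_shz _ _).
Qed.

Lemma shz_isoN X Y i : isomorphic (shz X i) Y -> isomorphic X (shz Y (- i)).
Proof.
move=> /(shz_iso (- i)); apply: isomorphic_trans; apply: isomorphic_sym.
by have := shz_shz X i (- i); rewrite subrr.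
Qed.

Lemma dimk_shz M N i j :
  dimk (mor (shz M i) (shz N j)) = dimk (mor M (shz N (j - i))).
Proof.
have step (l j' : int) : dimk (mor (shz M (l + 1)) (shz N j')) = dimk (mor (shz M l) (shz N (j' - 1))).
  rewrite -[in LHS](subrK 1 j') -(dimk_mor_isol _ (sh_shz M l)).
  by rewrite -(dimk_mor_isor _ (sh_shz N _)) dimk_sh.
elim/int_rect: i j => [|n IH|n IH] j; first by rewrite subr0.
  by rewrite -addn1 PoszD step IH -addrA -opprD [1 + _]addrC.
rewrite -addn1 PoszD opprK; have := step (- (n%:Z + 1)) (j + 1).
by rewrite opprD addrNK addrK => <-; rewrite IH opprK -addrA [1 + _]addrC.
Qed.

Lemma sh_indec X : indec X -> indec (sh C X).
Proof.
move=> [X0 hX]; split=> [sX0|A B hAB].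
  exact/X0/(zero_obj_iso (ush_sh X))/fobj_zero.
have : is_biprod (ush C A) (ush C B) X.
  apply: is_dsum_iso (ush_sh X) (fobj_dsum (ush C) hAB).
  by case; exact: isomorphic_refl.
by move/hX; case=> /(fobj_zero (sh C))/(zero_obj_iso (sh_ush _)); [left|right].
Qed.

Lemma ush_indec X : indec X -> indec (ush C X).
Proof.
move=> [X0 hX]; split=> [sX0|A B hAB].
  exact/X0/(zero_obj_iso (sh_ush X))/fobj_zero.
have : is_biprod (sh C A) (sh C B) X.
  apply: is_dsum_iso (sh_ush X) (fobj_dsum (sh C) hAB).
  by case; exact: isomorphic_refl.
by move/hX; case=> /(fobj_zero (ush C))/(zero_obj_iso (ush_sh _)); [left|right].
Qed.

Lemma shz_indec X i : indec X -> indec (shz X i).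
Proof.
by case: i => n hX; rewrite /shz; elim: n => [|n IH] //=; try exact: sh_indec;
  exact: ush_indec.
Qed.

Lemma shz_dsum (I : finType) (A : I -> C) X i :
  is_dsum A X -> is_dsum (fun l => shz (A l) i) (shz X i).
Proof.
by case: i => n hX; rewrite /shz; elim: n => [|n IH] //=; exact: fobj_dsum.
Qed.

End Shift.

(** * Laurent generating functions of Hom dimensions *)

Section LaurentSums.
Local Open Scope classical_set_scope.
Implicit Types (x y : laurent) (d : int -> nat).

Fact lconj_is_zmod_morphism : zmod_morphism lconj.
Proof. by move=> x y; apply: val_inj; rewrite /= rmorphB. Qed.
Fact lconj_is_monoid_morphism : monoid_morphism lconj.
Proof. by split=> [|x y]; apply: val_inj; rewrite /= ?rmorph1 ?rmorphM. Qed.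
HB.instance Definition _ := GRing.isZmodMorphism.Build laurent laurent lconj lconj_is_zmod_morphism.
HB.instance Definition _ := GRing.isMonoidMorphism.Build laurent laurent lconj lconj_is_monoid_morphism.

Lemma lconjK : involutive lconj.
Proof. by move=> x; apply: val_inj; rewrite /= qconjK. Qed.

Lemma lconj_lT i : lconj (lT i) = lT (- i).
Proof. by apply: val_inj; rewrite /= fmorphXz /= qconjT exprz_inv. Qed.

Lemma lTD i j : lT (i + j) = lT i * lT j.
Proof. by apply: val_inj; rewrite /= expfzDr ?qT_neq0. Qed.

Lemma lT0 : lT 0 = 1. Proof. exact: val_inj. Qed.

Definition hilb d : laurent := \sum_(i \in [set: int]) lT i *+ d i.

Definition finsupp d := exists A : seq int, forall i, i \notin A -> d i = 0%N.

Lemma hilbE d (A : seq int) : uniq A -> (forall i, i \notin A -> d i = 0%N) ->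
  hilb d = \sum_(i <- A) lT i *+ d i.
Proof.
move=> uA hA; rewrite /hilb (fsbigE A) //; last by move=> i _ /hA ->; rewrite mulr0n.
by apply: eq_bigl => i; rewrite in_setT.
Qed.

Lemma eq_hilb d d' : d =1 d' -> hilb d = hilb d'.
Proof. by move=> /funext ->. Qed.

Lemma finsupp_sum n (d : 'I_n -> int -> nat) : (forall l, finsupp (d l)) ->
  exists A : seq int, uniq A /\ forall l i, i \notin A -> d l i = 0%N.
Proof.
move=> /choice[A hA]; exists (undup (flatten [seq A l | l <- enum 'I_n])).
split; first exact: undup_uniq.
move=> l i; rewrite mem_undup => hi; apply: hA; apply: contra hi => hi.
by apply/flattenP; exists (A l) => //; apply: map_f; rewrite mem_enum.
Qed.

Lemma hilb_sum n (d : 'I_n -> int -> nat) : (forall l, finsupp (d l)) ->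
  hilb (fun i => (\sum_l d l i)%N) = \sum_l hilb (d l).
Proof.
move=> /finsupp_sum[A [uA hA]]; rewrite (hilbE (A := A)) //; last first.
  by move=> i hi; rewrite big1 // => l _; exact: hA.
rewrite (eq_bigr (fun i => \sum_l lT i *+ d l i)); last first.
  by move=> i _; rewrite -sumrMnr.
by rewrite exchange_big; apply: eq_bigr => l _; rewrite (hilbE (A := A)) // => i; exact: hA.
Qed.

Lemma hilbD d1 d2 : finsupp d1 -> finsupp d2 ->
  hilb (fun i => (d1 i + d2 i)%N) = hilb d1 + hilb d2.
Proof.
move=> h1 h2; pose d (b : 'I_2) := if b == 0 then d1 else d2.
have := @hilb_sum 2 d; rewrite big_ord_recl big_ord1 /d /= => <-.
  by apply: eq_hilb => i; rewrite big_ord_recl big_ord1.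
by move=> b; case: ifP.
Qed.

Lemma finsuppD d1 d2 : finsupp d1 -> finsupp d2 -> finsupp (fun i => d1 i + d2 i)%N.
Proof.
move=> [A hA] [B hB]; exists (A ++ B) => i; rewrite mem_cat negb_or => /andP[iA iB].
by rewrite hA ?hB.
Qed.

Lemma finsupp_shift d s : finsupp d -> finsupp (fun i => d (i - s)).
Proof.
move=> [A hA]; exists [seq i + s | i <- A] => i hi; apply: hA; apply: contra hi => hi.
by apply/mapP; exists (i - s); rewrite ?subrK.
Qed.

Lemma hilb_shift d s : finsupp d -> hilb (fun i => d (i - s)) = lT s * hilb d.
Proof.
move=> [A hA]; rewrite [hilb d](hilbE (A := undup A)) ?undup_uniq //; last first.
  by move=> i; rewrite mem_undup; exact: hA.
rewrite (hilbE (A := [seq i + s | i <- undup A])).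
- rewrite big_map mulr_sumr; apply: eq_bigr => i _.
  by rewrite addrK lTD mulrnAr mulrC.
- by rewrite map_inj_uniq ?undup_uniq //; exact: addIr.
move=> i hi; apply: hA; apply: contra hi => hi; apply/mapP; exists (i - s).
  by rewrite mem_undup.
by rewrite subrK.
Qed.

(** Origin of the factor 1 + t: the ranks with index i - 1 have t times the generating function of
    the ranks with index i. *)
Lemma hilb_defect (dX dY dZ r : int -> nat) :
  finsupp dX -> finsupp dY -> finsupp dZ -> finsupp r ->
  (forall i : int, dX i + dZ i = dY i + (r (i - 1)%R + r i))%N ->
  hilb dX + hilb dZ - hilb dY = (1 + lT 1) * hilb r.
Proof.
move=> fX fY fZ fr e; have fs := finsupp_shift 1 fr.
rewrite -hilbD // (eq_hilb e) !hilbD // ?hilb_shift //; last exact: finsuppD.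
by rewrite addrC addKr mulrDl mul1r addrC.
Qed.

Lemma hilb1 d : d 0 = 1%N -> (forall i, i != 0 -> d i = 0%N) -> hilb d = 1.
Proof.
move=> d0 dN; rewrite (hilbE (A := [:: 0])) //.
  by rewrite big_seq1 d0 lT0.
by move=> i; rewrite inE; exact: dN.
Qed.

Lemma hilb0 d : (forall i, d i = 0%N) -> hilb d = 0.
Proof. by move=> d0; rewrite (hilbE (A := [::])) ?big_nil. Qed.

Lemma hilb_conj d : lconj (hilb d) = hilb (fun i => d (- i)).
Proof.
have -> : hilb (fun i => d (- i)) = \sum_(i \in [set: int]) lconj (lT i *+ d i).
  rewrite /hilb (reindex_fsbigT (fun i : int => - i)); last exact: (inv_bij (@opprK _)).
  by apply: eq_fsbigr => i _; rewrite rmorphMn /= lconj_lT opprK.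
rewrite /hilb; set F := (fun i => lT i *+ d i).
have eS : [set: int] `&` (fun i => lconj (F i)) @^-1` [set~ 0] = [set: int] `&` F @^-1` [set~ 0].
  apply/seteqP; split=> i [_ /= h]; split=> //= e; apply: h; first by rewrite e rmorph0.
  by rewrite -[F i]lconjK e rmorph0.
(* For infinite support both sums take the default value 0, which conjugation fixes. *)
have [fF|iF] := pselect (finite_set ([set: int] `&` F @^-1` [set~ 0])); last first.
  by rewrite !fsbig_dflt ?rmorph0 // eS.
by rewrite fsbig_supp [RHS]fsbig_supp eS !fsbig_finite // rmorph_sum.
Qed.

End LaurentSums.

Section LForm.
Local Open Scope classical_set_scope.
Variables (k : fieldType) (C : shiftcat k).
Implicit Types M N X : C.

Lemma lformE M N : lform M N = hilb (fun i => dimk (mor M (shz N i))).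
Proof. by []. Qed.

Hypothesis hb : hom_bounded C.
Hypothesis hf : hom_finite C.

Lemma finsupp_hom M N : finsupp (fun i => dimk (mor M (shz N i))).
Proof.
have /finite_seqP[A hA] := hb M N; exists A => i iA.
apply: dimkE; apply: has_dim0 => f; apply: contrapT => /eqP f0.
have : [set` A] i by rewrite -hA; exists f.
by rewrite /= (negPf iA).
Qed.

Lemma lform_isol M N X : isomorphic M N -> lform M X = lform N X.
Proof. by move=> MN; apply: eq_hilb => i; exact: dimk_mor_isol. Qed.

Lemma lform_isor M N X : isomorphic M N -> lform X M = lform X N.
Proof. by move=> MN; apply: eq_hilb => i; apply: dimk_mor_isor; exact: shz_iso. Qed.

Lemma lform_dsuml n (A : 'I_n -> C) M N :
  is_dsum A M -> lform M N = \sum_i lform (A i) N.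
Proof.
move=> hA; rewrite -hilb_sum => [|l]; last exact: finsupp_hom.
by apply: eq_hilb => i; apply: dimk_mor_dsuml.
Qed.

Lemma lform_dsumr n (A : 'I_n -> C) M N :
  is_dsum A N -> lform M N = \sum_i lform M (A i).
Proof.
move=> hA; rewrite -hilb_sum => [|l]; last exact: finsupp_hom.
by apply: eq_hilb => i; apply: dimk_mor_dsumr (shz_dsum i hA).
Qed.

Lemma lform_shzl M N i : lform (shz M i) N = lT i * lform M N.
Proof.
rewrite -hilb_shift; last exact: finsupp_hom.
by apply: eq_hilb => j; rewrite dimk_shz.
Qed.

(** Shifting the second variable lowers the index of summation, whence the exponent - i: the
    relation M[i] = t^i M forces the right variable to be conjugate-linear. *)
Lemma lform_shzr M N i : lform M (shz N i) = lT (- i) * lform M N.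
Proof.
rewrite -hilb_shift; last exact: finsupp_hom.
by apply: eq_hilb => j; rewrite opprK addrC; apply: dimk_mor_isor; exact: shz_shz.
Qed.

End LForm.

(** * Universal properties *)

Section UniversalProperties.

Lemma quotmod_lift (R : pzRingType) (V G : lmodType R) (P : set V) (h : V -> G) :
  linear h -> (forall v, P v -> h v = 0) ->
  exists H : quotmod P -> G, linear H /\ forall v, H (qcls P v) = h v.
Proof.
move=> lh h0; have h0' v : submod_gen P v -> h v = 0.
  elim=> {v} [v /h0//||a u v _ hu _ hv].
    by have := lh (-1) 0 0; rewrite scaler0 addr0 scaleN1r addNr.
  by rewrite lh hu hv scaler0 addr0.
have lhB u v : h (u - v) = h u - h v by rewrite addrC -scaleN1r lh scaleN1r addrC.
have e v : h (qrep (qcls P v)) = h v.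
  by apply/eqP; rewrite -subr_eq0 -lhB; apply/eqP/h0'/qcls_eq; rewrite qrepK.
exists (fun x => h (qrep x)); split=> // c x y.
by rewrite -(qrepK x) -(qrepK y) -(qcls_is_linear P) !e lh.
Qed.

HB.instance Definition _ (R : nzRingType) (M : lmodType R) (K : choiceType) (f : K -> M) :=
  GRing.isZmodMorphism.Build {freeg K / R} M (fglift f) (@lift_is_additive R K M f).

Lemma fglift_linear (R : nzRingType) (M : lmodType R) (K : choiceType) (f : K -> M) :
  linear (fglift f).
Proof.
move=> c x y; rewrite raddfD; congr (_ + _).
rewrite -[in RHS](freeg_sumE x) -[c *: x]/(fgscale c x) !raddf_sum.
by apply: eq_bigr => z _; rewrite /= !liftU scalerA.
Qed.

Section ExtLift.
Variables (R : nzRingType) (S : comNzRingType) (phi : {rmorphism R -> S}) (V : lmodType R).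

Lemma tens_lin r (u v : V) :
  tens phi 1 (r *: u + v) = phi r *: tens phi 1 u + tens phi 1 v.
Proof.
rewrite /tens !scale1r -(qcls_is_linear (ext_rel phi (V := V))); apply/qcls_eq/SubmodIn.
by exists r, u, v.
Qed.

Lemma tens0 : tens phi 1 (0 : V) = 0.
Proof.
have := tens_lin (-1) (0 : V) 0.
by rewrite scaler0 addr0 rmorphN1 scaleN1r addNr.
Qed.

(** Universal property of extension of scalars: a map that is semilinear along [phi] kills
    [ext_rel]. *)
Lemma extsc_lift (G : lmodType S) (h : V -> G) :
  (forall r u v, h (r *: u + v) = phi r *: h u + h v) ->
  exists H : extsc phi V -> G, linear H /\ forall s v, H (tens phi s v) = s *: h v.
Proof.
move=> hl.
have lg := fglift_linear h.
have [|H [lH HE]] := @quotmod_lift _ _ _ (ext_rel phi (V := V)) _ lg.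
  move=> _ [r [u [v ->]]]; rewrite raddfB /= lg !liftU !scale1r hl.
  by rewrite subrr.
exists H; split=> // s v; rewrite /tens.
have -> : H (s *: qcls (ext_rel phi (V := V)) << v >>) = s *: H (qcls (ext_rel phi (V := V)) << v >>).
  exact: (linearZ_of s lH).
by rewrite HE liftU scale1r.
Qed.

Lemma extsc_ind (Q : extsc phi V -> Prop) :
  (forall a x y, Q x -> Q y -> Q (a *: x + y)) -> Q 0 ->
  (forall v, Q (tens phi 1 v)) -> forall x, Q x.
Proof.
move=> Qlin Q0 Qt x; rewrite -(qrepK x).
rewrite -[qrep x]freeg_sumE; elim: (dom _) => [|z l IH].
  by rewrite big_nil (linear0_of (qcls_is_linear (ext_rel phi (V := V)))).
rewrite big_cons.
have -> : << coeff z (qrep x) *g z >> = coeff z (qrep x) *: << z >> :> {freeg V / S}.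
  by apply/eqP/freeg_eqP => w; rewrite coeffZ !coeffU mul1r.
rewrite (qcls_is_linear (ext_rel phi (V := V))); apply: Qlin => //.
by have := Qt z; rewrite /tens scale1r.
Qed.
End ExtLift.

Lemma freeg_ind (R : nzRingType) (K : choiceType) (Q : {freeg K / R} -> Prop) :
  (forall a x y, Q x -> Q y -> Q (a *: x + y)) -> Q 0 ->
  (forall z, Q << z >>) -> forall x, Q x.
Proof.
move=> Qlin Q0 Qt x; rewrite -[x]freeg_sumE; elim: (dom _) => [|z l IH].
  by rewrite big_nil.
rewrite big_cons.
have -> : << coeff z x *g z >> = coeff z x *: << z >> :> {freeg K / R}.
  by apply/eqP/freeg_eqP => w; rewrite coeffZ !coeffU mul1r.
exact: Qlin.
Qed.

Lemma freeg_lift_int (K : choiceType) (G : zmodType) (f : K -> G) :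
  exists h : {freeg K / int} -> G, [/\ {morph h : x y / x + y},
    forall n x, h (n *: x) = h x *~ n & forall z, h << z >> = f z].
Proof.
exists (fglift (f : K -> zmodule G)); split=> [x y|n x|z].
- exact (linearD_of (@fglift_linear int (zmodule G) K f) x y).
- exact (linearZ_of n (@fglift_linear int (zmodule G) K f) x).
by rewrite liftU scale1r.
Qed.
End UniversalProperties.

(** * Decompositions of an indecomposable object *)

Section IndecomposableSummands.
Variables (k : fieldType) (C : lincat k).
Hypothesis biprod_ex : forall X Y : C, exists Z, is_biprod X Y Z.

(** Idempotents need not split in a linear category. These do, through the biproduct of the summands
    involved, built by adding one summand at a time. *)
Lemma partial_sum_splits n (A : 'I_n -> C) X
    (j : forall i, mor (A i) X) (p : forall i, mor X (A i)) (i0 : 'I_n) (l : seq 'I_n) :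
  (forall i, p i \oc j i = mid (A i)) -> (forall i l, i != l -> p l \oc j i = 0) ->
  uniq (i0 :: l) ->
  exists Z (s : mor Z X) (r : mor X Z),
    r \oc s = mid Z /\ s \oc r = \sum_(i <- i0 :: l) j i \oc p i.
Proof.
move=> pj pj0; elim: l i0 => [|i1 l IH] i0 u.
  by exists (A i0), (j i0), (p i0); rewrite big_seq1 pj.
have /IH[Z [s [r [rs sr]]]] : uniq (i1 :: l) by case/andP: u.
have ni : i0 \notin i1 :: l by case/andP: u.
have es : s = s \oc r \oc s by rewrite -mcompA rs mcompm1.
have er : r = r \oc (s \oc r) by rewrite mcompA rs mcomp1m.
have ps : p i0 \oc s = 0.
  rewrite es sr mcompA (linear_sum_of _ _ _ (mcomp_linearr _)) big_seq big1 ?mcomp0m //.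
  move=> i il; rewrite mcompA pj0 ?mcomp0m //; apply: contraNneq ni => <- //.
have rj : r \oc j i0 = 0.
  rewrite er sr -mcompA (linear_sum_of _ _ _ (mcomp_linearl _)) big_seq big1 ?mcompm0 //.
  move=> i il; rewrite -mcompA pj0 ?mcompm0 //; apply: contraNneq ni => -> //.
have [Z2 [jj [pp [ppjj ppjj0 jjpp]]]] := biprod_ex (A i0) Z.
pose ja : mor (A i0) Z2 := jj true; pose jz : mor Z Z2 := jj false.
pose pa : mor Z2 (A i0) := pp true; pose pz : mor Z2 Z := pp false.
have e1 : pa \oc ja = mid _ := ppjj true.
have e2 : pz \oc jz = mid _ := ppjj false.
have e3 : pz \oc ja = 0 := ppjj0 true false isT.
have e4 : pa \oc jz = 0 := ppjj0 false true isT.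
have e5 : ja \oc pa + jz \oc pz = mid Z2 by rewrite -jjpp big_bool.
exists Z2, (j i0 \oc pa + s \oc pz), (ja \oc p i0 + jz \oc r); split.
  rewrite mcompDm !mcompmD !mcompA -!(mcompA ja) -!(mcompA jz) pj ps rs rj.
  by rewrite !(mcomp0m, mcompm0, mcomp1m) addr0 add0r -e5.
rewrite big_cons -sr mcompDm !mcompmD !mcompA -!(mcompA (j i0)) -!(mcompA s).
by rewrite e1 e2 e3 e4 !(mcomp0m, mcompm0, mcomp1m) addr0 add0r.
Qed.

(** [indec] speaks of two summands only, so all terms but one are first gathered into an object Z.
    Then [A i0] or Z is zero, although each of them has an indecomposable retract. The lemma makes
    [Acls] of an indecomposable a basis vector. *)
Lemma indec_dsum_single n (A : 'I_n -> C) X : indec X -> (forall i, indec (A i)) ->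
  is_dsum A X -> exists i0, isomorphic (A i0) X /\ forall i, i = i0.
Proof.
move=> [X0 hX] hA [j [p [pj pj0 jp]]].
have [i0|I0] := pickP (fun _ : 'I_n => true); last first.
  by case: X0; rewrite /is_zero_obj -jp big1 // => i _; have := I0 i.
move=> _; exists i0; suff all0 i : i = i0.
  split=> //; exists (j i0), (p i0); split=> //.
  by rewrite -jp (bigD1 i0) //= big1 ?addr0 // => i; rewrite (all0 i) eqxx.
apply: contrapT => /eqP ni.
pose l := rem i0 (enum 'I_n).
have ul : uniq (i0 :: l).
  by rewrite /l -(perm_uniq (perm_to_rem (mem_enum _ i0))) enum_uniq.
have : i \in l by rewrite /l mem_rem_uniq ?enum_uniq // inE ni mem_enum.
have : perm_eq (enum 'I_n) (i0 :: l) by exact: perm_to_rem (mem_enum _ _).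
move: l ul => [|i1 l] // ul pl il.
have ul1 : uniq (i1 :: l) by case/andP: ul.
have [Z [s [r [rs sr]]]] := partial_sum_splits pj pj0 ul1.
have sum1 : j i0 \oc p i0 + s \oc r = mid X.
  rewrite sr -jp; transitivity (\sum_(i <- enum 'I_n) j i \oc p i).
    by rewrite (perm_big _ pl) [RHS]big_cons.
  by rewrite big_enum.
have [Z0|A0] : is_zero_obj Z \/ is_zero_obj (A i0).
- have : is_biprod Z (A i0) X.
    exists (fun b : bool => if b return mor (if b then Z else A i0) X then s else j i0).
    exists (fun b : bool => if b return mor X (if b then Z else A i0) then r else p i0).
    split; last by rewrite big_bool /= addrC sum1.
      by case.
    have es : s = s \oc r \oc s by rewrite -mcompA rs mcompm1.
    have er : r = r \oc (s \oc r) by rewrite mcompA rs mcomp1m.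
    have psr : p i0 \oc (s \oc r) = 0.
      have /(congr1 (fun f => p i0 \oc f)) := sum1.
      by rewrite mcompmD mcompA pj mcomp1m mcompm1 -[RHS]addr0 => /addrI.
    have srj : (s \oc r) \oc j i0 = 0.
      have /(congr1 (fun f => f \oc j i0)) := sum1.
      by rewrite mcompDm -mcompA pj mcomp1m mcompm1 -[RHS]addr0 => /addrI.
    case; case=> // _; first by rewrite es mcompA psr mcomp0m.
    by rewrite er -mcompA srj mcompm0.
  exact: hX.
- have [i1A0 _] := hA i1; apply: i1A0.
  have : p i1 \oc (s \oc r) \oc j i1 = mid (A i1).
    rewrite sr (linear_sum_of _ _ _ (mcomp_linearr _)) (linear_sum_of _ _ _ (mcomp_linearl _)).
    rewrite big_cons big_seq big1 ?addr0 => [|i' il'].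
      by rewrite mcompA pj mcomp1m pj.
    rewrite mcompA pj0 ?mcomp0m //; apply: contraTneq il' => ->.
    by case/andP: ul1.
  by rewrite (zero_obj_mor r) ?mcompm0 ?mcomp0m //; right.
by have [] := hA i0.
Qed.
End IndecomposableSummands.

(** * The Grothendieck group and its forms *)

Section Grothendieck.
Local Open Scope classical_set_scope.
Variables (k : fieldType) (C : shiftcat k).
Implicit Types X Y M N : C.

Lemma icls_iso X Y (hX : indec X) (hY : indec Y) : isomorphic X Y -> icls hX = icls hY.
Proof.
move=> XY; apply: eq_exist; apply/seteqP; split=> Z /=.
  exact: isomorphic_trans (isomorphic_sym XY).
exact: isomorphic_trans XY.
Qed.

Lemma icls_repr_ex (c : isoclass C) : exists X, exists hX : indec X, c = icls hX.
Proof.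
case: c => c hc; have [X hX e] := hc; exists X, hX.
exact: eq_exist.
Qed.

Definition icls_repr (c : isoclass C) : C := sval (cid (icls_repr_ex c)).

Lemma icls_reprP (c : isoclass C) : exists hX : indec (icls_repr c), c = icls hX.
Proof. by rewrite /icls_repr; case: cid. Qed.

Lemma icls_inj X Y (hX : indec X) (hY : indec Y) : icls hX = icls hY -> isomorphic X Y.
Proof.
move/(congr1 sval)/seteqP => /= [_ /(_ Y)]; apply; exact: isomorphic_refl.
Qed.

Lemma AclsE M : (exists n (A : 'I_n -> C), (forall i, indec (A i)) /\ is_dsum A M) ->
  exists n (A : 'I_n -> C) (hA : forall i, indec (A i)),
    is_dsum A M /\ Acls M = \sum_i << icls (hA i) >>.
Proof.
move=> [n [A [hA dA]]]; rewrite /Acls; case: xgetP => [a _ //|].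
by move=> /(_ (\sum_i << icls (hA i) >>)) []; exists n, A, hA.
Qed.

Hypothesis biprod_ex : forall X Y, exists Z, is_biprod X Y Z.

Lemma Acls_indec X (hX : indec X) : Acls X = << icls hX >>.
Proof.
have [|n [A [hA [dA ->]]]] := @AclsE X.
  by exists 1%N, (fun=> X); split=> //; exact: is_dsum1.
have [i0 [iX u]] := indec_dsum_single biprod_ex hX hA dA.
rewrite (bigD1 i0) //= big1 ?addr0 => [|i]; last by rewrite (u i) eqxx.
by congr [freeg [:: (_, _)]]; exact: icls_iso.
Qed.

(** Identities between forms are checked on indecomposables through this principle and [AQt_ind].
    Since [Acls_indec] rests on biproducts only, both apply to [Db L]. *)
Lemma At_ind (Q : At C -> Prop) : (forall a x y, Q x -> Q y -> Q (a *: x + y)) -> Q 0 ->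
  (forall X, indec X -> Q (Atcls X)) -> forall x, Q x.
Proof.
move=> Qlin Q0 QX x; rewrite -(qrepK x); elim/extsc_ind: (qrep x) => [a u v|| a].
- by rewrite (qcls_is_linear (@At_rel k C)); exact: Qlin.
- by rewrite (linear0_of (qcls_is_linear (@At_rel k C))).
elim/freeg_ind: a => [n u v hu hv||c].
- by rewrite tens_lin (qcls_is_linear (@At_rel k C)); exact: Qlin.
- by rewrite tens0 (linear0_of (qcls_is_linear (@At_rel k C))).
have [hX ->] := icls_reprP c.
by have := QX _ hX; rewrite /Atcls (Acls_indec hX).
Qed.

Lemma AQt_ind (Q : AQt C -> Prop) : (forall a x y, Q x -> Q y -> Q (a *: x + y)) -> Q 0 ->
  (forall X, indec X -> Q (AQtcls X)) -> forall x, Q x.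
Proof.
move=> Qlin Q0 QX x; elim/extsc_ind: x => // a; elim/At_ind: a => [c u v hu hv||X /QX] //.
  by rewrite tens_lin; exact: Qlin.
by rewrite tens0.
Qed.

End Grothendieck.

Section Sesquilinear.
Variables (R : comNzRingType) (cj : {rmorphism R -> R}) (V : lmodType R).
Variables (f : V -> V -> R) (hf : is_sesquilinear cj f).

Lemma sesqPl a x x' y : f (a *: x + x') y = a * f x y + f x' y.
Proof. by have [h _] := hf; have := h a 1 x x' y; rewrite scale1r mul1r. Qed.
Lemma sesqPr a x y y' : f x (a *: y + y') = cj a * f x y + f x y'.
Proof. by have [_ h] := hf; have := h a 1 x y y'; rewrite scale1r rmorph1 mul1r. Qed.
Lemma sesq0l y : f 0 y = 0.
Proof. by have := sesqPl (-1) 0 0 y; rewrite scaler0 addr0 mulN1r addNr. Qed.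
Lemma sesq0r x : f x 0 = 0.
Proof. by have := sesqPr (-1) x 0 0; rewrite scaler0 addr0 rmorphN1 mulN1r addNr. Qed.
Lemma sesqDl x x' y : f (x + x') y = f x y + f x' y.
Proof. by have := sesqPl 1 x x' y; rewrite scale1r mul1r. Qed.
Lemma sesqDr x y y' : f x (y + y') = f x y + f x y'.
Proof. by have := sesqPr 1 x y y'; rewrite scale1r rmorph1 mul1r. Qed.
Lemma sesqZl a x y : f (a *: x) y = a * f x y.
Proof. by have := sesqPl a x 0 y; rewrite sesq0l !addr0. Qed.
Lemma sesqZr a x y : f x (a *: y) = cj a * f x y.
Proof. by have := sesqPr a x y 0; rewrite sesq0r !addr0. Qed.
Lemma sesqBl x x' y : f (x - x') y = f x y - f x' y.
Proof. by rewrite sesqDl -scaleN1r sesqZl mulN1r. Qed.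
Lemma sesqBr x y y' : f x (y - y') = f x y - f x y'.
Proof. by rewrite sesqDr -scaleN1r sesqZr rmorphN1 mulN1r. Qed.
End Sesquilinear.

(** * Uniqueness, Hermitian symmetry and existence of the forms *)

Section Forms.
Variables (k : fieldType) (C : shiftcat k).
Implicit Types X Y M N : C.
Hypothesis biprod_ex : forall X Y, exists Z, is_biprod X Y Z.

Lemma hform_uniq (f g : At C -> At C -> laurent) : hform f -> hform g -> f = g.
Proof.
move=> [sf ef] [sg eg]; apply/funext=> x; apply/funext=> y.
elim/(At_ind biprod_ex): x => [a x x' h h'||X _].
- by rewrite (sesqPl sf) (sesqPl sg) h h'.
- by rewrite (sesq0l sf) (sesq0l sg).
elim/(At_ind biprod_ex): y => [a x x' h h'||Y _].
- by rewrite (sesqPr (cj := lconj) sf) (sesqPr (cj := lconj) sg) h h'.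
- by rewrite (sesq0r (cj := lconj) sf) (sesq0r (cj := lconj) sg).
by rewrite ef eg.
Qed.

Lemma hformQ_uniq (f g : AQt C -> AQt C -> Qt) : hformQ f -> hformQ g -> f = g.
Proof.
move=> [sf ef] [sg eg]; apply/funext=> x; apply/funext=> y.
elim/(AQt_ind biprod_ex): x => [a x x' h h'||X _].
- by rewrite (sesqPl sf) (sesqPl sg) h h'.
- by rewrite (sesq0l sf) (sesq0l sg).
elim/(AQt_ind biprod_ex): y => [a x x' h h'||Y _].
- by rewrite (sesqPr (cj := qconj) sf) (sesqPr (cj := qconj) sg) h h'.
- by rewrite (sesq0r (cj := qconj) sf) (sesq0r (cj := qconj) sg).
by rewrite ef eg.
Qed.

Lemma hform_hermitian (f : At C -> At C -> laurent) :
  (forall M N, lform M N = lconj (lform N M)) -> hform f ->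
  forall x y, f x y = lconj (f y x).
Proof.
move=> herm [sf ef] x y.
elim/(At_ind biprod_ex): x => [a x x' h h'||X _].
- by rewrite (sesqPl sf) (sesqPr (cj := lconj) sf) h h' rmorphD rmorphM /= lconjK.
- by rewrite (sesq0l sf) (sesq0r (cj := lconj) sf) rmorph0.
elim/(At_ind biprod_ex): y => [a x x' h h'||Y _].
- by rewrite (sesqPl sf) (sesqPr (cj := lconj) sf) h h' rmorphD rmorphM.
- by rewrite (sesq0l sf) (sesq0r (cj := lconj) sf) rmorph0.
by rewrite !ef.
Qed.

Lemma hformQ_hermitian (f : AQt C -> AQt C -> Qt) :
  (forall M N, lform M N = lconj (lform N M)) -> hformQ f ->
  forall x y, f x y = qconj (f y x).
Proof.
move=> herm [sf ef] x y.
elim/(AQt_ind biprod_ex): x => [a x x' h h'||X _].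
- by rewrite (sesqPl sf) (sesqPr (cj := qconj) sf) h h' rmorphD rmorphM /= qconjK.
- by rewrite (sesq0l sf) (sesq0r (cj := qconj) sf) rmorph0.
elim/(AQt_ind biprod_ex): y => [a x x' h h'||Y _].
- by rewrite (sesqPl sf) (sesqPr (cj := qconj) sf) h h' rmorphD rmorphM.
- by rewrite (sesq0l sf) (sesq0r (cj := qconj) sf) rmorph0.
by rewrite !ef herm.
Qed.

Hypothesis decomp : forall X, exists (n : nat) (A : 'I_n -> C),
  (forall i, indec (A i)) /\ is_dsum A X.

(** The three hypotheses match the three layers of [At C]: invariance makes the value on an isoclass
    independent of its representative, additivity computes the value on [Acls M], and compatibility
    with shifts kills [At_rel]. *)
Lemma At_lift (phi : C -> laurent) :
  (forall X Y, isomorphic X Y -> phi X = phi Y) ->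
  (forall n (A : 'I_n -> C) M, is_dsum A M -> phi M = \sum_i phi (A i)) ->
  (forall M i, phi (shz M i) = lT i * phi M) ->
  exists L : At C -> laurent^o, linear L /\ forall M, L (Atcls M) = phi M.
Proof.
move=> phi_iso phi_sum phi_sh.
have [h [hD hZ hE]] := freeg_lift_int (fun c : isoclass C => phi (icls_repr c)).
have hA M : h (Acls M) = phi M.
  have [n [A [hA [dA ->]]]] := AclsE (decomp M).
  have h0 : h 0 = 0 by have := hZ 0 0; rewrite scaler0 mulr0z.
  rewrite (phi_sum _ _ _ dA) (big_morph h hD h0); apply: eq_bigr => i _.
  rewrite hE; apply: phi_iso; have [hX] := icls_reprP (icls (hA i)).
  by move/icls_inj/isomorphic_sym.
have [|H [lH HE]] := @extsc_lift _ _ intr (Agrp C) laurent^o h.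
  by move=> r u v; rewrite hD hZ -mulrzl.
have [|L [lL LE]] := @quotmod_lift _ _ _ (@At_rel k C) H lH.
  move=> _ [M [i ->]]; rewrite (linearD_of lH) (linearN_of lH) !HE !hA scale1r phi_sh.
  by rewrite subrr.
by exists L; split=> // M; rewrite LE HE scale1r hA.
Qed.

Hypothesis hb : hom_bounded C.
Hypothesis hf : hom_finite C.

(* Conjugating twice turns the conjugate-linear slot into a linear one, to which
   [At_lift] applies. *)
Lemma hform_ex : exists f : At C -> At C -> laurent, hform f.
Proof.
have /choice[L hL] N : exists L : At C -> laurent^o, linear L /\ forall M, L (Atcls M) = lform M N.
  apply: At_lift => [X Y|n A M|M i].
  - exact: lform_isol.
  - exact: lform_dsuml.
  - exact: lform_shzl.
have LE N M : L N (Atcls M) = lform M N by case: (hL N).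
have lL N : linear (L N) by case: (hL N).
(* The requirements of [At_lift] in the second variable become equalities between the linear maps
   [L N], which are determined by their values on classes. *)
have L_eq N (l : At C -> laurent^o) : linear l -> (forall M, l (Atcls M) = lform M N) -> L N = l.
  move=> ll lE; apply/funext; elim/(At_ind biprod_ex) => [a x y hx hy||X _].
  - by rewrite lL ll hx hy.
  - by rewrite !linear0_of.
  - by rewrite LE lE.
have /choice[T hT] x : exists T : At C -> laurent^o, linear T /\
    forall N, T (Atcls N) = lconj (L N x).
  apply: At_lift => [X Y XY|n A M dA|M i].
  - congr (lconj _); rewrite (L_eq X (L Y)) // => M.
    by rewrite LE; symmetry; exact: lform_isor.
  - rewrite (L_eq M (fun x => \sum_i L (A i) x)) ?rmorph_sum // => [a u v|N].
      by rewrite scaler_sumr -big_split; apply: eq_bigr => i _; rewrite lL.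
    by rewrite (lform_dsumr _ _ _ dA) //; apply: eq_bigr => i _; rewrite LE.
  - rewrite (L_eq _ (fun x => lT (- i) *: L M x)) => [|a u v|N].
    + by rewrite rmorphM /= lconj_lT opprK.
    + by rewrite lL scalerDr !scalerA mulrC.
    + by rewrite LE lform_shzr.
have TE x N : T x (Atcls N) = lconj (L N x) by case: (hT x).
have lT' x : linear (T x) by case: (hT x).
exists (fun x y => lconj (T x y)); split; last by move=> M N; rewrite TE lconjK LE.
split=> [a1 a2 x1 x2 y|b1 b2 x y1 y2]; last first.
  by rewrite lT' rmorphD rmorphM (linearZ_of b2 (lT' x)) /= rmorphM.
(* Linearity in the left variable is not visible on [T], which was chosen separately for each x; it
   is verified by induction on y. *)
elim/(At_ind biprod_ex): y => [c y y' h h'||N _].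
- have e x : lconj (T x (c *: y + y')) = lconj c * lconj (T x y) + lconj (T x y').
    by rewrite lT' rmorphD rmorphM.
  by rewrite !e h h' !mulrDr [RHS]addrACA ![lconj c * (_ * _)]mulrCA.
- by rewrite !(linear0_of (lT' _)) rmorph0 !mulr0 addr0.
by rewrite !TE !lconjK lL (linearZ_of a2 (lL N)).
Qed.

(** The form on [At C] is extended along [lval] one variable at a time. As over the Laurent
    polynomials, the right variable is made linear by a conjugation that is undone at the end. *)
Lemma hformQ_ex : exists F : AQt C -> AQt C -> Qt, hformQ F.
Proof.
have [f [sf fE]] := hform_ex.
have /choice[L hL] y : exists L : AQt C -> Qt^o, linear L /\
    forall s x, L (tens lval s x) = s * lval (f x y).
  apply: (@extsc_lift _ _ lval (At C) Qt^o (fun x => lval (f x y))) => r u v.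
  by rewrite (sesqPl sf) rmorphD rmorphM.
have LE y s x : L y (tens lval s x) = s * lval (f x y) by case: (hL y).
have lL y : linear (L y) by case: (hL y).
have L_lin c y y' x : L (c *: y + y') x = lval (lconj c) * L y x + L y' x.
  elim/extsc_ind: x => [a u v hu hv||v].
  - by rewrite !lL hu hv /GRing.scale /= !mulrDr !addrA; congr (_ + _); rewrite addrAC mulrCA.
  - by rewrite !(linear0_of (lL _)) mulr0 addr0.
  by rewrite !LE !mul1r (sesqPr (cj := lconj) sf) rmorphD rmorphM.
have /choice[T hT] x : exists T : AQt C -> Qt^o, linear T /\
    forall s y, T (tens lval s y) = s * qconj (L y x).
  apply: (@extsc_lift _ _ lval (At C) Qt^o (fun y => qconj (L y x))) => r u v.
  by rewrite L_lin rmorphD rmorphM /= qconjK.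
have TE x s y : T x (tens lval s y) = s * qconj (L y x) by case: (hT x).
have lT' x : linear (T x) by case: (hT x).
exists (fun x y => qconj (T x y)); split; last first.
  by move=> M N; rewrite TE mul1r qconjK LE mul1r fE.
split=> [a1 a2 x1 x2 y|b1 b2 x y1 y2]; last first.
  by rewrite lT' rmorphD rmorphM (linearZ_of b2 (lT' x)) /= rmorphM.
elim/extsc_ind: y => [c y y' h h'||v].
- have e x : qconj (T x (c *: y + y')) = qconj c * qconj (T x y) + qconj (T x y').
    by rewrite lT' rmorphD rmorphM.
  by rewrite !e h h' !mulrDr [RHS]addrACA ![qconj c * (_ * _)]mulrCA.
- by rewrite !(linear0_of (lT' _)) rmorph0 !mulr0 addr0.
by rewrite !TE !mul1r !qconjK lL (linearZ_of a2 (lL _)).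
Qed.

End Forms.

(** * Triangles and Auslander-Reiten triangles *)

Section TriangleExactness.
Variables (k : fieldType) (C : shiftcat k) (dist : triangle_class C).
Hypothesis tri : triangulated dist.
Variables (X Y Z : C) (f : mor X Y) (g : mor Y Z) (h : mor Z (sh C X)).
Hypothesis fgh : dist f g h.

(** The triangle X = X -> 0 maps to the given one by the identity of X and by f; the square that
    [tr_fill] completes factors [g \oc f] through 0. *)
Lemma dist_comp0 : g \oc f = 0.
Proof.
have [O O0] := tr_zero tri.
have [|w [-> _]] := tr_fill tri (u := mid X) (v := f) (tr_id tri X O0) fgh; first by [].
by rewrite mcompm0.
Qed.

(** After rotation, v is completed to a map from W -> 0 -> W[1] to Y -> Z -> X[1]. The third
    component is a map W[1] -> X[1], which fullness of the shift brings back to W -> X; the two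
    signs of the rotations cancel. *)
Lemma dist_factor_fst W (v : mor W Y) : g \oc v = 0 -> exists u, v = f \oc u.
Proof.
move=> gv; have [O O0] := tr_zero tri.
have t1 := (tr_rot tri _ _ _).1 (tr_id tri W O0).
have t2 := (tr_rot tri _ _ _).1 fgh.
have [|w [_ wE]] := tr_fill tri (u := v) (v := 0) t1 t2; first by rewrite gv mcompm0.
have [u uE] := sh_full w; exists u; apply: sh_inj => /=.
move: wE; rewrite uE mcompNm mcompmN fmap_id mcompm1 => /oppr_inj <-.
by rewrite fmap_comp.
Qed.

(** Here v is completed to a map into the triangle 0 -> W = W, whose third component is already the
    factorization. *)
Lemma dist_factor_snd W (v : mor Y W) : v \oc f = 0 -> exists w, v = w \oc g.
Proof.
move=> vf; have [O O0] := tr_zero tri.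
have t1 : dist (0 : mor O W) (mid W) (0 : mor W (sh C O)).
  apply/(tr_rot tri); rewrite fmap0 oppr0; apply: (tr_id tri).
  exact: fobj_zero.
have [|w [wE _]] := tr_fill tri (u := 0) (v := v) fgh t1; first by rewrite vf mcompm0.
by exists w; rewrite -wE mcomp1m.
Qed.
End TriangleExactness.

Section TriangleRotations.
Variables (k : fieldType) (C : shiftcat k) (dist : triangle_class C).
Hypothesis tri : triangulated dist.
Variables (X Y Z : C) (f : mor X Y) (g : mor Y Z) (h : mor Z (sh C X)).
Hypothesis fgh : dist f g h.

Let rot1 := (tr_rot tri _ _ _).1 fgh.
Let rot2 := (tr_rot tri _ _ _).1 rot1.

Lemma dist_comp0_rot : h \oc g = 0.
Proof. exact: (dist_comp0 tri rot1). Qed.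

Lemma dist_comp0_rot2 : fmap (sh C) f \oc h = 0.
Proof. by apply: oppr_inj; rewrite oppr0 -mcompNm; exact: (dist_comp0 tri rot2). Qed.

Lemma dist_factor_fst_rot W (v : mor W Z) : h \oc v = 0 -> exists u, v = g \oc u.
Proof. exact: (dist_factor_fst tri rot1). Qed.

Lemma dist_factor_fst_rot2 W (v : mor W (sh C X)) :
  fmap (sh C) f \oc v = 0 -> exists u, v = h \oc u.
Proof.
move=> e; apply: (dist_factor_fst tri rot2); by rewrite mcompNm e oppr0.
Qed.

Lemma dist_factor_snd_rot W (v : mor Z W) : v \oc g = 0 -> exists w, v = w \oc h.
Proof. exact: (dist_factor_snd tri rot1). Qed.

Lemma dist_factor_snd_rot2 W (v : mor (sh C X) W) :
  v \oc h = 0 -> exists w, v = w \oc fmap (sh C) f.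
Proof.
move=> /(dist_factor_snd tri rot2)[w ->]; exists (- w).
by rewrite mcompmN mcompNm.
Qed.
End TriangleRotations.

(** * Endomorphisms over an algebraically closed field *)

Section LocalEndomorphisms.
Variables (k : closedFieldType) (C : lincat k).

Lemma dimk_eq0 (V : lmodType k) : finite_dim V -> dimk V = 0%N -> forall v : V, v = 0.
Proof.
move=> fV V0 v; apply: (bij_inj (coords_bij fV)).
by rewrite (linear0_of (coords_linear fV)); apply/rowP=> -[j jV]; exfalso; rewrite V0 in jV.
Qed.

(** Composition with f on the nonzero finite-dimensional space End(X) has an eigenvalue a, as the
    field is algebraically closed. An eigenvector is a nonzero g with (f - a) g = 0, so f - a is not
    invertible. This is the form in which the residue field being k is used. *)
Lemma noniso_translate (X : C) (f : mor X X) : ~ is_zero_obj X -> finite_dim (mor X X) ->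
  exists a : k, ~ is_iso (f - a *: mid X).
Proof.
move=> X0 fX; pose A := matrix_of (fun g : mor X X => f \oc g).
have [a] : exists a, root (char_poly A) a.
  apply/closed_rootP; rewrite size_char_poly eqSS.
  by apply/eqP => /(dimk_eq0 fX)/(_ (mid X)).
rewrite -eigenvalue_root_char => /eigenvalueP[v vA v0]; exists a => -[u [uf _]].
have [c cK Kc] := coords_bij fX.
case/eqP: v0; rewrite -(Kc v) -[c v]mcomp1m -uf -mcompA.
have -> : (f - a *: mid X) \oc c v = 0.
  rewrite mcompDm mcompNm mcompZm mcomp1m; apply/eqP; rewrite subr_eq0; apply/eqP.
  apply: (bij_inj (coords_bij fX)).
  rewrite (@matrix_ofP _ _ _ (fun g : mor X X => f \oc g)) //; last exact: mcomp_linearr.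
  by rewrite (linearZ_of _ (coords_linear fX)) Kc.
by rewrite mcompm0 (linear0_of (coords_linear fX)).
Qed.
End LocalEndomorphisms.

(** * Ranks of the connecting map of an Auslander-Reiten triangle *)

Section AuslanderReiten.
Variables (k : closedFieldType) (C : shiftcat k) (dist : triangle_class C).
Hypotheses (tri : triangulated dist) (ks : krull_schmidt C).
Hypotheses (hf : hom_finite C) (hb : hom_bounded C).
Implicit Types M N W : C.

(** For i nonzero, all the spaces Hom(M, M[n i]) would have the dimension of End(M), which is
    positive, against boundedness. For M = Z this confines the rank of the connecting map to degree
    0. *)
Lemma shz_aperiodic M i : indec M -> isomorphic M (shz M i) -> i = 0.
Proof.
move=> [M0 _] hM; apply: contrapT => /eqP i0.
have per (n : nat) : isomorphic M (shz M (i *~ n)).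
  elim: n => [|n IH]; first exact: isomorphic_refl.
  rewrite -addn1 PoszD mulrzDr mulr1z.
  exact: isomorphic_trans hM (isomorphic_trans (shz_iso i IH) (shz_shz _ _ _)).
have [A hA] := finsupp_hom hb M M.
(* This n exceeds every absolute value of an index in A, hence so does that of i n. *)
pose n := (\sum_(a <- A) `|a|%N).+1.
have nA : i *~ n \notin A.
  apply/negP => iA; have : (`|(i *~ n : int)|%N <= \sum_(a <- A) `|a|%N)%N.
    by rewrite (big_rem _ iA) /= leq_addr.
  apply/negP; rewrite -ltnNge mulrzz abszM absz_nat /n.
  by apply: leq_pmull; rewrite absz_gt0.
apply: M0; apply: (dimk_eq0 (hf M M)).
by rewrite (dimk_mor_isor _ (per n)) hA.
Qed.

Variables (X Y Z : C) (a : mor X Y) (b : mor Y Z) (c : mor Z (sh C X)).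
Hypothesis ar : AR_triangle dist a b c.

Let abc : dist a b c. Proof. by case: ar. Qed.
Let hX : indec X. Proof. by case: ar. Qed.
Let hZ : indec Z. Proof. by case: ar. Qed.
Let c0 : c <> 0. Proof. by case: ar. Qed.
Let hsX : indec (sh C X) := sh_indec hX.

Lemma AR_right_kills W (f : mor W Z) : ~ split_epi f -> c \oc f = 0.
Proof.
case: ar => _ _ _ _ /[apply] -[g ->].
by rewrite mcompA (dist_comp0_rot tri abc) mcomp0m.
Qed.

(* The weak kernel e of h c is not a split epimorphism, so it is killed by c;
   hence c factors as u h c, and u h is invertible in the local ring End(X[1]). *)
Lemma AR_left_split N (h : mor (sh C X) N) : h \oc c <> 0 ->
  exists r : mor N (sh C X), r \oc h = mid (sh C X).
Proof.
move=> hc0; have [K [p [q hcpq]]] := tr_cone tri (h \oc c).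
(* K is the cone of [h \oc c], so its desuspension [ush K], mapped to Z by e, is the weak kernel. *)
have [e eE] := sh_full (q \oc sh_counit K).
have [v [vK Kv]] := sh_counit_iso K.
have hce : (h \oc c) \oc e = 0.
  apply: sh_inj => /=; rewrite fmap_comp -eE mcompA (dist_comp0_rot2 tri hcpq).
  by rewrite mcomp0m fmap0.
have [[s es]|/AR_right_kills ce] := pselect (split_epi e).
  by case: hc0; rewrite -[LHS]mcompm1 -es mcompA hce mcomp0m.
have : fmap (sh C) c \oc q = 0.
  by rewrite -[q]mcompm1 -Kv (mcompA q) eE mcompA -fmap_comp ce fmap0 mcomp0m.
move/(dist_factor_snd_rot2 tri hcpq) => [y]; have [u ->] := sh_full y.
rewrite -fmap_comp => /sh_inj cE.
have [_ loc] := ks_local ks hsX.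
(* The first summand kills c, which is nonzero, so it is the second one that is invertible. *)
have : is_iso ((mid _ - u \oc h) + u \oc h) by rewrite subrK; exact: is_iso_mid.
case/loc => [[w [wK _]]|[w [wK _]]]; last by exists (w \oc u); rewrite -mcompA.
case: c0; rewrite -[c]mcomp1m -wK -mcompA mcompDm mcomp1m mcompNm -mcompA -cE.
by rewrite subrr mcompm0.
Qed.

(** The retraction r of h is a split epimorphism out of an indecomposable, hence invertible, and h
    is its inverse. *)
Lemma AR_left_iso N (h : mor (sh C X) N) : indec N -> h \oc c <> 0 -> is_iso h.
Proof.
move=> hN /AR_left_split[r rh].
have [s [sr rs]] := local_retract_iso (ks_local ks hN) hsX.1 rh.
by exists r; split=> //; rewrite -{1}[h]mcomp1m -sr -(mcompA s) rh mcompm1.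
Qed.

Lemma AR_right_iso N (f : mor N Z) : indec N -> c \oc f <> 0 -> is_iso f.
Proof.
move=> hN cf; have [[s fs]|/AR_right_kills//] := pselect (split_epi f).
exact: (local_retract_iso (ks_local ks hN) hZ.1 fs).
Qed.

(** On the right the shift is moved to the source M, so that composition is with a, b, c themselves
    and not with their shifts. In [ll] below, the index i + 1 matches maps X[1] -> M[i+1] with maps
    X -> M[i]. *)
Local Notation rr M i := (lrank (fun f : mor (shz M (- i)%R) Z => c \oc f)).

Local Notation ll M i := (lrank (fun f : mor (sh C X) (shz M (i + 1)%R) => f \oc c)).

(** By exactness each Hom space has for dimension the rank arriving plus the rank leaving: r (i-1) +
    p i at X, p i + q i at Y, q i + r i at Z. The alternating sum leaves the two ranks of the
    connecting map. *)
Lemma AR_dim_right M i :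
  (dimk (mor M (shz X i)) + dimk (mor M (shz Z i)) =
   dimk (mor M (shz Y i)) + (rr M (i - 1)%R + rr M i))%N.
Proof.
have dE V j : dimk (mor M (shz V j)) = dimk (mor (shz M (- j)) V).
  by have := dimk_shz M V (- j) 0; rewrite opprK add0r => <-.
have lcr W V V' (f : mor V V') : linear (fun x : mor W V => f \oc x) by exact: mcomp_linearr.
pose p j := lrank (fun x : mor (shz M (- j)) X => a \oc x).
pose q j := lrank (fun x : mor (shz M (- j)) Y => b \oc x).
have Yi j : dimk (mor M (shz Y j)) = (p j + q j)%N.
  rewrite dE; apply: exact_dim => // [x|y].
    by rewrite mcompA (dist_comp0 tri abc) mcomp0m.
  exact: (dist_factor_fst tri abc).
have Zi j : dimk (mor M (shz Z j)) = (q j + rr M j)%N.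
  rewrite dE; apply: exact_dim => // [x|y].
    by rewrite mcompA (dist_comp0_rot tri abc) mcomp0m.
  exact: (dist_factor_fst_rot tri abc).
have Xi : dimk (mor M (shz X i)) = (rr M (i - 1)%R + p i)%N.
  have iso : isomorphic (sh C (shz M (- i))) (shz M (- (i - 1))).
    by rewrite opprB addrC; exact: sh_shz.
  rewrite dE -dimk_sh (dimk_mor_isol _ iso).
  (* Exactness at X concerns maps into X[1], so the rank of composition with a is transported along
     the shift. *)
  have -> : p i = lrank (fun x : mor (shz M (- (i - 1))) (sh C X) => fmap (sh C) a \oc x).
    have [u [u' [u'u uu']]] := iso.
    have bij V : bijective (fun x : mor (shz M (- i)) V => fmap (sh C) x \oc u').
      pose y0 g := sval (cid (sh_full (X := shz M (- i)) (Y := V) g)).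
      exists (fun g => y0 (g \oc u)) => [x|g]; rewrite /y0.
        by case: cid => y /=; rewrite -mcompA u'u mcompm1 => /(@sh_inj _ _ _ _ x y).
      by case: cid => y /= <-; rewrite -mcompA uu' mcompm1.
    have lin V : linear (fun x : mor (shz M (- i)) V => fmap (sh C) x \oc u').
      by move=> d x y; rewrite fmap_linear mcomp_linearl.
    apply: (lrank_iso (u := fun x => fmap (sh C) x \oc u') (v := fun x => fmap (sh C) x \oc u')) => //.
    by move=> x; rewrite fmap_comp mcompA.
  apply: exact_dim => // [x|y].
    by rewrite mcompA (dist_comp0_rot2 tri abc) mcomp0m.
  exact: (dist_factor_fst_rot2 tri abc).
by rewrite Xi Yi Zi addnA -(addnA (rr M (i - 1)%R)) (addnC (rr M (i - 1)%R)) -addnA.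
Qed.

Lemma AR_dim_left M i :
  (dimk (mor X (shz M i)) + dimk (mor Z (shz M i)) =
   dimk (mor Y (shz M i)) + (ll M (i - 1)%R + ll M i))%N.
Proof.
have lcr W V V' (f : mor V V') : linear (fun x : mor V' W => x \oc f) by exact: mcomp_linearl.
pose q j := lrank (fun x : mor Z (shz M j) => x \oc b).
pose p j := lrank (fun x : mor Y (shz M j) => x \oc a).
have Zi : dimk (mor Z (shz M i)) = (ll M (i - 1)%R + q i)%N.
  rewrite subrK; apply: exact_dim => // [x|y].
    by rewrite -mcompA (dist_comp0_rot tri abc) mcompm0.
  exact: (dist_factor_snd_rot tri abc).
have Yi : dimk (mor Y (shz M i)) = (q i + p i)%N.
  apply: exact_dim => // [x|y].
    by rewrite -mcompA (dist_comp0 tri abc) mcompm0.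
  exact: (dist_factor_snd tri abc).
have Xi : dimk (mor X (shz M i)) = (p i + ll M i)%N.
  have iso := sh_shz M i.
  rewrite -dimk_sh (dimk_mor_isor _ iso).
  have -> : p i = lrank (fun x : mor (sh C Y) (shz M (i + 1)) => x \oc fmap (sh C) a).
    have [u [u' [u'u uu']]] := iso.
    have bij V : bijective (fun x : mor V (shz M i) => u \oc fmap (sh C) x).
      pose y0 g := sval (cid (sh_full (X := V) (Y := shz M i) g)).
      exists (fun g => y0 (u' \oc g)) => [x|g]; rewrite /y0.
        by case: cid => y /=; rewrite mcompA u'u mcomp1m => /(@sh_inj _ _ _ _ x y).
      by case: cid => y /= <-; rewrite mcompA uu' mcomp1m.
    have lin V : linear (fun x : mor V (shz M i) => u \oc fmap (sh C) x).
      by move=> d x y; rewrite fmap_linear mcomp_linearr.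
    apply: (lrank_iso (u := fun x => u \oc fmap (sh C) x) (v := fun x => u \oc fmap (sh C) x)) => //.
    by move=> x; rewrite fmap_comp mcompA.
  apply: exact_dim => // [x|y].
    by rewrite -mcompA (dist_comp0_rot2 tri abc) mcompm0.
  exact: (dist_factor_snd_rot2 tri abc).
by rewrite Xi Yi Zi addnC -addnA (addnA (q i)) addnCA.
Qed.

Lemma AR_form_right M : indec M ->
  (~ (exists i, isomorphic M (shz Z i)) -> lform M X + lform M Z - lform M Y = 0) /\
  (isomorphic M Z -> lform M X + lform M Z - lform M Y = 1 + lT 1).
Proof.
have r0 N i : indec N -> ~ isomorphic N (shz Z i) -> rr N i = 0%N.
  move=> hN NZ; apply: lrank0 => // f; apply: contrapT => cf; apply: NZ.
  have /shz_isoN : isomorphic (shz N (- i)) Z.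
    by exists f; apply: AR_right_iso cf; exact: shz_indec.
  by rewrite opprK.
have defect N : finsupp (fun i => rr N i) -> lform N X + lform N Z - lform N Y = (1 + lT 1) * hilb (fun i => rr N i).
  move=> fr; apply: hilb_defect => //; try exact: finsupp_hom.
  exact: AR_dim_right.
move=> hM; split=> [MZ|MZ].
  have rM i : rr M i = 0%N by apply: r0 => // Mi; apply: MZ; exists i.
  by rewrite defect ?hilb0 ?mulr0 //; exists [::].
rewrite !(lform_isol _ MZ).
(* For f in End(Z) some f - d is not invertible, hence killed by c: thus c f = d c, and the image is
   the line spanned by c. *)
have rZ0 : rr Z 0 = 1%N.
  rewrite oppr0; apply: (lrank1 (v := c)) => //.
  - exact: mcomp_linearr.
  - move=> f; have [d hd] := noniso_translate f hZ.1 (hf Z Z).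
    exists d; apply: contrapT => cf; apply: hd; apply: AR_right_iso => // e; apply: cf.
    by apply/eqP; rewrite -subr_eq0 -[X in _ - d *: X]mcompm1 -mcompmZ -mcompmN -mcompmD e.
  - by exists (mid Z); rewrite mcompm1.
have rZ i : i != 0 -> rr Z i = 0%N.
  by move=> i0; apply: r0 => // /(shz_aperiodic hZ)/eqP; rewrite (negPf i0).
rewrite defect ?hilb1 ?mulr1 //.
by exists [:: 0] => i; rewrite inE; exact: rZ.
Qed.

Lemma AR_form_left M : indec M ->
  (~ (exists i, isomorphic M (shz X i)) -> lform X M + lform Z M - lform Y M = 0) /\
  (isomorphic M X -> lform X M + lform Z M - lform Y M = 1 + lT 1).
Proof.
have l0 N i : indec N -> ~ isomorphic N (shz X (- i)) -> ll N i = 0%N.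
  move=> hN NX; apply: lrank0 => // f; apply: contrapT => cf; apply: NX.
  have : isomorphic (shz N (i + 1)) (sh C X).
    by apply: isomorphic_sym; exists f; apply: AR_left_iso cf; exact: shz_indec.
  move/shz_isoN => h; apply: isomorphic_trans h _.
  by have := shz_sh X (- (i + 1)); rewrite opprD addrNK.
have defect N : finsupp (fun i => ll N i) -> lform X N + lform Z N - lform Y N = (1 + lT 1) * hilb (fun i => ll N i).
  move=> fr; apply: hilb_defect => //; try exact: finsupp_hom.
  exact: AR_dim_left.
move=> hM; split=> [MX|MX].
  have lM i : ll M i = 0%N by apply: l0 => // Mi; apply: MX; exists (- i).
  by rewrite defect ?hilb0 ?mulr0 //; exists [::].
rewrite !(lform_isor _ MX).
have lX0 : ll X 0 = 1%N.
  rewrite add0r; apply: (lrank1 (v := c)) => //.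
  - exact: mcomp_linearl.
  - move=> f; have [d hd] := noniso_translate f hsX.1 (hf (sh C X) (sh C X)).
    exists d; apply: contrapT => cf; apply: hd; apply: AR_left_iso => // e; apply: cf.
    by apply/eqP; rewrite -subr_eq0 -[X in _ - d *: X]mcomp1m -mcompZm -mcompNm -mcompDm e.
  - by exists (mid _); rewrite mcomp1m.
have lX i : i != 0 -> ll X i = 0%N.
  move=> i0; apply: l0 => // /(shz_aperiodic hX)/eqP.
  by rewrite oppr_eq0 (negPf i0).
rewrite defect ?hilb1 ?mulr1 //.
by exists [:: 0] => i; rewrite inE; exact: lX.
Qed.

End AuslanderReiten.

(** * Relative traces over symmetric algebras *)

Section SymmetricAlgebras.
Variables (k : fieldType) (L : falgType k).

(** [lam] is a symmetrizing form, and the sum of the tensors of [a i] with [b i] is its Casimir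
    element. *)
Definition dual_bases d (lam : L -> k) (a b : 'I_d -> L) : Prop :=
  [/\ forall c x y, lam (c *: x + y) = c * lam x + lam y,
      forall x y, lam (x * y) = lam (y * x),
      forall i j, lam (b i * a j) = (i == j)%:R,
      forall y, \sum_i lam (b i * y) *: a i = y &
      forall z, \sum_i lam (z * a i) *: b i = z].

(** The form is the image of 1 under the bimodule isomorphism; linearity for both actions makes it
    symmetric. [b i] is the preimage of the i-th coordinate function of a basis. *)
Lemma symmetric_dual_bases : symmetric_algebra L ->
  exists d lam (a b : 'I_d -> L), dual_bases lam a b.
Proof.
move=> [phi [lphi [psi phiK psiK] phiE]].
pose lam (x : L) : k := phi 1 x.
have lamE x y : phi x y = lam (y * x) by have := phiE x 1 1 y; rewrite !mulr1 mul1r.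
have lamC x y : lam (x * y) = lam (y * x).
  by rewrite -lamE; have := phiE 1 y 1 x; rewrite !mul1r !mulr1.
have laml c x y : lam (c *: x + y) = c * lam x + lam y by rewrite /lam linearP.
pose e := vbasis {:L}; pose n := \dim {:L}.
have ee : basis_of fullv e by exact: vbasisP.
have /choice[b hb] (i : 'I_n) : exists b, forall y, lam (y * b) = coord e i y.
  exists (psi (linfun (coord e i : L -> k^o))) => y.
  by rewrite -lamE psiK lfunE.
have ae (y : L) : \sum_(i < n) lam (b i * y) *: e`_i = y.
  rewrite [RHS](coord_vbasis (memvf y)); apply: eq_bigr => i _.
  by rewrite lamC hb.
have lam_sum (I : finType) (c : I -> k) (x : I -> L) y :
    lam ((\sum_i c i *: x i) * y) = \sum_i c i * lam (x i * y).
  have l0 : lam 0 = 0 by rewrite /lam linear0.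
  have lD x' y' : lam (x' + y') = lam x' + lam y' by rewrite /lam linearD.
  rewrite mulr_suml (big_morph lam lD l0); apply: eq_bigr => i _.
  by rewrite -scalerAl /lam linearZ.
have be (z : L) : \sum_(i < n) lam (z * e`_i) *: b i = z.
  apply: (can_inj phiK); apply/lfunP => y; rewrite !lamE lamC lam_sum [RHS]lamC.
  rewrite -{2}(ae y) [RHS]lamC lam_sum; apply: eq_bigr => i _.
  by rewrite mulrC [lam (_ * z)]lamC.
exists n, lam, (fun i => e`_i), b; split=> // i j.
rewrite lamC hb coord_free 1?eq_sym //; exact: basis_free ee.
Qed.

Section Casimir.
Variables (d : nat) (lam : L -> k) (a b : 'I_d -> L).
Hypothesis ab : dual_bases lam a b.

(** Centrality of the Casimir element, with a bilinear F in place of the tensor product: both sides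
    expand to the double sum of [lam (b j * x * a i) *: F (a j) (b i)]. *)
Lemma casimir_move (V : lmodType k) (F : L -> L -> V) (x : L) :
  (forall y, linear (F^~ y)) -> (forall y, linear (F y)) ->
  \sum_i F (x * a i) (b i) = \sum_i F (a i) (b i * x).
Proof.
move=> Fl Fr; have [_ _ _ ha hb] := ab.
transitivity (\sum_i \sum_j lam (b j * x * a i) *: F (a j) (b i)).
  apply: eq_bigr => i _; rewrite -{1}[x * a i]ha (linear_sum_of _ _ _ (Fl _)).
  by apply: eq_bigr => j _; rewrite (linearZ_of _ (Fl _)) mulrA.
rewrite exchange_big; apply: eq_bigr => j _; rewrite -[in RHS](hb (b j * x)).
rewrite (linear_sum_of _ _ _ (Fr _)).
by apply: eq_bigr => i _; rewrite (linearZ_of _ (Fr _)).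
Qed.

(** Both sides expand in [F (a j) (a i)] with coefficients [lam (b j * b i)], a symmetric matrix. *)
Lemma casimir_sym (V : lmodType k) (F : L -> L -> V) :
  (forall y, linear (F^~ y)) -> (forall y, linear (F y)) ->
  \sum_i F (b i) (a i) = \sum_i F (a i) (b i).
Proof.
move=> Fl Fr; have [_ lamC _ ha hb] := ab.
transitivity (\sum_i \sum_j lam (b j * b i) *: F (a j) (a i)).
  apply: eq_bigr => i _; rewrite -{1}[b i]ha (linear_sum_of _ _ _ (Fl _)).
  by apply: eq_bigr => j _; rewrite (linearZ_of _ (Fl _)).
rewrite exchange_big; apply: eq_bigr => j _; rewrite -[in RHS](ha (b j)).
rewrite (linear_sum_of _ _ _ (Fr _)).
by apply: eq_bigr => i _; rewrite (linearZ_of _ (Fr _)) lamC.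
Qed.

Implicit Types U V W : fdmod L.

(** The relative trace from k-linear to L-linear maps; for a group algebra it is the sum of the
    conjugates g t g^-1. *)
Definition rtr U V (t : 'M[k]_(mdim V, mdim U)) : 'M[k]_(mdim V, mdim U) :=
  \sum_i mdact V (a i) *m t *m mdact U (b i).

Lemma linear_mulmxl m n p (A : L -> 'M[k]_(m, n)) (N : 'M[k]_(n, p)) :
  linear A -> linear (fun x => A x *m N).
Proof. by move=> lA c u v; rewrite lA mulmxDl scalemxAl. Qed.

Lemma linear_mulmxr m n p (N : 'M[k]_(m, n)) (B : L -> 'M[k]_(n, p)) :
  linear B -> linear (fun x => N *m B x).
Proof. by move=> lB c u v; rewrite lB mulmxDr -scalemxAr. Qed.

Lemma rtr_modhom U V (t : 'M[k]_(mdim V, mdim U)) : is_modhom U V (rtr t).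
Proof.
move=> x; rewrite /rtr mulmx_suml mulmx_sumr.
have e := casimir_move x (F := fun y z => mdact V y *m t *m mdact U z)
  (fun y => linear_mulmxl _ (linear_mulmxl t (@mdact_linear _ _ V)))
    (fun y => linear_mulmxr _ (@mdact_linear _ _ U)).
rewrite [RHS](eq_bigr (fun i => mdact V (x * a i) *m t *m mdact U (b i))); last first.
  by move=> i _; rewrite !mulmxA -mdactM.
by rewrite e; apply: eq_bigr => i _; rewrite -mulmxA -mdactM.
Qed.

Lemma rtr_swap U V (t : 'M[k]_(mdim V, mdim U)) :
  \sum_i mdact V (b i) *m t *m mdact U (a i) = rtr t.
Proof.
exact: (casimir_sym (F := fun y z => mdact V y *m t *m mdact U z)
  (fun y => linear_mulmxl _ (linear_mulmxl t (@mdact_linear _ _ V)))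
    (fun y => linear_mulmxr _ (@mdact_linear _ _ U))).
Qed.

Lemma rtr_compl U V W (f : 'M[k]_(mdim W, mdim V)) (t : 'M[k]_(mdim V, mdim U)) :
  is_modhom V W f -> f *m rtr t = rtr (f *m t).
Proof.
by move=> hf; rewrite /rtr mulmx_sumr; apply: eq_bigr => i _; rewrite !mulmxA hf.
Qed.

Lemma rtr_compr U V W (f : 'M[k]_(mdim V, mdim U)) (t : 'M[k]_(mdim W, mdim V)) :
  is_modhom U V f -> rtr t *m f = rtr (t *m f).
Proof.
by move=> hf; rewrite /rtr mulmx_suml; apply: eq_bigr => i _; rewrite -!mulmxA hf.
Qed.

Lemma rtr_sum U V (I : Type) (r : seq I) (t : I -> 'M[k]_(mdim V, mdim U)) :
  rtr (\sum_(l <- r) t l) = \sum_(l <- r) rtr (t l).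
Proof.
rewrite /rtr exchange_big; apply: eq_bigr => i _.
by rewrite mulmx_sumr mulmx_suml.
Qed.

(** Cyclicity of the trace carries the Casimir sum from c over to t, and [rtr_swap] restores the
    order of its factors. When [rtr t] is 1, a trace twisted by t becomes an ordinary one. *)
Lemma mxtrace_rtrr U V (t : 'M[k]_(mdim U)) (f : 'M[k]_(mdim U, mdim V))
    (c : 'M[k]_(mdim V, mdim U)) :
  is_modhom V U f -> \tr (t *m (f *m rtr c)) = \tr (rtr (U := U) (V := U) t *m (f *m c)).
Proof.
move=> hf; rewrite rtr_compl // {1}/rtr -rtr_swap mulmx_sumr mulmx_suml !linear_sum.
apply: eq_bigr => i _ /=.
by rewrite !mulmxA mxtrace_mulC !mulmxA.
Qed.

Lemma mxtrace_rtrl U V (t : 'M[k]_(mdim U)) (f : 'M[k]_(mdim V, mdim U))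
    (c : 'M[k]_(mdim U, mdim V)) :
  is_modhom U V f -> \tr (t *m (rtr c *m f)) = \tr (rtr (U := U) (V := U) t *m (c *m f)).
Proof.
move=> hf; rewrite rtr_compr // {1}/rtr -rtr_swap mulmx_sumr mulmx_suml !linear_sum.
apply: eq_bigr => i _ /=.
by rewrite !mulmxA mxtrace_mulC !mulmxA.
Qed.

(** Although t need not be L-linear, twisting by it gives a trace function on projectives: it is
    cyclic, and taking f to be an identity shows that it does not depend on t. *)
Lemma mxtrace_cycle U V (t : 'M[k]_(mdim U)) (s : 'M[k]_(mdim V))
    (f : 'M[k]_(mdim V, mdim U)) (g : 'M[k]_(mdim U, mdim V)) :
  rtr (U := U) (V := U) t = 1%:M -> rtr (U := V) (V := V) s = 1%:M ->
  is_modhom U V f -> is_modhom V U g -> \tr (t *m (g *m f)) = \tr (s *m (f *m g)).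
Proof.
move=> t1 s1 hf hg; rewrite -{1}[f]mul1mx -s1 rtr_compr // mxtrace_rtrr // t1 mul1mx.
by rewrite mulmxA mxtrace_mulC !mulmxA mxtrace_mulC !mulmxA mxtrace_mulC.
Qed.

(** A k-linear section S of p gives a k-linear lift of f. Composing with t and taking the relative
    trace makes it L-linear, and it stays a lift because p and f are L-linear. *)
Lemma rtr1_projective P (t : 'M[k]_(mdim P)) : rtr (U := P) (V := P) t = 1%:M -> projective P.
Proof.
move=> t1 U V p f hp p_onto hf.
have /choice[s hs] j : exists u, p *m u = (1%:M : 'M[k]_(mdim V)) *m delta_mx j (0 : 'I_1).
  exact: p_onto.
pose S : 'M[k]_(mdim U, mdim V) := \matrix_(i, j) s j i 0.
have pS : p *m S = 1%:M.
  apply/matrixP=> i j; have /matrixP/(_ i 0) := hs j.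
  rewrite mul1mx !mxE eqxx andbT => <-; apply: eq_bigr => l _; rewrite !mxE //.
exists (rtr (S *m f *m t)); first exact: rtr_modhom.
by rewrite rtr_compl // !mulmxA pS mul1mx -rtr_compl // t1 mulmx1.
Qed.

End Casimir.
End SymmetricAlgebras.

Lemma sum_mxtens (V : nmodType) m n (F : 'I_(m * n) -> V) :
  \sum_p F p = \sum_i \sum_j F (mxtens_index (i, j)).
Proof.
rewrite pair_bigA /= (reindex (@mxtens_index m n)) /=; last first.
  by exists (@mxtens_unindex m n) => ? _; rewrite ?mxtens_indexK ?mxtens_unindexK.
by apply: eq_bigr => -[].
Qed.

Lemma tensmx11 (R : comNzRingType) m n : (1%:M : 'M[R]_m) *t (1%:M : 'M[R]_n) = 1%:M.
Proof.
apply/matrixP=> i j; rewrite -(mxtens_unindexK i) -(mxtens_unindexK j).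
case: (mxtens_unindex i) (mxtens_unindex j) => [i1 i2] [j1 j2].
by rewrite tensmxE !mxE -natrM mulnb (can_eq (@mxtens_indexK m n)).
Qed.

(** * Higman's criterion for modules and complexes *)

Section Higman.
Variables (k : fieldType) (L : falgType k) (d : nat) (lam : L -> k) (a b : 'I_d -> L).
Hypothesis ab : dual_bases lam a b.

Let lam_sum (I : finType) (c : I -> k) (x : I -> L) :
  lam (\sum_i c i *: x i) = \sum_i c i * lam (x i).
Proof.
have [ll _ _ _ _] := ab.
have l0 : lam 0 = 0 by have := ll (-1) 0 0; rewrite scaler0 addr0 mulN1r addNr.
have lD x' y' : lam (x' + y') = lam x' + lam y' by have := ll 1 x' y'; rewrite scale1r mul1r.
by rewrite (big_morph lam lD l0); apply: eq_bigr => i _; have := ll (c i) (x i) 0; rewrite l0 !addr0.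
Qed.

(** Left multiplication by x in the basis a, coordinates being read off by pairing with b. *)
Definition regmx (x : L) : 'M[k]_d := \matrix_(i, j) lam (b i * x * a j).

Lemma regmx_mul x j : x * a j = \sum_i regmx x i j *: a i.
Proof.
by have [_ _ _ ha _] := ab; rewrite -[LHS]ha; apply: eq_bigr => i _; rewrite mxE mulrA.
Qed.

Lemma lam_regmx x j : \sum_i lam (a i) * regmx x i j = lam (x * a j).
Proof. by rewrite regmx_mul lam_sum; apply: eq_bigr => i _; rewrite mulrC. Qed.

Section FreeCover.
Variable P : fdmod L.
Local Notation n := (mdim P).

(* The free module L (x)_k P, in the basis a_i (x) e_j; [cover_map] is its action map
   onto P. *)
Definition cover_act (x : L) : 'M[k]_(d * n) := regmx x *t (1%:M : 'M[k]_n).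

Fact cover_act_linear : linear cover_act.
Proof.
have [ll _ _ _ _] := ab; move=> c x y; apply/matrixP=> i j; rewrite !mxE.
by rewrite mulrDr mulrDl -scalerAr -scalerAl ll mulrDl mulrA.
Qed.

Fact cover_act1 : cover_act 1 = 1%:M.
Proof.
have [_ _ hd _ _] := ab; rewrite -tensmx11; congr (_ *t _).
by apply/matrixP=> i j; rewrite !mxE mulr1 hd.
Qed.

Fact cover_actM x y : cover_act (x * y) = cover_act x *m cover_act y.
Proof.
rewrite /cover_act tensmx_mul mulmx1; congr (_ *t _); apply/matrixP=> i j; rewrite !mxE.
rewrite [b i * _]mulrA -mulrA regmx_mul mulr_sumr.
under eq_bigr => l _ do rewrite -scalerAr.
by rewrite lam_sum; apply: eq_bigr => l _; rewrite !mxE mulrC.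
Qed.

Definition cover : fdmod L := Fdmod cover_act_linear cover_act1 cover_actM.

Definition cover_map : 'M[k]_(n, d * n) :=
  \matrix_(i, q) mdact P (a (mxtens_unindex q).1) i (mxtens_unindex q).2.

Lemma cover_mapE m (g : 'M[k]_(d * n, m)) :
  cover_map *m g = \sum_j mdact P (a j) *m \matrix_(l, c) g (mxtens_index (j, l)) c.
Proof.
apply/matrixP=> i c; rewrite !mxE sum_mxtens summxE; apply: eq_bigr => j _.
by rewrite !mxE; apply: eq_bigr => l _; rewrite !mxE mxtens_indexK.
Qed.

Lemma cover_act_block m x (g : 'M[k]_(d * n, m)) j :
  \matrix_(l < n, c < m) (cover_act x *m g) (mxtens_index (j, l)) c =
  \sum_i regmx x j i *: \matrix_(l < n, c < m) g (mxtens_index (i, l)) c.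
Proof.
apply/matrixP=> l c; rewrite !mxE sum_mxtens summxE; apply: eq_bigr => i _.
rewrite !mxE (bigD1 l) //= big1 ?addr0 => [|l' ll'].
  by rewrite tensmxE !mxE eqxx mulr1.
by rewrite tensmxE [1%:M _ _]mxE eq_sym (negPf ll') mulr0 mul0r.
Qed.

Lemma mdact_sum (I : finType) (c : I -> k) (x : I -> L) :
  mdact P (\sum_i c i *: x i) = \sum_i c i *: mdact P (x i).
Proof.
rewrite (linear_sum_of _ _ _ (@mdact_linear _ _ P)); apply: eq_bigr => i _.
exact: (linearZ_of _ (@mdact_linear _ _ P)).
Qed.

Lemma cover_map_modhom : is_modhom cover P cover_map.
Proof.
move=> x; rewrite -[mdact cover x]mulmx1 cover_mapE -[cover_map in RHS]mulmx1 cover_mapE.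
under eq_bigr => j _ do rewrite cover_act_block mulmx_sumr.
rewrite exchange_big mulmx_sumr; apply: eq_bigr => i _ /=.
rewrite mulmxA -mdactM regmx_mul mdact_sum mulmx_suml; apply: eq_bigr => j _.
by rewrite -scalemxAr -scalemxAl.
Qed.

Lemma cover_map_onto (v : 'cV[k]_n) : exists u, cover_map *m u = v.
Proof.
have [_ _ _ ha _] := ab.
exists (\col_q (lam (b (mxtens_unindex q).1) * v (mxtens_unindex q).2 0)).
rewrite cover_mapE -[RHS]mul1mx -(@mdact1 _ _ P) -[1]ha mdact_sum mulmx_suml.
apply: eq_bigr => j _; rewrite mulr1 -scalemxAl scalemxAr; congr (_ *m _).
by apply/matrixP=> l c; rewrite !mxE mxtens_indexK ord1.
Qed.

Lemma projective_rtr1 : projective P -> exists t, rtr a b (U := P) (V := P) t = 1%:M.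
Proof.
have [_ _ _ ha _] := ab.
move=> /(_ cover P cover_map 1%:M cover_map_modhom cover_map_onto).
case=> [x|g hg pg]; first by rewrite mul1mx mulmx1.
pose gb j : 'M[k]_n := \matrix_(l, c) g (mxtens_index (j, l)) c.
(* On the free cover, x (x) v |-> lam x (1 (x) v) has relative trace 1, by expansion in dual bases.
   The witness is this map placed between the splitting g and [cover_map]. *)
exists (\sum_j lam (a j) *: gb j); rewrite -pg cover_mapE /rtr.
have tE x : (\sum_j lam (a j) *: gb j) *m mdact P x = \sum_i lam (x * a i) *: gb i.
  transitivity (\sum_j \sum_i (lam (a j) * regmx x j i) *: gb i).
    rewrite mulmx_suml; apply: eq_bigr => j _; rewrite -scalemxAl.
    have -> : gb j *m mdact P x = \sum_i regmx x j i *: gb i.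
      rewrite -cover_act_block -[cover_act x]/(mdact cover x) -hg.
      by apply/matrixP=> l c; rewrite !mxE; apply: eq_bigr => r _; rewrite !mxE.
    by rewrite scaler_sumr; apply: eq_bigr => i _; rewrite scalerA.
  by rewrite exchange_big; apply: eq_bigr => i _; rewrite -scaler_suml lam_regmx.
transitivity (\sum_i \sum_j lam (b i * a j) *: (mdact P (a i) *m gb j)).
  apply: eq_bigr => i _; rewrite -mulmxA tE mulmx_sumr.
  by apply: eq_bigr => j _; rewrite scalemxAr.
rewrite exchange_big; apply: eq_bigr => j _.
rewrite -[in RHS](ha (a j)) mdact_sum mulmx_suml; apply: eq_bigr => i _.
by rewrite scalemxAl.
Qed.
End FreeCover.

Section PerfectComplexes.
Implicit Type X : complex L.

Section Inclusion.
Variables (X : complex L) (n : int).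
Local Notation Xn := (cterm X n).
Local Notation P := (fun i => @cdeg _ _ X i == n).

Definition term_inc : 'M[k]_(mdim X, mdim Xn) :=
  \matrix_(i, j) (i == enum_val (j : 'I_#|P|))%:R.

Lemma term_incK : term_inc^T *m term_inc = 1%:M.
Proof.
apply/matrixP=> i j; rewrite !mxE (bigD1 (enum_val (i : 'I_#|P|))) //= !mxE eqxx mul1r.
rewrite big1 ?addr0 ?(inj_eq enum_val_inj) // => l li.
by rewrite !mxE (negPf li) mul0r.
Qed.

Lemma term_incE i j : (term_inc *m term_inc^T) i j = ((i == j) && (@cdeg _ _ X i == n))%:R.
Proof.
rewrite !mxE; have [Pi|Pi] := boolP (@cdeg _ _ X i == n); last first.
  rewrite andbF big1 // => l _; rewrite !mxE.
  case: eqP => [il|_]; last by rewrite mul0r.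
  by have := enum_valP (l : 'I_#|P|); rewrite -il -topredE /= (negPf Pi).
have Pi' : i \in P by [].
rewrite andbT (bigD1 (enum_rank_in Pi' i)) //= !mxE enum_rankK_in // eqxx mul1r eq_sym.
rewrite big1 ?addr0 // => l li; rewrite !mxE.
case: eqP => [il|_]; last by rewrite mul0r.
by case/eqP: li; apply: enum_val_inj; rewrite enum_rankK_in.
Qed.

Lemma term_inc_modhom : is_modhom Xn X term_inc.
Proof.
move=> x; apply/matrixP=> i j; rewrite !mxE.
rewrite [RHS](bigD1 (enum_val (j : 'I_#|P|))) //= !mxE eqxx mulr1 [X in _ + X]big1 ?addr0; last first.
  by move=> l li; rewrite !mxE (negPf li) mulr0.
have [Pi|Pi] := boolP (i \in P); last first.
  rewrite big1 => [|l _].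
    apply/esym/eqP; apply: contraNT Pi => /cact_homog; rewrite addr0 -topredE /= => ->.
    by have := enum_valP (j : 'I_#|P|).
  rewrite !mxE; case: eqP => [il|_]; last by rewrite mul0r.
  by have := enum_valP (l : 'I_#|P|); rewrite -il (negPf Pi).
rewrite (bigD1 (enum_rank_in Pi i)) //= !mxE enum_rankK_in // eqxx mul1r.
rewrite big1 ?addr0 // => l li; rewrite !mxE.
case: eqP => [il|_]; last by rewrite mul0r.
by case/eqP: li; apply: enum_val_inj; rewrite enum_rankK_in.
Qed.

Lemma term_prj_modhom : is_modhom X Xn term_inc^T.
Proof.
have comm x : term_inc *m term_inc^T *m mdact X x = mdact X x *m (term_inc *m term_inc^T).
  apply/matrixP=> i j; rewrite mxE [RHS]mxE (bigD1 i) //= [X in _ + X]big1 ?addr0; last first.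
    by move=> l li; rewrite term_incE eq_sym (negPf li) mul0r.
  rewrite [RHS](bigD1 j) //= [X in _ = _ + X]big1 ?addr0; last first.
    by move=> l lj; rewrite term_incE (negPf lj) mulr0.
  rewrite !term_incE !eqxx /= mulrC.
  have [->|/cact_homog ->] := eqVneq (mdact X x i j) 0; first by rewrite !mul0r.
  by rewrite addr0.
move=> x; rewrite -{1}[term_inc^T]mul1mx -term_incK -!mulmxA [term_inc *m _]mulmxA comm.
by rewrite !mulmxA -(mulmxA _ _ term_inc) -term_inc_modhom !mulmxA term_incK mul1mx.
Qed.
End Inclusion.

Lemma sum_term_inc X : exists D : seq int, \sum_(n <- D) term_inc X n *m (term_inc X n)^T = 1%:M.
Proof.
exists (undup [seq @cdeg _ _ X i | i <- enum 'I_(mdim X)]).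
apply/matrixP=> i j; rewrite summxE.
have iD : @cdeg _ _ X i \in undup [seq @cdeg _ _ X i | i <- enum 'I_(mdim X)].
  by rewrite mem_undup map_f // mem_enum.
rewrite (bigD1_seq _ iD) ?undup_uniq //=.
rewrite term_incE eqxx andbT [1%:M i j]mxE big1 ?addr0 // => n ni.
by rewrite term_incE (eq_sym (@cdeg _ _ X i)) (negPf ni) andbF.
Qed.

(** Perfectness is a condition in each degree; with [rtr1_perfect] it becomes one equation on the
    total module, the form suited to sums, tensor products and duals. *)
Lemma perfect_rtr1 X : perfect X -> exists t, rtr a b (U := X) (V := X) t = 1%:M.
Proof.
move=> pX; have ex_t n : exists t, rtr a b (U := cterm X n) (V := cterm X n) t = 1%:M.
  exact/projective_rtr1/pX.
have [D D1] := sum_term_inc X.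
exists (\sum_(n <- D) term_inc X n *m sval (cid (ex_t n)) *m (term_inc X n)^T).
rewrite rtr_sum -[RHS]D1; apply: eq_bigr => n _; case: cid => t /= t1.
have hi := @term_inc_modhom X n; have hp := @term_prj_modhom X n.
by rewrite -(rtr_compr _ _ _ hp) -(rtr_compl _ _ _ hi) t1 mulmx1.
Qed.

Lemma rtr1_perfect X t : rtr a b (U := X) (V := X) t = 1%:M -> perfect X.
Proof.
move=> t1 n; have hi := @term_inc_modhom X n; have hp := @term_prj_modhom X n.
apply: (rtr1_projective ab (t := (term_inc X n)^T *m t *m term_inc X n)).
by rewrite -(rtr_compr _ _ _ hi) -(rtr_compl _ _ _ hp) t1 mulmx1 term_incK.
Qed.

End PerfectComplexes.
End Higman.

(** * Duality of Hom in the homotopy category *)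

(** Among the subspaces contained in P take one of maximal dimension: a missing vector of P could be
    adjoined. This gives cycles and boundaries, defined by propositions, a dimension. *)
Lemma vspace_of (k : fieldType) (V : vectType k) (P : V -> Prop) : P 0 ->
  (forall c u v, P u -> P v -> P (c *: u + v)) ->
  exists U : {vspace V}, forall v, v \in U <-> P v.
Proof.
move=> P0 Plin.
pose Q n := `[< exists U : {vspace V}, \dim U = n /\ forall v, v \in U -> P v >].
have Q0 : exists n, Q n.
  by exists 0%N; apply/asboolP; exists 0%VS; rewrite dimv0; split=> // v; rewrite memv0 => /eqP ->.
have Qmax n : Q n -> (n <= dim V)%N.
  by move/asboolP => [U [<- _]]; rewrite -dimvf dimvS ?subvf.
case: (ex_maxnP Q0 Qmax) => n /asboolP[U [dU UP]] maxn.
exists U => v; split=> [/UP//|Pv]; apply: contrapT => /negP vU.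
suff /maxn : Q (\dim (U + <[v]>)%VS).
  rewrite leqNgt -dU => /negP; apply; rewrite ltnNge; apply: contra vU => le.
  have : (U == U + <[v]>)%VS by rewrite -(geq_leqif (dimv_leqif_eq (addvSl U <[v]>))).
  by move/eqP ->; rewrite memvE addvSr.
apply/asboolP; exists (U + <[v]>)%VS; split=> // _ /memv_addP[u uU [_ /vlineP[c ->] ->]].
by rewrite addrC; apply: Plin => //; exact: UP.
Qed.

(** * Orthogonals for a bilinear pairing *)

Section Orthogonal.
Variables (k : fieldType).

(** The orthogonal of B in T is cut out by one equation per basis vector of B. *)
Lemma dim_orthogonal_ge (V W : vectType k) (beta : V -> W -> k)
    (T : {vspace W}) (B : {vspace V}) :
  (forall v, linear (beta v : W -> k^o)) -> (forall w, linear (fun v => beta v w : k^o)) ->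
  exists A : {vspace W}, (forall t, t \in A <-> t \in T /\ forall b, b \in B -> beta b t = 0) /\
    (\dim T <= \dim A + \dim B)%N.
Proof.
move=> lr ll; pose g (w : W) : 'rV[k]_(\dim B) := \row_j beta (vbasis B)`_j w.
have lg : linear g by move=> c x y; apply/rowP=> j; rewrite !mxE (lr _ c x y).
pose gl := GRing.isLinear.Build k W 'rV[k]_(\dim B) _ g lg.
pose G : {linear W -> 'rV[k]_(\dim B)} := HB.pack g gl.
exists (T :&: lker (linfun G))%VS; split=> [t|].
  rewrite memv_cap memv_ker lfunE /=; split=> [/andP[tT /eqP/rowP gt]|[tT Bt]].
    split=> // b /coord_vbasis ->.
    rewrite (linear_sum_of _ _ _ (ll t)) big1 // => i _.
    rewrite (linearZ_of _ (ll t)); have := gt i; rewrite !mxE => ->.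
    by rewrite scaler0.
  rewrite tT; apply/eqP/rowP=> j; rewrite !mxE; apply: Bt.
  by apply: vbasis_mem; rewrite mem_nth // size_tuple.
rewrite -(limg_ker_dim (linfun G) T) leq_add2l.
by apply: leq_trans (dimvS (subvf _)) _; rewrite dimvf /dim /= mul1n.
Qed.

Variables (V W : vectType k) (beta : V -> W -> k) (U : {vspace V}) (T : {vspace W}).
Hypothesis lr : forall v, linear (beta v : W -> k^o).
Hypothesis ll : forall w, linear (fun v => beta v w : k^o).
Hypothesis ndl : forall u, u \in U -> (forall t, t \in T -> beta u t = 0) -> u = 0.
Hypothesis ndr : forall t, t \in T -> (forall u, u \in U -> beta u t = 0) -> t = 0.

Lemma dim_nondegenerate : \dim U = \dim T.
Proof.
apply/eqP; rewrite eqn_leq; apply/andP; split.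
  have [A [hA /leq_trans]] := @dim_orthogonal_ge W V (fun w v => beta v w) U T ll lr; apply.
  suff -> : A = 0%VS by rewrite dimv0.
  apply/eqP; rewrite -subv0; apply/subvP => u /hA[uU ut]; rewrite memv0; apply/eqP.
  exact: ndl.
have [A [hA /leq_trans]] := @dim_orthogonal_ge V W beta T U lr ll; apply.
suff -> : A = 0%VS by rewrite dimv0.
apply/eqP; rewrite -subv0; apply/subvP => u /hA[uU ut]; rewrite memv0; apply/eqP.
exact: ndr.
Qed.

(** For the upper bound on A, let A2 be the orthogonal of a complement of B in U. By nondegeneracy A
    and A2 meet in 0, and A2 has codimension in T at most that of B in U. *)
Lemma dim_orthogonal (B : {vspace V}) (A : {vspace W}) : (B <= U)%VS ->
  (forall t, t \in A <-> t \in T /\ forall b, b \in B -> beta b t = 0) ->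
  (\dim A + \dim B)%N = \dim T.
Proof.
move=> BU hA; have [A1 [hA1 lA1]] := @dim_orthogonal_ge V W beta T B lr ll.
have eA : A1 = A by apply/vspaceP => t; apply/idP/idP => [/hA1/hA|/hA/hA1].
rewrite {A1 hA1}eA in lA1.
have [A2 [hA2 lA2]] := @dim_orthogonal_ge V W beta T (U :\: B)%VS lr ll.
have dC : (\dim B + \dim (U :\: B))%N = \dim T.
  by rewrite -dim_nondegenerate -{1}(capv_idPr BU) dimv_cap_compl.
have A12 : (A :&: A2 = 0)%VS.
  apply/eqP; rewrite -subv0; apply/subvP => t /memv_capP[/hA[tT tB] /hA2[_ tC]].
  rewrite memv0; apply/eqP/ndr => // u; rewrite -(addv_diff_cap U B).
  move=> /memv_addP[c cC [b bB ->]]; rewrite (linearD_of (ll t)) tC // tB ?addr0 //.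
  by case/memv_capP: bB.
have : (\dim A + \dim A2 <= \dim T)%N.
  rewrite -(dimv_disjoint_sum A12) dimvS //; apply/subvP => _ /memv_addP[t /hA[tT _] [s /hA2[sT _] ->]].
  exact: memvD.
move=> le; apply/eqP; rewrite eqn_leq lA1 andbT -dC addnC leq_add2l.
by rewrite -(leq_add2r (\dim A2)) (leq_trans le) // addnC.
Qed.
End Orthogonal.

Section HomDimension.
Variables (k : fieldType) (L : falgType k).
Implicit Types X Y : complex L.

(** A complement of the boundaries inside the cycles maps isomorphically onto the quotient. *)
Lemma dimk_hthom X Y (Z B : {vspace 'M[k]_(mdim Y, mdim X)}) :
  (forall f, f \in Z <-> is_chmap X Y f) ->
  (forall f, f \in B <-> exists h, [/\ homogeneous (@cdeg _ _ X) (@cdeg _ _ Y) (-1) h,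
     is_modhom X Y h & f = cdiff Y *m h + h *m cdiff X]) ->
  (B <= Z)%VS -> dimk (hthom X Y) = (\dim Z - \dim B)%N.
Proof.
move=> hZ hB BZ; pose D := (Z :\: B)%VS.
have DZ (w : subvs_of D) : is_chmap X Y (vsval w).
  by apply/hZ; apply: subvP (diffvSl Z B) _ (subvsP w).
pose F w := htcls (mkchmap (DZ w)).
have lF : linear F.
  move=> c u v; rewrite /F -htcls_linear; congr htcls; apply: chmap_inj.
  by [].
have dimD : has_dim (subvs_of D) (\dim D) by constructor; exact: subvs_vect_iso.
have -> : (\dim Z - \dim B)%N = \dim D.
  by rewrite -(dimv_cap_compl Z B) (capv_idPr BZ) addKn.
apply: dimkE; apply: (has_dim_iso lF) dimD.
have injF : injective F.
  move=> u v /htcls_eq [h [h1 h2 h3]]; apply/eqP; rewrite -subr_eq0.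
  apply/eqP/val_inj/eqP; rewrite -memv0 -(capv_diff Z B) memv_cap subvsP /=.
  by apply/hB; exists h; split=> //; rewrite -h3 /= linearB.
have surF y : exists w, F w = y.
  have cy := chmapP (htrep y); have : chmx (htrep y) \in (Z :\: B + Z :&: B)%VS.
    by rewrite addv_diff_cap; apply/hZ.
  move=> /memv_addP[w wD [b bB e]]; exists (Subvs wD); rewrite -[RHS]htrepK; apply/htcls_eq.
  have /hB[h [h1 h2 h3]] : b \in B by case/memv_capP: bB.
  exists (- h); split=> [i j|x|].
  - by rewrite mxE oppr_eq0; exact: h1.
  - by rewrite mulNmx mulmxN h2.
  by rewrite /= e mulmxN mulNmx -opprD -h3 opprD addrA subrr add0r.
exists (fun y => sval (cid (surF y))) => [w|y]; last by case: cid.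
by case: cid => w' /= e; apply: injF.
Qed.

(** The parity operator, which turns a trace into a supertrace. *)
Definition gsgn X : 'M[k]_(mdim X) := diag_mx (\row_i (-1) ^ @cdeg _ _ X i).

Lemma gsgn_comm X Y r f : homogeneous (@cdeg _ _ X) (@cdeg _ _ Y) r f ->
  gsgn Y *m f = (-1) ^ r *: (f *m gsgn X).
Proof.
move=> hf; apply/matrixP=> i j; rewrite mul_diag_mx mul_mx_diag !mxE.
have [->|/hf ->] := eqVneq (f i j) 0; first by rewrite !mul0r !mulr0.
by rewrite exprzDr ?unitrN1 // [LHS]mulrC mulrA [LHS]mulrC.
Qed.

Lemma gsgn_diff X : gsgn X *m cdiff X = - (cdiff X *m gsgn X).
Proof. by rewrite (gsgn_comm (@cdiff_homog _ _ X)) expr1z scaleN1r. Qed.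

Lemma diff_gsgn X : cdiff X *m gsgn X = - (gsgn X *m cdiff X).
Proof. by rewrite gsgn_diff opprK. Qed.

Lemma gsgn_modhom X : is_modhom X X (gsgn X).
Proof. by move=> x; rewrite (gsgn_comm (@cact_homog _ _ X x)) expr0z scale1r. Qed.

Lemma mxtrace_mul_delta m n (A : 'M[k]_(m, n)) i j : \tr (A *m delta_mx i j) = A j i.
Proof.
rewrite /mxtrace (bigD1 j) //= [X in _ + X]big1 ?addr0 => [|l lj]; last first.
  by rewrite mxE big1 // => l' _; rewrite mxE (negPf lj) andbF mulr0.
rewrite mxE (bigD1 i) //= big1 ?addr0 => [|l li]; last by rewrite mxE (negPf li) mulr0.
by rewrite mxE !eqxx mulr1.
Qed.

Lemma modhomM (U V W : fdmod L) (g : 'M[k]_(mdim W, mdim V)) (f : 'M[k]_(mdim V, mdim U)) :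
  is_modhom V W g -> is_modhom U V f -> is_modhom U W (g *m f).
Proof. by move=> hg hf x; rewrite -mulmxA hf !mulmxA hg. Qed.

Lemma modhom_lin (U V : fdmod L) c (f g : 'M[k]_(mdim V, mdim U)) :
  is_modhom U V f -> is_modhom U V g -> is_modhom U V (c *: f + g).
Proof. by move=> hf hg x; rewrite mulmxDl mulmxDr -scalemxAl -scalemxAr hf hg. Qed.

Lemma modhom0 (U V : fdmod L) : is_modhom U V 0.
Proof. by move=> x; rewrite mul0mx mulmx0. Qed.

Variables (d : nat) (lam : L -> k) (a b : 'I_d -> L).
Hypothesis ab : dual_bases lam a b.

Lemma homogeneous_rtr X Y r t : homogeneous (@cdeg _ _ X) (@cdeg _ _ Y) r t ->
  homogeneous (@cdeg _ _ X) (@cdeg _ _ Y) r (rtr a b (U := X) (V := Y) t).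
Proof.
move=> ht; rewrite /rtr; elim/big_ind: _ => [|f g hf hg|i _].
- exact: homogeneous0.
- by rewrite -[f]scale1r; exact: homogeneous_lin.
rewrite -[r]add0r; apply: homogeneousM (@cact_homog _ _ _ _).
by rewrite -[r]addr0; apply: homogeneousM ht; exact: cact_homog.
Qed.

Lemma homogeneous_delta X Y r i j : @cdeg _ _ Y i = @cdeg _ _ X j + r ->
  homogeneous (@cdeg _ _ X) (@cdeg _ _ Y) r (delta_mx i j : 'M[k]_(_, _)).
Proof.
by move=> e i' j'; rewrite mxE; case: andP => [[/eqP -> /eqP ->]|_] //; rewrite eqxx.
Qed.

(** * The twisted supertrace pairing *)

Section Pairing.
Variables (X Y : complex L) (t : 'M[k]_(mdim X)).
Hypothesis t1 : rtr a b (U := X) (V := X) t = 1%:M.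

Definition pairing (f : 'M[k]_(mdim Y, mdim X)) (g : 'M[k]_(mdim X, mdim Y)) : k :=
  \tr (t *m (gsgn X *m g *m f)).

Lemma pairing_linr f : linear (pairing f : _ -> k^o).
Proof.
move=> c g h; rewrite /pairing mulmxDr mulmxDl mulmxDr -scalemxAr -scalemxAl -scalemxAr.
by rewrite linearP.
Qed.

Lemma pairing_linl g : linear (fun f => pairing f g : k^o).
Proof. by move=> c f h; rewrite /pairing !mulmxDr -!scalemxAr linearP. Qed.

Lemma gsgn_neq0 i : (-1) ^ @cdeg _ _ X i != 0 :> k.
Proof. by apply: expfz_neq0; rewrite oppr_eq0 oner_eq0. Qed.

(** By [mxtrace_rtrr] and [rtr t = 1], pairing g with the relative trace of an elementary matrix
    returns an entry of g up to sign. *)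
Lemma pairing_ndr r g : homogeneous (@cdeg _ _ Y) (@cdeg _ _ X) r g -> is_modhom Y X g ->
  (forall f, homogeneous (@cdeg _ _ X) (@cdeg _ _ Y) (- r) f -> is_modhom X Y f ->
     pairing f g = 0) -> g = 0.
Proof.
move=> g1 g2 h; apply/matrixP=> j i; rewrite [RHS]mxE; apply: contrapT => /eqP gji.
have : pairing (rtr a b (U := X) (V := Y) (delta_mx i j)) g = 0.
  apply: h; last exact: (rtr_modhom ab).
  by apply: homogeneous_rtr; apply: homogeneous_delta; rewrite (g1 _ _ gji) addrK.
rewrite /pairing (mxtrace_rtrr ab); last by apply: modhomM g2; exact: gsgn_modhom.
rewrite t1 mul1mx mxtrace_mul_delta mul_diag_mx !mxE => /eqP.
by rewrite mulf_eq0 (negPf gji) (negPf (gsgn_neq0 j)).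
Qed.

Lemma pairing_ndl r f : homogeneous (@cdeg _ _ X) (@cdeg _ _ Y) r f -> is_modhom X Y f ->
  (forall g, homogeneous (@cdeg _ _ Y) (@cdeg _ _ X) (- r) g -> is_modhom Y X g ->
     pairing f g = 0) -> f = 0.
Proof.
move=> f1 f2 h; apply/matrixP=> i j; rewrite [RHS]mxE; apply: contrapT => /eqP fij.
have : pairing f (rtr a b (U := Y) (V := X) (delta_mx j i)) = 0.
  apply: h; last exact: (rtr_modhom ab).
  by apply: homogeneous_rtr; apply: homogeneous_delta; rewrite (f1 _ _ fij) addrK.
rewrite /pairing (rtr_compl a b _ (@gsgn_modhom X)) (mxtrace_rtrl ab) // t1 mul1mx.
rewrite mxtrace_mulC mulmxA mxtrace_mul_delta mul_mx_diag !mxE => /eqP.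
by rewrite mulf_eq0 (negPf fij) (negPf (gsgn_neq0 j)).
Qed.

(** The differential at the end of the product is brought to the front by [mxtrace_cycle] with both
    twists equal to t; moving it past the parity operator gives the minus sign. *)
Lemma pairing_adjl (h : 'M[k]_(mdim Y, mdim X)) g : is_modhom X Y h -> is_modhom Y X g ->
  pairing (cdiff Y *m h + h *m cdiff X) g = pairing h (g *m cdiff Y - cdiff X *m g).
Proof.
move=> hh hg; rewrite (linearD_of (pairing_linl g)) (linearD_of (pairing_linr h)).
rewrite (linearN_of (pairing_linr h)); congr (_ + _); first by rewrite /pairing !mulmxA.
have := mxtrace_cycle ab t1 t1 (@cdiff_modhom _ _ X)
  (modhomM (@gsgn_modhom X) (modhomM hg hh)).
rewrite /pairing !mulmxA => ->.
by rewrite -(mulmxA t (cdiff X)) diff_gsgn mulmxN !mulNmx linearN !mulmxA.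
Qed.

Lemma pairing_adjr f (h : 'M[k]_(mdim X, mdim Y)) : is_modhom X Y f -> is_modhom Y X h ->
  pairing f (cdiff X *m h + h *m cdiff Y) = pairing (cdiff Y *m f - f *m cdiff X) h.
Proof.
move=> hf hh; rewrite (linearD_of (pairing_linr f)) (linearD_of (pairing_linl h)).
rewrite (linearN_of (pairing_linl h)) addrC; congr (_ + _); first by rewrite /pairing !mulmxA.
have := mxtrace_cycle ab t1 t1 (@cdiff_modhom _ _ X)
  (modhomM (@gsgn_modhom X) (modhomM hh hf)).
rewrite /pairing !mulmxA => ->.
by rewrite -(mulmxA t (cdiff X)) diff_gsgn mulmxN !mulNmx linearN opprK !mulmxA.
Qed.

(** Let n be the common dimension of the two spaces of degree 0 module maps. Cycles in one direction
    are the orthogonal of boundaries in the other, so both Hom spaces have dimension n minus those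
    of the two spaces of boundaries. *)
Lemma dimk_hthom_sym : dimk (hthom X Y) = dimk (hthom Y X).
Proof.
have ex_hom (A B : complex L) : exists U : {vspace 'M[k]_(mdim B, mdim A)}, forall f,
    f \in U <-> homogeneous (@cdeg _ _ A) (@cdeg _ _ B) 0 f /\ is_modhom A B f.
  apply: vspace_of => [|c f g [f1 f2] [g1 g2]].
    by split; [exact: homogeneous0|exact: modhom0].
  by split; [exact: homogeneous_lin|exact: modhom_lin].
have ex_cyc (A B : complex L) : exists Z : {vspace 'M[k]_(mdim B, mdim A)}, forall f,
    f \in Z <-> is_chmap A B f.
  have [c0 cl] := chmap_closed A B; apply: vspace_of => [|c f g /asboolP hf /asboolP hg].
    exact/asboolP.
  by apply/asboolP; exact: cl.
have ex_bd (A B : complex L) : exists Z : {vspace 'M[k]_(mdim B, mdim A)}, forall f,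
    f \in Z <-> exists h, [/\ homogeneous (@cdeg _ _ A) (@cdeg _ _ B) (-1) h,
      is_modhom A B h & f = cdiff B *m h + h *m cdiff A].
  apply: vspace_of => [|c f g [h [h1 h2 ->]] [l [l1 l2 ->]]].
    exists 0; split; [exact: homogeneous0|exact: modhom0|by rewrite mulmx0 mul0mx addr0].
  exists (c *: h + l); split; [exact: homogeneous_lin|exact: modhom_lin|].
  by rewrite mulmxDr mulmxDl -scalemxAr -scalemxAl scalerDr addrACA.
have bd_cyc (A B : complex L) (Z' B' : {vspace 'M[k]_(mdim B, mdim A)}) :
    (forall f, f \in Z' <-> is_chmap A B f) ->
    (forall f, f \in B' <-> exists h, [/\ homogeneous (@cdeg _ _ A) (@cdeg _ _ B) (-1) h,
      is_modhom A B h & f = cdiff B *m h + h *m cdiff A]) -> (B' <= Z')%VS.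
  move=> hZ hB; apply/subvP => _ /hB[h [h1 h2 ->]]; apply/hZ; split.
  - rewrite -[_ *m h]scale1r; apply: homogeneous_lin.
      by rewrite -[0](addNr 1); apply: homogeneousM h1; exact: cdiff_homog.
    by rewrite -[0](subrr 1); apply: homogeneousM (@cdiff_homog _ _ _); rewrite ?addrC.
  - rewrite -[_ *m h]scale1r; apply: modhom_lin.
      by apply: modhomM h2; exact: cdiff_modhom.
    by apply: modhomM h2 _; exact: cdiff_modhom.
  by rewrite mulmxDl mulmxDr !mulmxA cdiff2 mul0mx -!mulmxA cdiff2 mulmx0 addr0 add0r.
have [U hU] := ex_hom X Y; have [T hT] := ex_hom Y X.
have [Z hZ] := ex_cyc X Y; have [Z' hZ'] := ex_cyc Y X.
have [B hB] := ex_bd X Y; have [B' hB'] := ex_bd Y X.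
have ndl u : u \in U -> (forall g, g \in T -> pairing u g = 0) -> u = 0.
  move=> /hU[u1 u2] h; apply: (pairing_ndl u1 u2) => g g1 g2; apply: h.
  by apply/hT; split=> //; rewrite -[0]oppr0.
have ndr g : g \in T -> (forall u, u \in U -> pairing u g = 0) -> g = 0.
  move=> /hT[g1 g2] h; apply: (pairing_ndr g1 g2) => f f1 f2; apply: h.
  by apply/hU; split=> //; rewrite -[0]oppr0.
have ZU : (Z <= U)%VS by apply/subvP => f /hZ[f1 f2 _]; apply/hU.
have ZT : (Z' <= T)%VS by apply/subvP => f /hZ'[f1 f2 _]; apply/hT.
have BZ := bd_cyc _ _ _ _ hZ hB; have BZ' := bd_cyc _ _ _ _ hZ' hB'.
(* The defect of g from being a chain map has degree 1 and is tested on homotopies, of degree -1: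
   this is why nondegeneracy was proved in every degree. *)
have perp1 g : g \in Z' <-> g \in T /\ forall f, f \in B -> pairing f g = 0.
  split=> [/hZ'[g1 g2 g3]|[/hT[g1 g2] gB]].
    split=> [|f /hB[h [h1 h2 ->]]]; first exact/hT.
    by rewrite pairing_adjl // g3 subrr (linear0_of (pairing_linr _)).
  apply/hZ'; split=> //; apply/eqP; rewrite -subr_eq0; apply/eqP.
  apply: (@pairing_ndr 1) => [||f f1 f2].
  - rewrite addrC -scaleN1r; apply: homogeneous_lin.
      by rewrite -[1]add0r; apply: homogeneousM g1; exact: cdiff_homog.
    by rewrite -[1]addr0; apply: homogeneousM g1 _; exact: cdiff_homog.
  - rewrite addrC -scaleN1r; apply: modhom_lin.
      by apply: modhomM g2; exact: cdiff_modhom.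
    by apply: modhomM g2 _; exact: cdiff_modhom.
  by rewrite -pairing_adjl //; apply: gB; apply/hB; exists f.
have perp2 f : f \in Z <-> f \in U /\ forall g, g \in B' -> pairing f g = 0.
  split=> [/hZ[f1 f2 f3]|[/hU[f1 f2] fB]].
    split=> [|g /hB'[h [h1 h2 ->]]]; first exact/hU.
    by rewrite pairing_adjr // f3 subrr (linear0_of (pairing_linl _)).
  apply/hZ; split=> //; apply/eqP; rewrite eq_sym -subr_eq0; apply/eqP.
  apply: (@pairing_ndl 1) => [||g g1 g2].
  - rewrite addrC -scaleN1r; apply: homogeneous_lin.
      by rewrite -[1]addr0; apply: homogeneousM f1 _; exact: cdiff_homog.
    by rewrite -[1]add0r; apply: homogeneousM f1; exact: cdiff_homog.
  - rewrite addrC -scaleN1r; apply: modhom_lin.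
      by apply: modhomM f2 _; exact: cdiff_modhom.
    by apply: modhomM f2; exact: cdiff_modhom.
  by rewrite -pairing_adjr //; apply: fB; apply/hB'; exists g.
have e1 := dim_orthogonal pairing_linr pairing_linl ndl ndr (subv_trans BZ ZU) perp1.
have e2 := dim_orthogonal (beta := fun g f => pairing f g) pairing_linl pairing_linr
  ndr ndl (subv_trans BZ' ZT) perp2.
have e3 := dim_nondegenerate pairing_linr pairing_linl ndl ndr.
rewrite (dimk_hthom hZ hB BZ) (dimk_hthom hZ' hB' BZ').
by rewrite -(addnK (\dim B') (\dim Z)) e2 -(addnK (\dim B) (\dim Z')) e1 e3 subnAC.
Qed.
End Pairing.
End HomDimension.

(** * The category of perfect complexes *)

Section PerfectCategory.
Variables (k : fieldType) (L : falgType k).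

Lemma dimk_hthom_iso (X Y X' Y' : complex L) (f : chmap X Y -> chmap X' Y')
    (g : chmap X' Y' -> chmap X Y) : linear f -> linear g -> cancel f g -> cancel g f ->
  (forall u, nullhomotopic u -> nullhomotopic (f u)) ->
  (forall u, nullhomotopic u -> nullhomotopic (g u)) ->
  dimk (hthom X Y) = dimk (hthom X' Y').
Proof.
move=> lf lg fK gK nf ng.
have lift (A B A' B' : complex L) (h : chmap A B -> chmap A' B') : linear h ->
    (forall u, nullhomotopic u -> nullhomotopic (h u)) ->
    exists H : hthom A B -> hthom A' B', linear H /\ forall v, H (htcls v) = htcls (h v).
  move=> lh nh; apply: (quotmod_lift (h := fun v => htcls (h v))) => [c u v|v /nh hv].
    by rewrite lh htcls_linear.
  rewrite -(linear0_of (@htcls_linear _ _ A' B')); apply/htcls_eq.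
  by rewrite subr0.
have [F [lF FE]] := lift _ _ _ _ f lf nf; have [G [lG GE]] := lift _ _ _ _ g lg ng.
apply: (dimk_iso lF); exists G => x; rewrite -(htrepK x).
  by rewrite FE GE fK.
by rewrite GE FE gK.
Qed.

Lemma shift_comp_chmap r s (X : complex L) :
  is_chmap (cshift s (cshift r X)) (cshift (r + s) X) 1%:M /\
  is_chmap (cshift (r + s) X) (cshift s (cshift r X)) 1%:M.
Proof.
have degE i : @cdeg _ _ (cshift s (cshift r X)) i = @cdeg _ _ (cshift (r + s) X) i.
  by rewrite /= /shift_deg /= /shift_deg opprD addrA.
have diffE : cdiff (cshift s (cshift r X)) = cdiff (cshift (r + s) X).
  by rewrite /= /shift_diff /= /shift_diff scalerA -exprzDr ?unitrN1 // addrC.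
by split; split=> [i j|x|]; rewrite ?mul1mx ?mulmx1 ?diffE // mxE degE addr0;
  case: (eqVneq i j) => [->|_] //; rewrite eqxx.
Qed.

Lemma shift0_chmap (X : complex L) :
  is_chmap (cshift 0 X) X 1%:M /\ is_chmap X (cshift 0 X) 1%:M.
Proof.
have degE i : @cdeg _ _ (cshift 0 X) i = @cdeg _ _ X i by rewrite /= /shift_deg subr0.
have diffE : cdiff (cshift 0 X) = cdiff X by rewrite /= /shift_diff expr0z scale1r.
by split; split=> [i j|x|]; rewrite ?mul1mx ?mulmx1 ?diffE // mxE degE addr0;
  case: (eqVneq i j) => [->|_] //; rewrite eqxx.
Qed.

Lemma chmap_iso (X Y : Db L) f g (hf : is_chmap X Y f) (hg : is_chmap Y X g) :
  g *m f = 1%:M -> f *m g = 1%:M -> isomorphic X Y.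
Proof.
move=> gf fg; exists (htcls (mkchmap hf)), (htcls (mkchmap hg)).
by split; rewrite -[LHS]/(htcomp _ _) htcompE; congr htcls; apply: chmap_inj.
Qed.

Lemma pshift_add r s (X : Db L) : isomorphic (pshift s (pshift r X) : Db L) (pshift (r + s) X).
Proof.
have [h1 h2] := shift_comp_chmap r s X.
by apply: (@chmap_iso (pshift s (pshift r X)) (pshift (r + s) X) _ _ h1 h2); rewrite mulmx1.
Qed.

(** Replaces the iterated shifts of [shz] by a single shift whose sign (-1)^i is explicit. *)
Lemma shz_pshift (X : Db L) i : isomorphic (shz X i) (pshift i X).
Proof.
have X0 : isomorphic (pshift 0 X : Db L) X.
  have [h1 h2] := shift0_chmap X.
  by apply: (@chmap_iso (pshift 0 X) X _ _ h1 h2); rewrite mulmx1.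
elim/int_rect: i => [|n IH|n IH]; first exact: isomorphic_sym.
  rewrite -addn1 PoszD; apply: isomorphic_trans (isomorphic_sym (sh_shz _ _)) _.
  exact: isomorphic_trans (fobj_iso (sh (Db L)) IH) (pshift_add _ _ _).
rewrite -addn1 PoszD opprD; apply: isomorphic_trans (isomorphic_sym (ush_shz _ _)) _.
exact: isomorphic_trans (fobj_iso (ush (Db L)) IH) (pshift_add _ _ _).
Qed.

Lemma dimk_Db (M N : Db L) i : dimk (mor M (shz N i)) = dimk (hthom M (cshift i N)).
Proof. exact: (dimk_mor_isor _ (shz_pshift N i)). Qed.

Variables (d : nat) (lam : L -> k) (a b : 'I_d -> L).
Hypothesis ab : dual_bases lam a b.

(** Hom(M, N[i]) has the dimension of Hom(N[i], M), that is of Hom(N, M[-i]); the reversal of i is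
    the conjugation. *)
Lemma lform_hermitian (M N : Db L) : lform M N = lconj (lform N M).
Proof.
rewrite lformE lformE hilb_conj; apply: eq_hilb => i.
have [t t1] := perfect_rtr1 ab (@perfP _ _ M).
have -> : dimk (mor M (shz N i)) = dimk (mor (shz N i) M) by exact (dimk_hthom_sym ab (shz N i : perf L) t1).
by have := dimk_shz N M i 0; rewrite add0r.
Qed.

(** * Direct sums of complexes *)

Section DirectSum.
Variables X Y : complex L.

Definition sum_act (x : L) : 'M[k]_(mdim X + mdim Y) := block_mx (mdact X x) 0 0 (mdact Y x).

Fact sum_act_linear : linear sum_act.
Proof.
move=> c x y; rewrite /sum_act !mdact_linear scale_block_mx add_block_mx.
by rewrite !scaler0 !addr0.
Qed.
Fact sum_act1 : sum_act 1 = 1%:M.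
Proof. by rewrite /sum_act !mdact1 -scalar_mx_block. Qed.
Fact sum_actM x y : sum_act (x * y) = sum_act x *m sum_act y.
Proof.
by rewrite /sum_act !mdactM mulmx_block !mulmx0 !mul0mx !addr0 !add0r.
Qed.
Definition sum_mod : fdmod L := Fdmod sum_act_linear sum_act1 sum_actM.

Definition sum_deg (i : 'I_(mdim X + mdim Y)) : int :=
  match fintype.split i with inl j => @cdeg _ _ X j | inr j => @cdeg _ _ Y j end.

Lemma homogeneous_block r (f : 'M[k]_(mdim X)) (g : 'M[k]_(mdim Y)) : homogeneous (@cdeg _ _ X) (@cdeg _ _ X) r f ->
  homogeneous (@cdeg _ _ Y) (@cdeg _ _ Y) r g ->
  homogeneous sum_deg sum_deg r (block_mx f 0 0 g).
Proof.
move=> hf hg i j; rewrite /sum_deg -[in block_mx _ _ _ _ i j](splitK i).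
rewrite -[in block_mx _ _ _ _ _ j](splitK j).
case: (fintype.split i) => i'; case: (fintype.split j) => j' /=.
- by rewrite block_mxEul; exact: hf.
- by rewrite block_mxEur mxE eqxx.
- by rewrite block_mxEdl mxE eqxx.
by rewrite block_mxEdr; exact: hg.
Qed.

Definition sum_diff : 'M[k]_(mdim X + mdim Y) := block_mx (cdiff X) 0 0 (cdiff Y).

Fact sum_act_homog x : homogeneous sum_deg sum_deg 0 (mdact sum_mod x).
Proof. by apply: homogeneous_block; exact: cact_homog. Qed.
Fact sum_diff_homog : homogeneous sum_deg sum_deg 1 sum_diff.
Proof. by apply: homogeneous_block; exact: cdiff_homog. Qed.
Fact sum_diff_modhom : is_modhom sum_mod sum_mod sum_diff.
Proof.
move=> x; rewrite /= /sum_act /sum_diff !mulmx_block !mulmx0 !mul0mx !addr0 !add0r.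
by rewrite !cdiff_modhom.
Qed.
Fact sum_diff2 : sum_diff *m sum_diff = 0.
Proof.
rewrite /sum_diff mulmx_block !mulmx0 !mul0mx !addr0 !add0r !cdiff2.
exact: block_mx0.
Qed.
Definition csum : complex L :=
  @Complex k L sum_mod sum_deg sum_diff sum_act_homog sum_diff_homog sum_diff_modhom sum_diff2.

Lemma csum_perfect : perfect X -> perfect Y -> perfect csum.
Proof.
move=> /(perfect_rtr1 ab)[t t1] /(perfect_rtr1 ab)[s s1].
apply: (rtr1_perfect ab (X := csum) (t := block_mx t 0 0 s)).
rewrite /rtr (eq_bigr (fun i => block_mx (mdact X (a i) *m t *m mdact X (b i)) 0 0
   (mdact Y (a i) *m s *m mdact Y (b i)))); last first.
  by move=> i _; rewrite /= /sum_act !mulmx_block !mulmx0 !mul0mx !addr0 !add0r !mul0mx.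
have -> (F : 'I_d -> 'M[k]_(mdim X)) (G : 'I_d -> 'M[k]_(mdim Y)) :
    \sum_i block_mx (F i) 0 0 (G i) = block_mx (\sum_i F i) 0 0 (\sum_i G i).
  elim/big_rec3: _ => [|i x y z _ ->]; first by rewrite block_mx0.
  by rewrite add_block_mx !addr0.
by rewrite -[X in block_mx X]/(rtr a b t) -[X in block_mx _ _ _ X]/(rtr a b s) t1 s1 -scalar_mx_block.
Qed.

Lemma csum_incl : is_chmap X csum (col_mx 1%:M 0) /\ is_chmap csum X (row_mx 1%:M 0).
Proof.
split; split=> [i j|x|].
- rewrite -(splitK i) /= /sum_deg unsplitK; case: (fintype.split i) => i'.
    by rewrite col_mxEu => /homogeneous1.
  by rewrite col_mxEd mxE eqxx.
- by rewrite /= /sum_act mul_col_mx mul_block_col !mul1mx !mul0mx !mulmx1 !mulmx0 !addr0.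
- by rewrite /= /sum_diff mul_col_mx mul_block_col !mul1mx !mul0mx !mulmx1 !mulmx0 !addr0.
- rewrite -(splitK j) /= /sum_deg unsplitK; case: (fintype.split j) => j'.
    by rewrite row_mxEl => /homogeneous1.
  by rewrite row_mxEr mxE eqxx.
- by rewrite /= /sum_act mul_mx_row mul_row_block !mul1mx !mul0mx !mulmx1 !mulmx0 !addr0.
by rewrite /= /sum_diff mul_mx_row mul_row_block !mul1mx !mul0mx !mulmx1 !mulmx0 !addr0.
Qed.

Lemma csum_incr : is_chmap Y csum (col_mx 0 1%:M) /\ is_chmap csum Y (row_mx 0 1%:M).
Proof.
split; split=> [i j|x|].
- rewrite -(splitK i) /= /sum_deg unsplitK; case: (fintype.split i) => i'.
    by rewrite col_mxEu mxE eqxx.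
  by rewrite col_mxEd => /homogeneous1.
- by rewrite /= /sum_act mul_col_mx mul_block_col !mul1mx !mul0mx !mulmx1 !mulmx0 !add0r.
- by rewrite /= /sum_diff mul_col_mx mul_block_col !mul1mx !mul0mx !mulmx1 !mulmx0 !add0r.
- rewrite -(splitK j) /= /sum_deg unsplitK; case: (fintype.split j) => j'.
    by rewrite row_mxEl mxE eqxx.
  by rewrite row_mxEr => /homogeneous1.
- by rewrite /= /sum_act mul_mx_row mul_row_block !mul1mx !mul0mx !mulmx1 !mulmx0 !add0r.
by rewrite /= /sum_diff mul_mx_row mul_row_block !mul1mx !mul0mx !mulmx1 !mulmx0 !add0r.
Qed.
End DirectSum.

Lemma Db_biprod (X Y : Db L) : exists Z, is_biprod X Y Z.
Proof.
exists (Perf (csum_perfect (@perfP _ _ X) (@perfP _ _ Y))).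
have [i1 p1] := csum_incl X Y; have [i2 p2] := csum_incr X Y.
pose Z : Db L := Perf (csum_perfect (@perfP _ _ X) (@perfP _ _ Y)).
pose j1 : mor X Z := htcls (mkchmap i1); pose q1 : mor Z X := htcls (mkchmap p1).
pose j2 : mor Y Z := htcls (mkchmap i2); pose q2 : mor Z Y := htcls (mkchmap p2).
exists (fun c : bool => if c return mor (if c then X else Y) Z then j1 else j2).
exists (fun c : bool => if c return mor Z (if c then X else Y) then q1 else q2).
split=> [[]|[] []|] //.
- apply: (etrans (htcompE (mkchmap p1) (mkchmap i1))); congr htcls.
  by apply: chmap_inj; rewrite /= mul_row_col mulmx1 mul0mx addr0.
- apply: (etrans (htcompE (mkchmap p2) (mkchmap i2))); congr htcls.
  by apply: chmap_inj; rewrite /= mul_row_col mulmx1 mul0mx add0r.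
- move=> _; apply: (etrans (htcompE (mkchmap p2) (mkchmap i1))).
  apply: (etrans _ (linear0_of (@htcls_linear _ _ X Y))); congr htcls.
  by apply: chmap_inj; rewrite /= mul_row_col mul0mx mulmx0 addr0.
- move=> _; apply: (etrans (htcompE (mkchmap p1) (mkchmap i2))).
  apply: (etrans _ (linear0_of (@htcls_linear _ _ Y X))); congr htcls.
  by apply: chmap_inj; rewrite /= mul_row_col mul0mx mulmx0 addr0.
rewrite big_bool /=.
apply: (etrans (congr2 +%R (htcompE (mkchmap i1) (mkchmap p1)) (htcompE (mkchmap i2) (mkchmap p2)))).
rewrite -(linearD_of (@htcls_linear _ _ Z Z)); congr htcls.
apply: chmap_inj; rewrite /= !mul_col_row !mulmx1 !mul0mx !mulmx0 add_block_mx.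
by rewrite !addr0 !add0r -scalar_mx_block.
Qed.

End PerfectCategory.

(** * Tensor products and duals over group algebras *)

Section GradedHom.
Variables (k : fieldType) (L : falgType k).
Implicit Types X Y : complex L.

Lemma signD (x y : int) : (-1) ^ (x + y) = (-1) ^ x * (-1) ^ y :> k.
Proof. by rewrite exprzDr ?unitrN1. Qed.

Lemma signN (x : int) : (-1) ^ (- x) = (-1) ^ x :> k.
Proof. by rewrite -exprz_inv invrN1. Qed.

(** The differential of the total Hom complex on maps of degree s; its L-linear cycles of degree r
    are the chain maps to the r-th shift. *)
Definition hdiff X Y (s : int) (f : 'M[k]_(mdim Y, mdim X)) : 'M[k]_(mdim Y, mdim X) :=
  cdiff Y *m f - (-1) ^ s *: (f *m cdiff X).

Lemma chmap_shiftP X Y r (f : 'M[k]_(mdim Y, mdim X)) : is_chmap X (cshift r Y) f <->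
  [/\ homogeneous (@cdeg _ _ X) (@cdeg _ _ Y) r f, is_modhom X Y f & hdiff r f = 0].
Proof.
have homE : homogeneous (@cdeg _ _ X) (@cdeg _ _ (cshift r Y)) 0 f <->
    homogeneous (@cdeg _ _ X) (@cdeg _ _ Y) r f.
  split=> e i j /e /=; rewrite /shift_deg addr0; first by move/eqP; rewrite subr_eq => /eqP.
  by move=> ->; rewrite addrK.
have diffE : f *m cdiff X = cdiff (cshift r Y) *m f <-> hdiff r f = 0.
  rewrite /hdiff /= /shift_diff -scalemxAl; split=> [->|/eqP].
    by rewrite scalerA signE scale1r subrr.
  by rewrite subr_eq0 => /eqP ->; rewrite scalerA signE scale1r.
by split=> [[/homE h1 h2 /diffE h3]|[/homE h1 h2 /diffE h3]].
Qed.

(** The shifted differential carries the sign (-1)^r; rescaling a homotopy by it gives an element of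
    degree r - 1 of the Hom complex. *)
Lemma null_shiftP X Y r (f : chmap X (cshift r Y)) : nullhomotopic f <->
  exists h : 'M[k]_(mdim Y, mdim X),
    [/\ homogeneous (@cdeg _ _ X) (@cdeg _ _ Y) (r - 1) h, is_modhom X Y h &
    chmx f = hdiff (r - 1) h].
Proof.
have homE h : homogeneous (@cdeg _ _ X) (@cdeg _ _ (cshift r Y)) (-1) h <->
    homogeneous (@cdeg _ _ X) (@cdeg _ _ Y) (r - 1) h.
  split=> e i j /e /=; rewrite /shift_deg.
    by move/eqP; rewrite subr_eq -addrA [-1 + r]addrC => /eqP.
  by move=> ->; rewrite -addrA; congr (_ + _); rewrite addrC addKr.
have homZ h c : homogeneous (@cdeg _ _ X) (@cdeg _ _ Y) (r - 1) h ->
    homogeneous (@cdeg _ _ X) (@cdeg _ _ Y) (r - 1) (c *: h).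
  by move=> e; rewrite -[_ *: _]addr0; apply: homogeneous_lin => //; exact: homogeneous0.
have modZ h c : is_modhom X Y h -> is_modhom X Y (c *: h).
  by move=> e; rewrite -[_ *: _]addr0; apply: modhom_lin => //; exact: modhom0.
have diffE (h : 'M[k]_(mdim Y, mdim X)) : cdiff (cshift r Y) *m h + h *m cdiff X = hdiff (r - 1) ((-1) ^ r *: h).
  rewrite /hdiff /= /shift_diff -scalemxAl -scalemxAr; congr (_ + _).
  rewrite -scalemxAl scalerA signD signN expr1z -mulrA mulN1r mulrN signE scaleN1r.
  by rewrite opprK.
split=> [[h [/homE h1 h2 h3]]|[h [h1 h2 h3]]].
  by exists ((-1) ^ r *: h); split; [exact: homZ|exact: modZ|rewrite h3 diffE].
exists ((-1) ^ r *: h); split; [by apply/homE/homZ|exact: modZ|].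
by rewrite diffE scalerA signE scale1r.
Qed.

(** An isomorphism of Hom complexes preserves cycles and boundaries. Compatibility with [hdiff] is
    asked on homogeneous maps only, since sign twists commute with it only there. *)
Lemma dimk_hthom_shift_iso X Y X' Y' r
    (F : 'M[k]_(mdim Y, mdim X) -> 'M[k]_(mdim Y', mdim X'))
    (G : 'M[k]_(mdim Y', mdim X') -> 'M[k]_(mdim Y, mdim X)) :
  linear F -> cancel F G -> cancel G F ->
  (forall s f, homogeneous (@cdeg _ _ X) (@cdeg _ _ Y) s f <->
     homogeneous (@cdeg _ _ X') (@cdeg _ _ Y') s (F f)) ->
  (forall s f, homogeneous (@cdeg _ _ X) (@cdeg _ _ Y) s f ->
     is_modhom X Y f <-> is_modhom X' Y' (F f)) ->
  (forall s f, homogeneous (@cdeg _ _ X) (@cdeg _ _ Y) s f ->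
     F (hdiff s f) = hdiff s (F f)) ->
  dimk (hthom X (cshift r Y)) = dimk (hthom X' (cshift r Y')).
Proof.
move=> lF FK GK hF mF dF; have lG := inverse_linear lF FK GK.
have F0 := linear0_of lF.
have chF f : is_chmap X (cshift r Y) f -> is_chmap X' (cshift r Y') (F f).
  move=> /chmap_shiftP[f1 f2 f3]; apply/chmap_shiftP; split; first exact/hF.
    exact/(mF _ _ f1).
  by rewrite -(dF _ _ f1) f3 F0.
have chG g : is_chmap X' (cshift r Y') g -> is_chmap X (cshift r Y) (G g).
  rewrite -{1}(GK g) => /chmap_shiftP[/hF f1 /(mF _ _ f1) f2 f3].
  apply/chmap_shiftP; split=> //; apply: (can_inj FK).
  by rewrite (dF _ _ f1) f3 F0.
apply: (@dimk_hthom_iso _ _ _ _ _ _ (fun u => mkchmap (chF _ (chmapP u)))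
  (fun u => mkchmap (chG _ (chmapP u)))).
- by move=> c u v; apply: chmap_inj; rewrite /= lF.
- by move=> c u v; apply: chmap_inj; rewrite /= lG.
- by move=> u; apply: chmap_inj; rewrite /= FK.
- by move=> u; apply: chmap_inj; rewrite /= GK.
- move=> u /null_shiftP[h [h1 h2 h3]]; apply/null_shiftP; exists (F h); split; first exact/hF.
    exact/(mF _ _ h1).
  by rewrite /= h3 dF.
move=> u /null_shiftP[h [h1 h2 h3]]; apply/null_shiftP; exists (G h).
rewrite -{1 2}(GK h) in h1 h2 h3.
move/hF: h1 => h1; move/(mF _ _ h1): h2 => h2; split=> //.
by apply: (can_inj FK); rewrite /= GK h3 dF // !GK.
Qed.
End GradedHom.

Section TensorEntries.
Variables (k : fieldType).

Lemma mulmx_tensr1 m n p q (h : 'M[k]_(q, m * n)) (A : 'M[k]_(m, p)) i j l :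
  (h *m (A *t (1%:M : 'M[k]_n))) i (mxtens_index (j, l)) =
  \sum_j' h i (mxtens_index (j', l)) * A j' j.
Proof.
rewrite mxE sum_mxtens; apply: eq_bigr => j' _.
rewrite (bigD1 l) //= big1 ?addr0 => [|l' ll']; first by rewrite tensmxE mxE eqxx mulr1.
by rewrite tensmxE mxE (negPf ll') !mulr0.
Qed.

Lemma mulmx_tens1r m n p q (h : 'M[k]_(q, m * n)) (A : 'M[k]_(n, p)) i j l :
  (h *m ((1%:M : 'M[k]_m) *t A)) i (mxtens_index (j, l)) =
  \sum_l' h i (mxtens_index (j, l')) * A l' l.
Proof.
rewrite mxE sum_mxtens (bigD1 j) //= [X in _ + X]big1 ?addr0 => [|j' jj'].
  by apply: eq_bigr => l' _; rewrite tensmxE mxE eqxx mul1r.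
by rewrite big1 // => l' _; rewrite tensmxE mxE (negPf jj') mul0r mulr0.
Qed.

Lemma mul_tens1_mx m n p q (h : 'M[k]_(m * n, q)) (A : 'M[k]_(p, m)) i j l :
  ((A *t (1%:M : 'M[k]_n)) *m h) (mxtens_index (j, l)) i =
  \sum_j' A j j' * h (mxtens_index (j', l)) i.
Proof.
rewrite mxE sum_mxtens; apply: eq_bigr => j' _.
rewrite (bigD1 l) //= big1 ?addr0 => [|l' ll']; first by rewrite tensmxE mxE eqxx mulr1.
by rewrite tensmxE [1%:M _ _]mxE eq_sym (negPf ll') mulr0 mul0r.
Qed.

Lemma mul_1tens_mx m n p q (h : 'M[k]_(m * n, q)) (A : 'M[k]_(p, n)) i j l :
  (((1%:M : 'M[k]_m) *t A) *m h) (mxtens_index (j, l)) i =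
  \sum_l' A l l' * h (mxtens_index (j, l')) i.
Proof.
rewrite mxE sum_mxtens (bigD1 j) //= [X in _ + X]big1 ?addr0 => [|j' jj'].
  by apply: eq_bigr => l' _; rewrite tensmxE mxE eqxx mul1r.
by rewrite big1 // => l' _; rewrite tensmxE mxE eq_sym (negPf jj') !mul0r.
Qed.

End TensorEntries.

(** * Perfect complexes over a group algebra *)

Section GroupAlgebraForms.
Variables (k : fieldType) (gT : finGroupType).
Local Notation kG := (galg k gT).
Implicit Types X Y M N U : complex kG.

Definition gbasis (i : 'I_#|gT|) : kG := gelt k (enum_val i).
Definition gcobasis (i : 'I_#|gT|) : kG := gelt k (enum_val i)^-1%g.

Lemma sum_enum_val (V : nmodType) (F : gT -> V) :
  \sum_(i < #|gT|) F (enum_val i) = \sum_g F g.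
Proof. by rewrite [RHS](reindex (@enum_val gT gT)) //; exact/onW_bij/enum_val_bij. Qed.

(** The form is the coefficient of the identity: a product of g^-1 and h contributes to it exactly
    when g = h. *)
Lemma galg_dual_bases : dual_bases (fun x : kG => x 1%g) gbasis gcobasis.
Proof.
have gE (g : gT) (x : kG) h : (gelt k g * x) h = x (g^-1 * h)%g.
  rewrite ffunE (bigD1 g) //= big1 ?addr0 => [|l lg]; first by rewrite ffunE eqxx mul1r.
  by rewrite ffunE (negPf lg) mul0r.
have trC (x y : kG) : (x * y) 1%g = (y * x) 1%g.
  rewrite !ffunE (reindex_inj invg_inj); apply: eq_bigr => g _ /=.
  by rewrite invgK !mulg1 mulrC.
split=> [c x y|x y|i j|y|z].
- by rewrite !ffunE.
- exact: trC.
- rewrite /gcobasis /gbasis geltM ffunE eq_sym -eq_invg_mul invgK; congr (_%:R).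
  by rewrite (inj_eq enum_val_inj).
- apply/ffunP=> h; rewrite sum_ffunE; transitivity (\sum_g y g * (h == g)%:R).
    rewrite -(sum_enum_val (fun g => y g * (h == g)%:R)); apply: eq_bigr => i _.
    by rewrite [LHS]ffunE /= gE invgK mulg1 ffunE.
  rewrite (bigD1 h) //= eqxx mulr1 big1 ?addr0 // => g gh.
  by rewrite eq_sym (negPf gh) mulr0.
apply/ffunP=> h; rewrite sum_ffunE; transitivity (\sum_g z g^-1%g * (h == g^-1)%g%:R).
  rewrite -(sum_enum_val (fun g => z g^-1%g * (h == g^-1)%g%:R)); apply: eq_bigr => i _.
  by rewrite [LHS]ffunE /= trC gE mulg1 ffunE.
rewrite (bigD1 h^-1%g) //= invgK eqxx mulr1 big1 ?addr0 // => g gh.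
by rewrite eq_sym -(inj_eq invg_inj) invgK (negPf gh) mulr0.
Qed.

Lemma galg_sum (x : kG) : x = \sum_g x g *: gelt k g.
Proof.
apply/ffunP=> h; rewrite sum_ffunE (bigD1 h) //= big1 ?addr0 => [|g gh].
  by rewrite !ffunE eqxx [RHS]mulr1.
by rewrite !ffunE eq_sym (negPf gh) scaler0.
Qed.

Lemma mdact_galg (X : fdmod kG) x : mdact X x = Defs.gact (grho X) x.
Proof.
rewrite {1}(galg_sum x) (linear_sum_of _ _ _ (@mdact_linear _ _ X)).
by apply: eq_bigr => g _; rewrite (linearZ_of _ (@mdact_linear _ _ X)).
Qed.

Lemma galg_modhomP (X Y : fdmod kG) f :
  is_modhom X Y f <-> forall g, f *m grho X g = grho Y g *m f.
Proof.
split=> [h g|h x]; first exact: h.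
by rewrite !mdact_galg; exact: gact_modhom.
Qed.

Lemma gact_gelt n (rho : gT -> 'M[k]_n) g : Defs.gact rho (gelt k g) = rho g.
Proof.
rewrite /Defs.gact (bigD1 g) //= ffunE eqxx scale1r big1 ?addr0 // => h hg.
by rewrite ffunE (negPf hg) scale0r.
Qed.

Lemma grho_tens X Y g : grho (ctens X Y) g = grho X g *t grho Y g.
Proof. exact: gact_gelt. Qed.

Lemma grho_dual X g : grho (cdual X) g = (grho X g^-1)^T.
Proof. exact: gact_gelt. Qed.

Lemma galg_perfectP X : perfect X <->
  exists t, \sum_g grho X g *m t *m grho X g^-1 = 1%:M.
Proof.
have rE (t : 'M[k]_(mdim X)) : rtr gbasis gcobasis (U := X) (V := X) t =
    \sum_g grho X g *m t *m grho X g^-1.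
  by rewrite -(sum_enum_val (fun g => grho X g *m t *m grho X g^-1)).
split=> [/(perfect_rtr1 galg_dual_bases)[t t1]|[t t1]]; first by exists t; rewrite -rE.
by apply: (rtr1_perfect galg_dual_bases (t := t)); rewrite rE.
Qed.

(** Conjugation by g fixes the identity of Y, so only the factor t is averaged. *)
Lemma ctens_perfectl X Y : perfect X -> perfect (ctens X Y).
Proof.
move=> /galg_perfectP[t t1]; apply/galg_perfectP; exists (t *t 1%:M).
have -> : \sum_g grho (ctens X Y) g *m (t *t 1%:M) *m grho (ctens X Y) g^-1 =
    \sum_g (grho X g *m t *m grho X g^-1) *t (1%:M : 'M[k]_(mdim Y)).
  apply: eq_bigr => g _; rewrite !grho_tens !tensmx_mul mulmx1 -grhoM mulgV.
  by rewrite grho1.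
have -> (F : gT -> 'M[k]_(mdim X)) :
    \sum_g F g *t (1%:M : 'M[k]_(mdim Y)) = (\sum_g F g) *t 1%:M.
  apply/matrixP=> i j; rewrite summxE !mxE summxE mulr_suml.
  by apply: eq_bigr => g _; rewrite !mxE.
by rewrite t1 tensmx11.
Qed.

Lemma ctens_perfectr X Y : perfect Y -> perfect (ctens X Y).
Proof.
move=> /galg_perfectP[t t1]; apply/galg_perfectP; exists (1%:M *t t).
have -> : \sum_g grho (ctens X Y) g *m (1%:M *t t) *m grho (ctens X Y) g^-1 =
    \sum_g (1%:M : 'M[k]_(mdim X)) *t (grho Y g *m t *m grho Y g^-1).
  apply: eq_bigr => g _; rewrite !grho_tens !tensmx_mul mulmx1 -grhoM mulgV.
  by rewrite grho1.
have -> (F : gT -> 'M[k]_(mdim Y)) :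
    \sum_g (1%:M : 'M[k]_(mdim X)) *t F g = 1%:M *t (\sum_g F g).
  apply/matrixP=> i j; rewrite summxE !mxE summxE mulr_sumr.
  by apply: eq_bigr => g _; rewrite !mxE.
by rewrite t1 tensmx11.
Qed.

Lemma cdual_perfect X : perfect X -> perfect (cdual X).
Proof.
move=> /galg_perfectP[t t1]; apply/galg_perfectP; exists t^T.
rewrite -[RHS]trmx1 -t1 linear_sum; apply: eq_bigr => g _.
by rewrite !grho_dual [RHS]/= !trmx_mul invgK mulmxA.
Qed.

Section Adjunction.
Variables M N U : complex kG.
Local Notation dM := (@cdeg _ _ M).
Local Notation dN := (@cdeg _ _ N).
Local Notation dU := (@cdeg _ _ U).
Local Notation sg u n := ((-1) ^ (dU u * dN n) : k).

(** The classical adjoint of F, with Hom(U, N) identified with [cdual U] tensor N: m goes to the sum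
    over basis vectors u of the dual vector of u tensor F (m (x) u), up to signs. *)
Definition adj (F : 'M[k]_(mdim N, mdim M * mdim U)) : 'M[k]_(mdim U * mdim N, mdim M) :=
  \matrix_(p, m) (sg (mxtens_unindex p).1 (mxtens_unindex p).2 *
    F (mxtens_unindex p).2 (mxtens_index (m, (mxtens_unindex p).1))).

Definition coadj (G : 'M[k]_(mdim U * mdim N, mdim M)) : 'M[k]_(mdim N, mdim M * mdim U) :=
  \matrix_(n, q) (sg (mxtens_unindex q).2 n *
    G (mxtens_index ((mxtens_unindex q).2, n)) (mxtens_unindex q).1).

Lemma adjE F u n m : adj F (mxtens_index (u, n)) m = sg u n * F n (mxtens_index (m, u)).
Proof. by rewrite mxE mxtens_indexK. Qed.

Lemma coadjE G u n m : coadj G n (mxtens_index (m, u)) = sg u n * G (mxtens_index (u, n)) m.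
Proof. by rewrite mxE mxtens_indexK. Qed.

Lemma sg_neq0 u n : sg u n != 0.
Proof. by apply: expfz_neq0; rewrite oppr_eq0 oner_eq0. Qed.

Lemma adj_linear : linear adj.
Proof.
by move=> c F G; apply/matrixP=> p m; rewrite !mxE mulrDr [c * (_ * _)]mulrCA.
Qed.

Lemma adjK : cancel adj coadj.
Proof.
move=> F; apply/matrixP=> n q; rewrite -(mxtens_unindexK q).
by case: (mxtens_unindex q) => m u; rewrite coadjE adjE mulrA signE mul1r.
Qed.

Lemma coadjK : cancel coadj adj.
Proof.
move=> G; apply/matrixP=> p m; rewrite -(mxtens_unindexK p).
by case: (mxtens_unindex p) => u n; rewrite adjE coadjE mulrA signE mul1r.
Qed.

Lemma adj_homog s (F : 'M[k]_(mdim N, mdim M * mdim U)) :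
  homogeneous (@cdeg _ _ (ctens M U)) dN s F <->
  homogeneous dM (@cdeg _ _ (ctens (cdual U) N)) s (adj F).
Proof.
split=> hF i j.
  rewrite -(mxtens_unindexK i); case: (mxtens_unindex i) => u n.
  rewrite adjE mulf_eq0 negb_or => /andP[_ /hF].
  rewrite /= /tens_deg !mxtens_indexK /= /dual_deg => ->.
  by rewrite [_ + dU u]addrC -addrA addKr.
rewrite -(mxtens_unindexK j); case: (mxtens_unindex j) => m u nz.
have /hF : adj F (mxtens_index (u, i)) m != 0 by rewrite adjE mulf_neq0 ?sg_neq0.
rewrite /= /tens_deg !mxtens_indexK /= /dual_deg => e.
by rewrite -[LHS](addKr (- dU u)) opprK e addrCA addrA.
Qed.

(** Both conditions amount to F (g m (x) u) = g F (m (x) g^-1 u), which is [A g = B g]. The signs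
    are harmless because the group preserves degrees. *)
Lemma adj_modhom (F : 'M[k]_(mdim N, mdim M * mdim U)) :
  is_modhom (ctens M U) N F <-> is_modhom M (ctens (cdual U) N) (adj F).
Proof.
pose A g := F *m (grho M g *t 1%:M).
pose B g := grho N g *m F *m (1%:M *t grho U g^-1).
have eA g u n m : (adj F *m grho M g) (mxtens_index (u, n)) m =
    sg u n * A g n (mxtens_index (m, u)).
  rewrite mulmx_tensr1 mxE mulr_sumr; apply: eq_bigr => m' _.
  by rewrite adjE mulrA.
have eB g u n m : (grho (ctens (cdual U) N) g *m adj F) (mxtens_index (u, n)) m =
    sg u n * B g n (mxtens_index (m, u)).
  rewrite grho_tens grho_dual -[_ *t _]/(_ *t _).
  have -> : (grho U g^-1)^T *t grho N g = ((grho U g^-1)^T *t 1%:M) *m (1%:M *t grho N g).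
    by rewrite tensmx_mul mulmx1 mul1mx.
  rewrite -mulmxA mul_tens1_mx mulmx_tens1r mulr_sumr; apply: eq_bigr => u' _.
  rewrite mul_1tens_mx [(_^T) u u']mxE [(grho N g *m F) _ _]mxE mulr_suml !mulr_sumr.
  apply: eq_bigr => n' _; rewrite adjE.
  have [->|/(cact_homog (c := N))] := eqVneq (grho N g n n') 0; first by rewrite !(mul0r, mulr0).
  have [->|/(cact_homog (c := U))] := eqVneq (grho U g^-1%g u' u) 0; first by rewrite !(mul0r, mulr0).
  rewrite !addr0 => -> ->.
  by rewrite [grho N g n n' * (_ * _)]mulrCA [LHS]mulrCA; congr (_ * _); exact: mulrC.
have eAB : (forall g, A g = B g) <-> forall g, adj F *m grho M g = grho (ctens (cdual U) N) g *m adj F.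
  split=> h g; apply/matrixP=> i j.
    by rewrite -(mxtens_unindexK i); case: (mxtens_unindex i) => u n; rewrite eA eB h.
  rewrite -(mxtens_unindexK j); case: (mxtens_unindex j) => m u.
  by apply: (mulfI (sg_neq0 u i)); rewrite -eA -eB h.
have inv g : (1%:M *t grho U g) *m (1%:M *t grho U g^-1) = 1%:M :> 'M[k]_(mdim M * mdim U).
  by rewrite tensmx_mul mulmx1 -grhoM mulgV grho1 tensmx11.
have inv' g : (1%:M *t grho U g^-1) *m (1%:M *t grho U g) = 1%:M :> 'M[k]_(mdim M * mdim U).
  by rewrite tensmx_mul mulmx1 -grhoM mulVg grho1 tensmx11.
have tE g : grho (ctens M U) g = (grho M g *t 1%:M) *m (1%:M *t grho U g).
  by rewrite grho_tens tensmx_mul mulmx1 mul1mx.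
split=> [/galg_modhomP h|/galg_modhomP/eAB h]; apply/galg_modhomP.
  by apply/eAB => g; rewrite /A /B -h tE -!mulmxA inv mulmx1.
by move=> g; rewrite tE mulmxA -/(A g) h /B -[LHS]mulmxA inv' mulmx1.
Qed.

(** The three differentials correspond one by one. That of M meets no sign ([e1]); that of N raises
    |n|, which yields the sign (-1)^|u| of the tensor differential ([e2]); that of U becomes the
    differential of the dual ([e3]). *)
Lemma adj_hdiff s (F : 'M[k]_(mdim N, mdim M * mdim U)) :
  homogeneous (@cdeg _ _ (ctens M U)) dN s F ->
  adj (@hdiff _ _ (ctens M U) N s F) = @hdiff _ _ M (ctens (cdual U) N) s (adj F).
Proof.
move=> hF; have degF n m u : F n (mxtens_index (m, u)) != 0 -> dN n = dM m + dU u + s.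
  by move/hF => ->; rewrite /= /tens_deg mxtens_indexK.
apply/matrixP=> p m; rewrite -(mxtens_unindexK p); case: (mxtens_unindex p) => u n.
rewrite adjE /hdiff.
have diffT : cdiff (ctens M U) = cdiff M *t 1%:M + (sgn_mx M *t 1%:M) *m (1%:M *t cdiff U).
  by rewrite tensmx_mul mulmx1 mul1mx.
have diffD : cdiff (ctens (cdual U) N) = cdiff (cdual U) *t 1%:M + (sgn_mx (cdual U) *t 1%:M) *m (1%:M *t cdiff N).
  by rewrite tensmx_mul mulmx1 mul1mx.
have sgnT q (H : 'M[k]_(q, mdim M * mdim U)) i l j :
    (H *m (sgn_mx M *t 1%:M)) i (mxtens_index (l, j)) = (-1) ^ dM l * H i (mxtens_index (l, j)).
  rewrite mulmx_tensr1 (bigD1 l) //= big1 ?addr0 => [|l' ll']; last first.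
    by rewrite !mxE (negPf ll') mulr0n mulr0.
  by rewrite !mxE eqxx mulr1n mulrC.
have sgnD q (H : 'M[k]_(mdim U * mdim N, q)) i l j :
    ((sgn_mx (cdual U) *t 1%:M) *m H) (mxtens_index (l, j)) i = (-1) ^ dU l * H (mxtens_index (l, j)) i.
  rewrite mul_tens1_mx (bigD1 l) //= big1 ?addr0 => [|l' ll']; last first.
    by rewrite !mxE eq_sym (negPf ll') mulr0n mul0r.
  by rewrite !mxE eqxx mulr1n /dual_deg signN.
have e1 : sg u n * (F *m (cdiff M *t 1%:M)) n (mxtens_index (m, u)) =
    (adj F *m cdiff M) (mxtens_index (u, n)) m.
  rewrite mulmx_tensr1 mxE mulr_sumr; apply: eq_bigr => m' _.
  by rewrite adjE mulrA.
have e2 : sg u n * (cdiff N *m F) n (mxtens_index (m, u)) =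
    ((sgn_mx (cdual U) *t 1%:M) *m ((1%:M *t cdiff N) *m adj F)) (mxtens_index (u, n)) m.
  rewrite sgnD mul_1tens_mx mxE !mulr_sumr; apply: eq_bigr => n' _; rewrite adjE.
  have [->|/cdiff_homog ->] := eqVneq (cdiff N n n') 0; first by rewrite !(mul0r, mulr0).
  rewrite mulrDr mulr1 signD [cdiff N n n' * (_ * _)]mulrCA.
  by rewrite [X in X * _ = _]mulrC -mulrA.
have e3 : sg u n * ((-1) ^ s * (F *m (sgn_mx M *t 1%:M) *m (1%:M *t cdiff U)) n (mxtens_index (m, u))) =
    - ((cdiff (cdual U) *t 1%:M) *m adj F) (mxtens_index (u, n)) m.
  rewrite mulmx_tens1r mul_tens1_mx !mulr_sumr -sumrN; apply: eq_bigr => u' _.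
  rewrite sgnT adjE [cdiff (cdual U) u u']mxE mul_mx_diag !mxE.
  have [->|/degF dn] := eqVneq (F n (mxtens_index (m, u'))) 0; first by rewrite !(mul0r, mulr0) oppr0.
  have [->|/cdiff_homog du] := eqVneq (cdiff U u' u) 0; first by rewrite !(mul0r, mulr0, oppr0).
  (* Since |u'| = |u| + 1, the sign changes by (-1)^|n|, and the degree of F expresses |n| through
     m, u' and s. *)
  have -> : (-1) ^ (dU u' * dN n) = (-1) ^ (dU u * dN n) * ((-1) ^ dM m * (-1) ^ dU u' * (-1) ^ s) :> k.
    by rewrite {1}du mulrDl mul1r signD; congr (_ * _); rewrite dn !signD.
  rewrite mulNr opprK; set x := (-1) ^ dU u'; have xx : x * x = 1 := signE k _.
  move: x ((-1) ^ (dU u * dN n)) ((-1) ^ s) ((-1) ^ dM m) (F _ _) (cdiff U u' u) xx.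
  by move=> x y z w v r xx; rewrite -[LHS]mul1r -xx; ring.
have addE q r (H K : 'M[k]_(q, r)) i j : (H + K) i j = H i j + K i j by rewrite mxE.
have subE q r c (H K : 'M[k]_(q, r)) i j : (H - c *: K) i j = H i j - c * K i j by rewrite !mxE.
rewrite subE [RHS]subE diffT diffD mulmxDr mulmxDl [F *m (_ *m _)]mulmxA -[_ *m _ *m adj F]mulmxA.
rewrite !addE mulrBr e2 [_ * (_ + _)]mulrDr mulrDr e3 [_ * (_ * (F *m (cdiff M *t _)) _ _)]mulrCA e1.
by rewrite opprD opprK [RHS]addrAC addrC; congr (_ + _); rewrite addrC.
Qed.

Lemma dimk_adj r : dimk (hthom (ctens M U) (cshift r N)) = dimk (hthom M (cshift r (ctens (cdual U) N))).
Proof.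
apply: (@dimk_hthom_shift_iso _ _ (ctens M U) N M (ctens (cdual U) N) r adj coadj).
- exact: adj_linear.
- exact: adjK.
- exact: coadjK.
- exact: adj_homog.
- by move=> s f _; exact: adj_modhom.
- exact: adj_hdiff.
Qed.
End Adjunction.

Section Duality.
Variables M N : complex kG.
Local Notation dM := (@cdeg _ _ M).
Local Notation dN := (@cdeg _ _ N).
Local Notation sg n m := ((-1) ^ (dN n * (1 + dM m)) : k).

(** The Koszul sign of transposing F past a functional on N: at this entry F has degree |n| - |m|,
    and |n|(|n| - |m|) has the parity of |n|(1 + |m|). In this form the sign is fixed by the entry,
    so the map is linear on all matrices. *)
Definition trdual (F : 'M[k]_(mdim N, mdim M)) : 'M[k]_(mdim M, mdim N) :=
  \matrix_(m, n) (sg n m * F n m).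
Definition untrdual (G : 'M[k]_(mdim M, mdim N)) : 'M[k]_(mdim N, mdim M) :=
  \matrix_(n, m) (sg n m * G m n).

Lemma sgd_neq0 n m : sg n m != 0.
Proof. by apply: expfz_neq0; rewrite oppr_eq0 oner_eq0. Qed.

Lemma trdual_modhom F : is_modhom M N F <-> is_modhom (cdual N) (cdual M) (trdual F).
Proof.
have e1 g m n : (trdual F *m grho (cdual N) g) m n = sg n m * (grho N g^-1 *m F) n m.
  rewrite grho_dual !mxE mulr_sumr; apply: eq_bigr => n' _; rewrite !mxE.
  have [->|/(cact_homog (c := N))] := eqVneq (grho N g^-1%g n n') 0; first by rewrite !(mul0r, mulr0).
  by rewrite addr0 => ->; rewrite -mulrA [F _ _ * _]mulrC.
have e2 g m n : (grho (cdual M) g *m trdual F) m n = sg n m * (F *m grho M g^-1) n m.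
  rewrite grho_dual !mxE mulr_sumr; apply: eq_bigr => m' _; rewrite !mxE.
  have [->|/(cact_homog (c := M))] := eqVneq (grho M g^-1%g m' m) 0; first by rewrite !(mul0r, mulr0).
  by rewrite addr0 => ->; rewrite mulrC mulrA.
split=> /galg_modhomP h; apply/galg_modhomP => g; apply/matrixP=> i j.
  by rewrite e1 e2 h.
by apply: (mulfI (sgd_neq0 i j)); rewrite -[g]invgK -e1 -e2 h.
Qed.

(** Transposition exchanges the two terms of [hdiff], each up to a sign; [e1] and [e2] show that
    these signs are the ones of the dual differentials. *)
Lemma trdual_hdiff s F : homogeneous dM dN s F ->
  trdual (@hdiff _ _ M N s F) = @hdiff _ _ (cdual N) (cdual M) s (trdual F).
Proof.
move=> hF; apply/matrixP=> m n.
have subE q r c (H K : 'M[k]_(q, r)) i j : (H - c *: K) i j = H i j - c * K i j by rewrite !mxE.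
rewrite mxE /hdiff subE [RHS]subE.
have e1 : sg n m * (cdiff N *m F) n m = - ((-1) ^ s * (trdual F *m cdiff (cdual N)) m n).
  rewrite !mxE !mulr_sumr -sumrN; apply: eq_bigr => n' _.
  rewrite [trdual F m n']mxE [cdiff (cdual N) n' n]mxE mul_mx_diag !mxE.
  have [->|fn] := eqVneq (F n' m) 0; first by rewrite !(mul0r, mulr0) oppr0.
  have [->|/cdiff_homog dn] := eqVneq (cdiff N n n') 0; first by rewrite !(mul0r, mulr0, oppr0).
  have -> : sg n m = sg n' m * (-1) ^ s * (-1) ^ dN n.
    rewrite dn mulrDl mul1r [LHS]signD -mulrA; congr (_ * _); rewrite (hF _ _ fn) !signD.
    have ss : (-1) ^ s * (-1) ^ s = 1 :> k := signE k s.
    move: ((-1) ^ s) ((-1) ^ dM m) ((-1) ^ 1%:Z) ss => x y z xx.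
    by rewrite -[LHS]mul1r -xx; ring.
  move: (sg n' m) ((-1) ^ s) ((-1) ^ dN n) (cdiff N n n') (F n' m) => x y z w v; ring.
have e2 : sg n m * ((-1) ^ s * (F *m cdiff M) n m) = - (cdiff (cdual M) *m trdual F) m n.
  rewrite !mxE !mulr_sumr -sumrN; apply: eq_bigr => m' _.
  rewrite [trdual F m' n]mxE [cdiff (cdual M) m m']mxE mul_mx_diag !mxE.
  have [->|fn] := eqVneq (F n m') 0; first by rewrite !(mul0r, mulr0) oppr0.
  have [->|/cdiff_homog dm] := eqVneq (cdiff M m' m) 0; first by rewrite !(mul0r, mulr0, oppr0).
  have -> : sg n m' = sg n m * ((-1) ^ dM m' * (-1) ^ s).
    by rewrite {1}dm addrA mulrDr mulr1 [LHS]signD; congr (_ * _); rewrite (hF _ _ fn) signD.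
  set x := (-1) ^ dM m'; have xx : x * x = 1 := signE k _.
  move: x (sg n m) ((-1) ^ s) (cdiff M m' m) (F n m') xx => x y z w v xx.
  by rewrite -[LHS]mul1r -xx; ring.
by rewrite mulrBr e1 e2 opprK addrC.
Qed.

Lemma dimk_trdual r : dimk (hthom M (cshift r N)) = dimk (hthom (cdual N) (cshift r (cdual M))).
Proof.
apply: (@dimk_hthom_shift_iso _ _ M N (cdual N) (cdual M) r trdual untrdual).
- by move=> c F G; apply/matrixP=> m n; rewrite !mxE mulrDr [c * (_ * _)]mulrCA.
- by move=> F; apply/matrixP=> n m; rewrite !mxE mulrA signE mul1r.
- by move=> G; apply/matrixP=> m n; rewrite !mxE mulrA signE mul1r.
- move=> s F; split=> hF i j.
    rewrite mxE mulf_eq0 negb_or => /andP[_ /hF]; rewrite /= /dual_deg => ->.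
    by rewrite opprD addrNK.
  move=> nz; have /hF : trdual F j i != 0 by rewrite mxE mulf_neq0 ?sgd_neq0.
  rewrite /= /dual_deg => e.
  by rewrite -[s](addKr (- dN i)) -e opprK addrC subrK.
- by move=> s f _; exact: trdual_modhom.
- exact: trdual_hdiff.
Qed.
End Duality.
End GroupAlgebraForms.

(** * The theorem *)

Section MainParts.
Variables (k : closedFieldType).

Lemma qT1_neq0 : 1 + qT != 0.
Proof.
rewrite /qT -tofrac1 -tofracD tofrac_eq0; apply/eqP => /(congr1 (fun p : {poly rat} => p`_1)).
by rewrite coefD coef1 coefX coef0 add0r => /eqP; rewrite oner_eq0.
Qed.

Lemma qconj_1T : qconj (1 + qT^-1)^-1 = (1 + qT)^-1.
Proof. by rewrite fmorphV rmorphD rmorph1 /= fmorphV /= qconjT invrK. Qed.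

Lemma lval_1T : lval (1 + lT 1) = 1 + qT.
Proof. by rewrite rmorphD rmorph1. Qed.

Variables (C : shiftcat k) (dist : triangle_class C).
Hypotheses (tri : triangulated dist) (ks : krull_schmidt C).
Hypotheses (hf : hom_finite C) (hb : hom_bounded C).
Variables (X Y Z : C) (a : mor X Y) (b : mor Y Z) (c : mor Z (sh C X)).
Hypothesis ar : AR_triangle dist a b c.

Lemma hform_AR_right (f : At C -> At C -> laurent) M : hform f -> indec M ->
  (~ (exists i, isomorphic M (shz Z i)) ->
     f (Atcls M) (Atcls X + Atcls Z - Atcls Y) = 0) /\
  (isomorphic M Z -> f (Atcls M) (Atcls X + Atcls Z - Atcls Y) = 1 + lT 1).
Proof.
move=> [sf fE] hM.
by rewrite (sesqBr (cj := lconj) sf) (sesqDr (cj := lconj) sf) !fE; exact: AR_form_right ar _ hM.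
Qed.

Lemma hform_AR_left (f : At C -> At C -> laurent) M : hform f -> indec M ->
  (~ (exists i, isomorphic M (shz X i)) ->
     f (Atcls X + Atcls Z - Atcls Y) (Atcls M) = 0) /\
  (isomorphic M X -> f (Atcls X + Atcls Z - Atcls Y) (Atcls M) = 1 + lT 1).
Proof.
move=> [sf fE] hM.
by rewrite (sesqBl sf) (sesqDl sf) !fE; exact: AR_form_left ar _ hM.
Qed.

Lemma hformQ_dual_right (F : AQt C -> AQt C -> Qt) : hformQ F ->
  dual_right F ((1 + qT^-1)^-1 *: (AQtcls X + AQtcls Z - AQtcls Y)) Z.
Proof.
move=> [sF FE].
have hZ : indec Z by case: ar.
have e M : F (AQtcls M) ((1 + qT^-1)^-1 *: (AQtcls X + AQtcls Z - AQtcls Y)) =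
    (1 + qT)^-1 * lval (lform M X + lform M Z - lform M Y).
  rewrite (sesqZr (cj := qconj) sF) (sesqBr (cj := qconj) sF) (sesqDr (cj := qconj) sF) !FE.
  by rewrite rmorphB rmorphD /= qconj_1T.
split=> [|M hM MZ]; rewrite e.
  have [_ ->] := AR_form_right tri ks hf hb ar hZ; last exact: isomorphic_refl.
  by rewrite lval_1T mulVf ?qT1_neq0.
have [-> // _] := AR_form_right tri ks hf hb ar hM.
by rewrite rmorph0 mulr0.
Qed.

Lemma hformQ_dual_left (F : AQt C -> AQt C -> Qt) : hformQ F ->
  dual_left F ((1 + qT)^-1 *: (AQtcls X + AQtcls Z - AQtcls Y)) X.
Proof.
move=> [sF FE].
have hX : indec X by case: ar.
have e M : F ((1 + qT)^-1 *: (AQtcls X + AQtcls Z - AQtcls Y)) (AQtcls M) =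
    (1 + qT)^-1 * lval (lform X M + lform Z M - lform Y M).
  by rewrite (sesqZl sF) (sesqBl sF) (sesqDl sF) !FE rmorphB rmorphD.
split=> [|M hM MX]; rewrite e.
  have [_ ->] := AR_form_left tri ks hf hb ar hX; last exact: isomorphic_refl.
  by rewrite lval_1T mulVf ?qT1_neq0.
have [-> // _] := AR_form_left tri ks hf hb ar hM.
by rewrite rmorph0 mulr0.
Qed.
End MainParts.

Theorem theorem4p3 (k : closedFieldType) :
  (forall (C : shiftcat k) (dist : triangle_class C),
    triangulated dist -> krull_schmidt C -> hom_finite C -> hom_bounded C ->
    (exists! f : At C -> At C -> laurent, hform f) /\
    (exists! F : AQt C -> AQt C -> Qt, hformQ F) /\
    (forall (X Y Z : C) (a : mor X Y) (b : mor Y Z) (c : mor Z (sh C X))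
        (f : At C -> At C -> laurent) (F : AQt C -> AQt C -> Qt),
      AR_triangle dist a b c -> hform f -> hformQ F ->
      let Zh := Atcls X + Atcls Z - Atcls Y in
      let ZhQ := AQtcls X + AQtcls Z - AQtcls Y in
      (forall M : C, indec M ->
        (~ (exists i, isomorphic M (shz Z i)) -> f (Atcls M) Zh = 0) /\
        (isomorphic M Z -> f (Atcls M) Zh = 1 + lT 1)) /\
      dual_right F ((1 + qT^-1)^-1 *: ZhQ) Z /\
      (forall M : C, indec M ->
        (~ (exists i, isomorphic M (shz X i)) -> f Zh (Atcls M) = 0) /\
        (isomorphic M X -> f Zh (Atcls M) = 1 + lT 1)) /\
      dual_left F ((1 + qT)^-1 *: ZhQ) X)) /\
  (forall L : falgType k, symmetric_algebra L ->
    (forall M N : Db L, lform M N = lconj (lform N M)) /\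
    (forall f : At (Db L) -> At (Db L) -> laurent, hform f ->
      forall x y, f x y = lconj (f y x)) /\
    (forall F : AQt (Db L) -> AQt (Db L) -> Qt, hformQ F ->
      forall x y, F x y = qconj (F y x))) /\
  (forall (gT : finGroupType) (M N U : Db (galg k gT)),
    (exists (pMU : perfect (ctens M U)) (pUN : perfect (ctens (cdual U) N)),
      lform (Perf pMU : Db (galg k gT)) N = lform M (Perf pUN : Db (galg k gT))) /\
    (exists (pM : perfect (cdual M)) (pN : perfect (cdual N)),
      lform M N = lform (Perf pN : Db (galg k gT)) (Perf pM : Db (galg k gT)) /\
      lform M N = lconj (lform (Perf pM : Db (galg k gT)) (Perf pN : Db (galg k gT))))).
Proof.
split; [|split].
- move=> C dist tri ks hf hb.
  have bp := tr_biprod tri; have dec := ks_exists ks.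
  split; [|split].
  + have [f hform_f] := hform_ex bp dec hb hf.
    by exists f; split=> // g; exact: hform_uniq.
  + have [F hformQ_F] := hformQ_ex bp dec hb hf.
    by exists F; split=> // G; exact: hformQ_uniq.
  + move=> X Y Z a b c f F ar hform_f hformQ_F Zh ZhQ.
    split; first by move=> M; exact: (hform_AR_right tri ks hf hb ar).
    split; first exact: (hformQ_dual_right tri ks hf hb ar).
    split; first by move=> M; exact: (hform_AR_left tri ks hf hb ar).
    exact: (hformQ_dual_left tri ks hf hb ar).
- move=> L /symmetric_dual_bases[d [lam [a [b ab]]]].
  have herm := lform_hermitian ab.
  split=> //; split=> [f hform_f|F hformQ_F].
    exact: (hform_hermitian (Db_biprod ab) herm hform_f).
  exact: (hformQ_hermitian (Db_biprod ab) herm hformQ_F).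
move=> gT M N U; split.
  exists (ctens_perfectl (Y := U) (@perfP _ _ M)), (ctens_perfectr (X := cdual U) (@perfP _ _ N)).
  by apply: eq_hilb => i; rewrite !dimk_Db; exact: dimk_adj.
exists (cdual_perfect (@perfP _ _ M)), (cdual_perfect (@perfP _ _ N)).
have e : lform M N = lform (Perf (cdual_perfect (@perfP _ _ N)) : Db (galg k gT))
    (Perf (cdual_perfect (@perfP _ _ M)) : Db (galg k gT)).
  by apply: eq_hilb => i; rewrite !dimk_Db; exact: dimk_trdual.
by split=> //; rewrite e; exact: (lform_hermitian (galg_dual_bases k gT)).
Qed.
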